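(* Let $M$ be a complete, connected, oriented $n$-dimensional self-shrinker hypersurface properly immersed in $\mathbb{R}^{n+1}$, with Gauss map $\gamma:M\to S^n$. (i) If $\gamma(M)$ is contained in an open hemisphere of $S^n$, then $M$ is a hyperplane. (ii) If $\gamma(M)$ is contained in a closed hemisphere of $S^n$, then $M$ is a hyperplane or a cylinder whose cross section is an $(n-1)$-dimensional self-shrinker in $\mathbb{R}^n$.
   Context: A self-shrinker is an immersed submanifold $X:M\to\mathbb{R}^{n+1}$ satisfying $H=-\frac12 X^N$, where $X$ is the position vector, $X^N$ its orthogonal projection onto the normal bundle, and the mean curvature vector $H$ is the trace of the second fundamental form $B_{VW}=(\overline\nabla_VW)^N$ with respect to the induced metric (no factor $1/n$; $\overline\nabla$ is the flat connection of $\mathbb{R}^{n+1}$). $M$ carries the induced metric, which is assumed complete. The Gauss map $\gamma$ sends $p\in M$ to the oriented $n$-plane parallel to $T_pM$ through the origin; the Grassmannian of oriented $n$-planes in $\mathbb{R}^{n+1}$ is identified with the unit sphere $S^n\subset\mathbb{R}^{n+1}$, so $\gamma(p)$ is the oriented unit normal at $p$. An open (resp. closed) hemisphere of $S^n$ is a set $\{x\in S^n:(x,a)>0\}$ (resp. $\{x\in S^n:(x,a)\ge 0\}$) for some $a\in S^n$, where $(\cdot,\cdot)$ is the Euclidean inner product. A cylinder whose cross section is an $(n-1)$-dimensional self-shrinker in $\mathbb{R}^n$ means that, after identifying $\mathbb{R}^{n+1}=\mathbb{R}^n\times\mathbb{R}$ by a rotation, $M=\widetilde M\times\mathbb{R}$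 with $\widetilde M$ an $(n-1)$-dimensional (immersed) self-shrinker in $\mathbb{R}^n$. *)

(* Defs.v *)
From HB Require Import structures.
From mathcomp Require Export all_boot all_order all_algebra.
From mathcomp Require Export all_classical all_reals all_analysis.
Export Order.TTheory GRing.Theory Num.Theory.
Export numFieldNormedType.Exports.

Set Implicit Arguments.
Unset Strict Implicit.
Unset Printing Implicit Defensive.

Global Open Scope classical_set_scope.
Global Open Scope ring_scope.

(* Points and vectors of R^N are row vectors.  The library norm on them is the
   sup norm (same topology and same derivatives as the Euclidean one), so the
   Euclidean structure is introduced through [dot]. *)
Definition dot (R : realType) (N : nat) (u v : 'rV[R]_N) : R :=
  \sum_(i < N) u 0 i * v 0 i.

Definition unit_sphere (R : realType) (N : nat) : set 'rV[R]_N :=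
  [set x | dot x x = 1].

Definition open_hemisphere (R : realType) (N : nat) (a : 'rV[R]_N) :
    set 'rV[R]_N :=
  [set x | unit_sphere x /\ 0 < dot x a].

Definition closed_hemisphere (R : realType) (N : nat) (a : 'rV[R]_N) :
    set 'rV[R]_N :=
  [set x | unit_sphere x /\ 0 <= dot x a].

Definition hyperplane (R : realType) (N : nat) (a : 'rV[R]_N) (c : R) :
    set 'rV[R]_N :=
  [set x | dot x a = c].

Definition rotation (R : realType) (N : nat) (Q : 'M[R]_N) : Prop :=
  Q *m Q^T = 1%:M /\ \det Q = 1.

(* Only meant for open U and finite-dimensional V, where it is the usual
   notion; values of f outside U are irrelevant. *)
Fixpoint Ck_on (R : realType) (V W : normedModType R) (k : nat) (U : set V)
    (f : V -> W) : Prop :=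
  match k with
  | 0 => forall x, U x -> {for x, continuous f}
  | k'.+1 => (forall x, U x -> differentiable f x) /\
             (forall v : V, Ck_on k' U (fun x => 'D_v f x))
  end.

Definition smooth_on (R : realType) (V W : normedModType R) (U : set V)
    (f : V -> W) : Prop :=
  forall k, Ck_on k U f.

(** Smooth manifolds *)

(* A chart is given by a local parametrization [cmap], defined on [cdom], and
   its inverse [cinv], defined on [crange]; both are junk elsewhere. *)
Record chart (R : realType) (n : nat) (M : Type) := Chart {
  cdom : set 'rV[R]_n ;
  cmap : 'rV[R]_n -> M ;
  cinv : M -> 'rV[R]_n }.

Definition crange (R : realType) (n : nat) (M : Type) (phi : chart R n M) :
    set M :=
  cmap phi @` cdom phi.

Definition is_chart (R : realType) (n : nat) (M : topologicalType)
    (phi : chart R n M) : Prop :=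
  [/\ open (cdom phi), open (crange phi),
      {within cdom phi, continuous (cmap phi)},
      {within crange phi, continuous (cinv phi)} &
      forall x, cdom phi x -> cinv phi (cmap phi x) = x].

Definition overlap (R : realType) (n : nat) (M : Type)
    (phi psi : chart R n M) : set 'rV[R]_n :=
  cdom phi `&` cmap phi @^-1` crange psi.

Definition smooth_atlas (R : realType) (n : nat) (M : topologicalType)
    (A : set (chart R n M)) : Prop :=
  [/\ forall phi, A phi -> is_chart phi,
      forall p, exists2 phi, A phi & crange phi p &
      forall phi psi, A phi -> A psi ->
        smooth_on (overlap phi psi) (cinv psi \o cmap phi)].

Definition smooth_manifold (R : realType) (n : nat) (M : topologicalType)
    (A : set (chart R n M)) : Prop :=
  [/\ hausdorff_space M, @second_countable M & smooth_atlas A].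

Definition oriented_atlas (R : realType) (n : nat) (M : topologicalType)
    (A : set (chart R n M)) : Prop :=
  forall phi psi, A phi -> A psi -> forall x, overlap phi psi x ->
    0 < \det (jacobian (cinv psi \o cmap phi) x).

Definition smooth_map (R : realType) (m n : nat) (M M' : topologicalType)
    (A : set (chart R m M)) (A' : set (chart R n M')) (f : M -> M') : Prop :=
  continuous f /\
  forall phi psi, A phi -> A' psi ->
    smooth_on (cdom phi `&` (f \o cmap phi) @^-1` crange psi)
              (cinv psi \o f \o cmap phi).

Definition diffeomorphism (R : realType) (m n : nat) (M M' : topologicalType)
    (A : set (chart R m M)) (A' : set (chart R n M')) (f : M -> M') : Prop :=
  exists g : M' -> M,
    [/\ cancel f g, cancel g f, smooth_map A A' f & smooth_map A' A g].

(* The product of the real line and a manifold.  The line is the first factor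
   so that the dimension 1 + n reduces to n.+1. *)
Definition line_chart (R : realType) (n : nat) (M : Type) (phi : chart R n M) :
    chart R n.+1 (R * M) :=
  @Chart R n.+1 (R * M)
    [set y : 'rV[R]_(1 + n) | cdom phi (rsubmx y)]
    (fun y : 'rV[R]_(1 + n) => (lsubmx y 0 0, cmap phi (rsubmx y)))
    (fun tq => row_mx (tq.1%:M : 'rV[R]_1) (cinv phi tq.2)).

Definition line_atlas (R : realType) (n : nat) (M : Type)
    (A : set (chart R n M)) : set (chart R n.+1 (R * M)) :=
  (@line_chart R n M) @` A.

(** Immersed submanifolds of Euclidean space *)

(* Row i of [jacobian F x] is the i-th partial derivative of F at x, so for
   F := X \o cmap phi the row space of [jacobian F x] is the tangent space. *)
Definition immersion (R : realType) (n N : nat) (M : topologicalType)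
    (A : set (chart R n M)) (X : M -> 'rV[R]_N) : Prop :=
  forall phi, A phi ->
    smooth_on (cdom phi) (X \o cmap phi) /\
    forall x, cdom phi x -> row_free (jacobian (X \o cmap phi) x).

Definition proper_map (S T : topologicalType) (f : S -> T) : Prop :=
  continuous f /\ forall K : set T, compact K -> compact (f @^-1` K).

(* Continuous curves on [0, 1], of class C^1 away from finitely many points. *)
Definition piecewise_C1 (R : realType) (n : nat) (M : topologicalType)
    (A : set (chart R n M)) (c : R -> M) : Prop :=
  {within `[0, 1]%classic, continuous c} /\
  exists s : seq R, forall phi, A phi ->
    Ck_on 1 ((`]0, 1[%classic `\` [set` s]) `&` c @^-1` crange phi)
          (cinv phi \o c).

(* Length for the induced metric, i.e. of the velocity of X \o c. *)
Definition curve_length (R : realType) (N : nat) (M : Type)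
    (X : M -> 'rV[R]_N) (c : R -> M) : \bar R :=
  (\int[lebesgue_measure]_(t in `[0%R, 1%R]%classic)
     (Num.sqrt (dot (derive1 (X \o c) t) (derive1 (X \o c) t)))%:E)%E.

(* +oo when no curve joins p to q. *)
Definition riemannian_dist (R : realType) (n N : nat) (M : topologicalType)
    (A : set (chart R n M)) (X : M -> 'rV[R]_N) (p q : M) : \bar R :=
  ereal_inf [set curve_length X c |
               c in [set c | [/\ piecewise_C1 A c, c 0 = p & c 1 = q]]].

Definition complete_immersion (R : realType) (n N : nat) (M : topologicalType)
    (A : set (chart R n M)) (X : M -> 'rV[R]_N) : Prop :=
  forall u : nat -> M,
    (forall e : R, 0 < e -> exists K : nat, forall i j : nat,
       (K <= i)%N -> (K <= j)%N ->
       (riemannian_dist A X (u i) (u j) < e%:E)%E) ->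
    exists p : M, forall e : R, 0 < e -> exists K : nat, forall i : nat,
       (K <= i)%N -> (riemannian_dist A X (u i) p < e%:E)%E.

(* The rows of [kermx J^T] span the orthogonal complement of the row space
   of J, so this is the projection onto the normal space along the tangent
   space. *)
Definition normal_part (R : realType) (n N : nat)
    (F : 'rV[R]_n -> 'rV[R]_N) (x : 'rV[R]_n) (w : 'rV[R]_N) : 'rV[R]_N :=
  let J := jacobian F x in w *m proj_mx (kermx J^T) <<J>>%MS.

Definition induced_metric (R : realType) (n N : nat)
    (F : 'rV[R]_n -> 'rV[R]_N) (x : 'rV[R]_n) : 'M[R]_n :=
  \matrix_(i, j) dot ('D_(delta_mx 0 i) F x) ('D_(delta_mx 0 j) F x).

(* B_{VW} for the coordinate fields V = d_i F and W = d_j F. *)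
Definition second_fundamental_form (R : realType) (n N : nat)
    (F : 'rV[R]_n -> 'rV[R]_N) (x : 'rV[R]_n) (i j : 'I_n) : 'rV[R]_N :=
  normal_part F x ('D_(delta_mx 0 i) (fun y => 'D_(delta_mx 0 j) F y) x).

Definition mean_curvature (R : realType) (n N : nat)
    (F : 'rV[R]_n -> 'rV[R]_N) (x : 'rV[R]_n) : 'rV[R]_N :=
  \sum_(i < n) \sum_(j < n)
    invmx (induced_metric F x) i j *: second_fundamental_form F x i j.

Definition self_shrinker (R : realType) (n N : nat) (M : topologicalType)
    (A : set (chart R n M)) (X : M -> 'rV[R]_N) : Prop :=
  immersion A X /\
  forall phi, A phi -> forall x, cdom phi x ->
    let F := X \o cmap phi in
    mean_curvature F x = - (2^-1 *: normal_part F x (F x)).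

(* The oriented n-plane spanned by the positively oriented tangent frame
   d_1 F, ..., d_n F is identified with the unit normal nu such that
   (nu, d_1 F, ..., d_n F) is a positive basis.  The opposite convention
   replaces gamma by - gamma. *)
Definition is_gauss_map (R : realType) (n : nat) (M : topologicalType)
    (A : set (chart R n M)) (X : M -> 'rV[R]_n.+1)
    (gamma : M -> 'rV[R]_n.+1) : Prop :=
  forall phi, A phi -> forall x, cdom phi x ->
    let J := jacobian (X \o cmap phi) x in
    let nu := gamma (cmap phi x) in
    [/\ unit_sphere nu, J *m nu^T = 0 &
        0 < \det (col_mx nu J : 'M[R]_(1 + n))].

(* A bijective immersion of M onto a hyperplane is automatically a
   diffeomorphism by the inverse function theorem. *)
Definition is_hyperplane (R : realType) (N : nat) (M : Type)
    (X : M -> 'rV[R]_N) : Prop :=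
  exists a : 'rV[R]_N, exists c : R,
    [/\ a != 0, injective X & range X = hyperplane a c].

Definition is_cylinder (R : realType) (n : nat) (M : topologicalType)
    (A : set (chart R n.+1 M)) (X : M -> 'rV[R]_n.+2) : Prop :=
  exists (M' : topologicalType) (A' : set (chart R n M'))
         (Y : M' -> 'rV[R]_n.+1) (Q : 'M[R]_n.+2) (Phi : R * M' -> M),
    [/\ smooth_manifold A', self_shrinker A' Y /\ complete_immersion A' Y,
        rotation Q, diffeomorphism (line_atlas A') A Phi &
        forall (t : R) (q : M'),
          X (Phi (t, q)) = (row_mx (t%:M : 'rV[R]_1) (Y q)) *m Q].

(* Main.v *)
Require Import Defs.
From mathcomp Require Import ring lra.

(* Let [a] be the pole of the hemisphere, [w = (gamma, a) >= 0] and
   [V = |X|^2].  Near each point M is the graph, over its tangent plane, of a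
   function [f] with [g^ij f_ij = (x . Df - f) / 2]; in this gauge every
   directional derivative of [f] solves a linear elliptic equation without
   zero-order term, and [w = (1 + |Df|^2)^(-1/2) (a0 + D_b f)] for constants
   [a0] and [b].

   Properness gives a minimum of [w + eps V] for every [eps > 0], and the
   elliptic equation, in which [V] contributes [2 n - |X|^2], forces [V <= 2 n]
   there; letting [eps] tend to 0, [w] attains its minimum [c] at some [p].  The
   function [(gamma, a - c gamma(p))] is nonnegative and vanishes at [p], so by
   Hopf's strong maximum principle it vanishes identically.  If [c > 0] this
   makes [gamma] constant, and if [c = 0] it says that [a] is tangent to M
   everywhere.

   When [a] is tangent everywhere, translations along [a] lift to a flow on M,
   properness making it complete.  If [gamma] is constant this holds for all
   directions of the plane, and the flows retract M onto a fibre of [X], which is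
   discrete, so that [X] is injective.  If [a] is merely tangent, the flow
   identifies M with the product of the line and [{(X, a) = 0}].  The
   projection of M onto this cross section and its inclusion do not increase
   distances, so that the cross section is complete. *)

Set Implicit Arguments.
Unset Strict Implicit.
Unset Printing Implicit Defensive.

(** * C^k maps *)

(** The function [w] itself satisfies an equation with a zero-order term, the squared norm of the
    second fundamental form. In a fixed frame the factor (1 + |Df|^2)^(1/2) removes it: the
    derivative of x . Df - f along v is x . D(D_v f), because the two terms D_v f cancel. The price
    is that the product depends on the patch and agrees with [w] only at its centre. Since w >= 0
    and the factor is at least 1, with equality at the centre, a global minimum of w + eps V is
    still a local minimum of the product plus eps V, which is all that the second-derivative test
    uses. Hence neither a Laplacian on M nor any integral estimate enters. The bound 2 n arises at
    the centre, where Df = 0: the equation reads Delta f = - f / 2, the drift is - x / 2, and the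
    operator sends |x|^2 + f^2 to 2 n - |x|^2 - f^2. It does not involve eps, so all the minimum
    points lie in one compact set. For c > 0, nonnegativity of (gamma, a - c gamma(p)) is w >= c
    together with (gamma, gamma(p)) <= 1. The flow is never differentiated: X of it is explicit, and
    a continuous map into M is as smooth as its composite with X. *)

Section rV_norm.
Context {R : realType} {N : nat}.
Implicit Types x y : 'rV[R]_N.

Lemma ler_norm_coord x i : `|x 0 i| <= `|x|.
Proof.
rewrite [leRHS]/Num.Def.normr/= mx_normrE.
exact: (le_bigmax _ (fun ij : 'I_1 * 'I_N => `|x ij.1 ij.2|) (0, i)).
Qed.

Lemma rV_norm_le x (e : R) :
  0 <= e -> (forall i, `|x 0 i| <= e) -> `|x| <= e.
Proof.
move=> e0 xe; rewrite [leLHS]/Num.Def.normr/= mx_normrE.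
by apply: bigmax_le => //= -[i j] _ /=; rewrite ord1.
Qed.

Lemma rV_norm_lt x (e : R) :
  0 < e -> (forall i, `|x 0 i| < e) -> `|x| < e.
Proof.
move=> e0 xe; rewrite [ltLHS]/Num.Def.normr/= mx_normrE.
by apply: bigmax_lt => //= -[i j] _ /=; rewrite ord1.
Qed.

Lemma cvg_rV (T : Type) (F : set_system T) {FF : Filter F}
    (f : T -> 'rV[R]_N) (l : 'rV[R]_N) :
  (forall i, f x 0 i @[x --> F] --> l 0 i) -> f @ F --> l.
Proof.
move=> fl; apply/cvgrPdist_lt => e e0.
near=> x; apply: rV_norm_lt => // i; rewrite !mxE.
move: i; near: x; apply: filter_forall => i.
by move/cvgrPdist_lt : (fl i) => /(_ e e0).
Unshelve. all: by end_near. Qed.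

Lemma cvg_coord (T : Type) (F : set_system T) {FF : Filter F}
    (f : T -> 'rV[R]_N) (l : 'rV[R]_N) i :
  f @ F --> l -> f x 0 i @[x --> F] --> l 0 i.
Proof.
move=> fl; apply: (@continuous_cvg _ _ _ _ _ f (fun v : 'rV[R]_N => v 0 i)) => //.
exact: coord_continuous.
Qed.

End rV_norm.

Section Ck.
Context {R : realType}.
Implicit Types (V W : normedModType R) (k : nat).

Lemma near_eq_continuous (S T : topologicalType) (f g : S -> T) x :
  {near x, f =1 g} -> {for x, continuous f} -> {for x, continuous g}.
Proof.
move=> fg fx; have gx := nbhs_singleton fg.
rewrite /prop_for /continuous_at -gx.
by apply: cvg_trans fx; apply: near_eq_cvg; apply: filterS fg => y ->.
Qed.

Lemma near_eq_differentiable V W (f g : V -> W) x :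
  {near x, f =1 g} -> differentiable f x -> differentiable g x.
Proof.
move=> fg /diff_locallyP[df fE].
have gE : g \o shift x = cst (g x) + 'd f x +o_0 id.
  apply/eqaddoP => e e0.
  have {}fE := (eqaddoP _ _ _ _).1 fE e e0.
  have fg0' : \forall h \near (0 : V), f (h + x) = g (h + x).
    have : (fun h : V => h + x) @ (0 : V) --> x.
      rewrite -[X in _ --> X]add0r; apply: cvgD; [exact: cvg_id|exact: cvg_cst].
    by move=> /(_ _ fg).
  near=> h.
  have -> : (g \o shift x - (cst (g x) + 'd f x)) h
          = (f \o shift x - (cst (f x) + 'd f x)) h.
    rewrite -![(_ - _ : _ -> _) _]/(_ - _) /= -![(_ + _ : _ -> _) _]/(_ + _) /=.
    by rewrite (nbhs_singleton fg); congr (_ - _); apply/esym; near: h.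
  by near: h.
by apply/diff_locallyP; rewrite (diff_unique df gE).
Unshelve. all: by end_near. Qed.

Lemma near_derive_eq V W (f g : V -> W) (x v : V) :
  {near x, f =1 g} -> \forall y \near x, 'D_v f y = 'D_v g y.
Proof.
move=> fg; have := @nbhs_interior _ x _ fg; apply: filterS => y yfg.
exact: near_eq_derive.
Qed.

Lemma Ck_on_local V W k U (f : V -> W) :
  (forall x, U x -> exists2 O : set V, nbhs x O & Ck_on k O f) -> Ck_on k U f.
Proof.
elim: k U f => [|k IH] U f /= Uf.
  by move=> x /Uf[B Bx] fO; apply: fO; exact: nbhs_singleton Bx.
split=> [x /Uf[B Bx] [fO _]|v]; first by apply: fO; exact: nbhs_singleton Bx.
by apply: IH => x /Uf[B Bx] [_ fO]; exists B.
Qed.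

Lemma Ck_on_sub V W k (U O : set V) (f : V -> W) :
  U `<=` O -> Ck_on k O f -> Ck_on k U f.
Proof.
elim: k f => [|k IH] f UO /=; first by move=> fO x /UO; exact: fO.
by move=> [fO Df]; split=> [x /UO|v]; [exact: fO|exact: IH].
Qed.

(** A derivative at a boundary point of [U] sees values outside [U], hence agreement is asked on a
    neighbourhood of each point. For open [U] this becomes agreement on [U], as in [Ck_on_ext]. *)
Lemma Ck_on_near_eq V W k (U : set V) (f g : V -> W) :
  (forall x, U x -> {near x, f =1 g}) -> Ck_on k U f -> Ck_on k U g.
Proof.
elim: k f g => [|k IH] f g fg /=.
  by move=> Uf x Ux; exact: near_eq_continuous (fg _ Ux) (Uf _ Ux).
move=> [Uf Df]; split=> [x Ux|v].
  exact: near_eq_differentiable (fg _ Ux) (Uf _ Ux).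
by apply: IH (Df v) => x /fg; exact: near_derive_eq.
Qed.

Lemma Ck_on_ext V W k (U : set V) (f g : V -> W) :
  open U -> {in U, f =1 g} -> Ck_on k U f -> Ck_on k U g.
Proof.
move=> Uo fg; apply: Ck_on_near_eq => x Ux.
by apply: filterS (open_nbhs_nbhs (conj Uo Ux)) => y Uy; apply/fg/mem_set.
Qed.

Lemma Ck_onW V W k (U : set V) (f : V -> W) : Ck_on k.+1 U f -> Ck_on k U f.
Proof.
elim: k f => [|k IH] f.
  by move=> [Uf _] x /Uf; exact: differentiable_continuous.
move=> [Uf Df]; split=> // v; exact: IH.
Qed.

Lemma Ck_on_cst V W k (U : set V) (a : W) : Ck_on k U (cst a).
Proof.
elim: k a => [|k IH] a; first by move=> x _; exact: cst_continuous.
split=> // v.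
by rewrite (_ : 'D_v (cst a) = cst 0) //; apply/funext => x; rewrite derive_cst.
Qed.

Lemma Ck_on_linear V W k (U : set V) (f : {linear V -> W}) :
  continuous f -> Ck_on k U f.
Proof.
move=> fc; case: k => [|k]; first by move=> x _; exact: fc.
split=> [x _|v]; first exact: linear_differentiable.
rewrite (_ : 'D_v f = cst (f v)); first exact: Ck_on_cst.
apply/funext => x; rewrite deriveE; last exact: linear_differentiable.
by rewrite diff_lin.
Qed.

Lemma Ck_onD V W k (U : set V) (f g : V -> W) : open U ->
  Ck_on k U f -> Ck_on k U g -> Ck_on k U (f \+ g).
Proof.
move=> Uo; elim: k f g => [|k IH] f g.
  by move=> Uf Ug x Ux; apply: continuousD; [exact: Uf|exact: Ug].
move=> [Uf Df] [Ug Dg]; split=> [x Ux|v].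
  by apply: differentiableD; [exact: Uf|exact: Ug].
apply: Ck_on_ext (IH _ _ (Df v) (Dg v)) => // x /set_mem Ux /=.
by rewrite deriveD//; apply: diff_derivable; [exact: Uf|exact: Ug].
Qed.

Lemma Ck_onM V k (U : set V) (f g : V -> R) : open U ->
  Ck_on k U f -> Ck_on k U g -> Ck_on k U (f \* g).
Proof.
move=> Uo; elim: k f g => [|k IH] f g.
  by move=> Uf Ug x Ux; apply: continuousM; [exact: Uf|exact: Ug].
move=> fk gk; case: (fk) => Uf Df; case: (gk) => Ug Dg; split=> [x Ux|v].
  by apply: differentiableM; [exact: Uf|exact: Ug].
have := Ck_onD Uo (IH _ _ (Ck_onW fk) (Dg v)) (IH _ _ (Ck_onW gk) (Df v)).
apply: Ck_on_ext => // x /set_mem Ux /=.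
by rewrite deriveM//; apply: diff_derivable; [exact: Uf|exact: Ug].
Qed.

Lemma Ck_on_sum V W k (U : set V) (I : Type) (r : seq I) (P : pred I)
    (f : I -> V -> W) : open U ->
  (forall i, P i -> Ck_on k U (f i)) ->
  Ck_on k U (fun x => \sum_(i <- r | P i) f i x).
Proof.
move=> Uo Uf; elim: r => [|i r IH].
  by under eq_fun do rewrite big_nil; exact: Ck_on_cst.
under eq_fun do rewrite big_cons.
by case Pi: (P i) => //; apply: Ck_onD => //; exact: Uf.
Qed.

Lemma Ck_onV V k (U : set V) (f : V -> R) : open U ->
  (forall x, U x -> f x != 0) -> Ck_on k U f -> Ck_on k U (fun x => (f x)^-1).
Proof.
move=> Uo f0; elim: k f f0 => [|k IH] f f0.
  by move=> Uf x Ux; apply: cvgV; [exact: f0|exact: Uf].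
move=> fk; case: (fk) => Uf Df; split=> [x Ux|v].
  by apply: (@differentiableV _ _ f); [exact: Uf|exact: f0].
have fV := IH _ f0 (Ck_onW fk).
have := Ck_onM Uo (@Ck_on_cst V R k U (-1)) (Ck_onM Uo (Ck_onM Uo fV fV) (Df v)).
apply: Ck_on_ext => // x /set_mem Ux /=.
rewrite (@deriveV _ _ f) ?f0//; last by apply: diff_derivable; exact: Uf.
rewrite -[_ *: _]/(_ * _) -exprVn expr2 mulN1r mulNr; ring.
Qed.

Lemma rV_sum_delta V N (f : V -> 'rV[R]_N) :
  f = (fun x => \sum_(i < N) f x 0 i *: delta_mx 0 i).
Proof. by apply/funext => x; rewrite -row_sum_delta. Qed.

Lemma differentiable_rV V N (f : V -> 'rV[R]_N) x :
  (forall i, differentiable (fun y => f y 0 i) x) -> differentiable f x.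
Proof.
move=> fx; rewrite (rV_sum_delta f).
rewrite (_ : (fun _ => _) =
   \sum_(i < N) (fun y => f y 0 i *: (delta_mx 0 i : 'rV[R]_N))); last first.
  by apply/funext => y; rewrite fct_sumE.
by apply: differentiable_sum => i; exact: differentiableZl.
Qed.

Lemma differentiable_coord_rV V N (f : V -> 'rV[R]_N) x i :
  differentiable f x -> differentiable (fun y => f y 0 i) x.
Proof.
move=> fx; apply: (@differentiable_comp _ _ _ _ f (fun M : 'rV[R]_N => M 0 i)) => //.
exact: differentiable_coord.
Qed.

Lemma derive_coord V N (f : V -> 'rV[R]_N) x v i :
  differentiable f x -> 'D_v f x 0 i = 'D_v (fun y => f y 0 i) x.
Proof. by move=> fx; rewrite derive_mx ?mxE//; exact: diff_derivable. Qed.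

Lemma Ck_on_rV V N k (U : set V) (f : V -> 'rV[R]_N) : open U ->
  Ck_on k U f <-> forall i, Ck_on k U (fun x => f x 0 i).
Proof.
move=> Uo; elim: k f => [|k IH] f; split.
- move=> Uf i x Ux; apply: (@cvg_coord _ _ _ (nbhs x) _ f _ i); exact: Uf.
- by move=> Uf x Ux; apply: cvg_rV => i; exact: Uf.
- move=> [Uf Df] i; split=> [x Ux|v].
    by apply: differentiable_coord_rV; exact: Uf.
  have /IH/(_ i) := Df v; apply: Ck_on_ext => // x /set_mem Ux.
  by rewrite derive_coord//; exact: Uf.
- move=> Uf; have fd x : U x -> differentiable f x.
    by move=> Ux; apply: differentiable_rV => i; have [+ _] := Uf i; exact.
  split=> // v; apply/IH => i; have [_ /(_ v)] := Uf i.
  apply: Ck_on_ext => // x /set_mem Ux.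
  by rewrite derive_coord//; exact: fd.
Qed.

Lemma derive_comp V W N (f : V -> 'rV[R]_N) (g : 'rV[R]_N -> W) x v :
  differentiable f x -> differentiable g (f x) ->
  'D_v (g \o f) x = 'D_('D_v f x) g (f x).
Proof.
move=> fx gx; rewrite deriveE; last exact: differentiable_comp.
by rewrite diff_comp// deriveE// [in RHS]deriveE.
Qed.

Lemma derive_delta W N (g : 'rV[R]_N -> W) x v : differentiable g x ->
  'D_v g x = \sum_(i < N) v 0 i *: 'D_(delta_mx 0 i) g x.
Proof.
move=> gx; rewrite deriveE// {1}(row_sum_delta v) linear_sum.
by apply: eq_bigr => i _; rewrite linearZ/= deriveE.
Qed.

(** By the chain rule in coordinates, the derivative of the composite is a sum of products of a
    derivative of [f] with a partial derivative of [g] composed with [f]. The latter is handled by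
    induction on [k], and a real-valued [g] keeps these products scalar. *)
Lemma Ck_on_comp V N k (U : set V) (O : set 'rV[R]_N) (f : V -> 'rV[R]_N)
    (g : 'rV[R]_N -> R) : open U -> (forall x, U x -> O (f x)) ->
  Ck_on k U f -> Ck_on k O g -> Ck_on k U (g \o f).
Proof.
move=> Uo UO; elim: k f g UO => [|k IH] f g UO.
  by move=> Uf Og x Ux; apply: continuous_comp; [exact: Uf|apply/Og/UO].
move=> fk gk; case: (fk) => Uf Df; case: (gk) => Og Dg; split=> [x Ux|v].
  by apply: differentiable_comp; [exact: Uf|apply/Og/UO].
have : Ck_on k U (fun x => \sum_(i < N) 'D_v f x 0 i *
                     ('D_(delta_mx 0 i) g \o f) x).
  apply: Ck_on_sum => // i _; apply: Ck_onM => //.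
    by have /(@Ck_on_rV _ _ _ _ _ Uo)/(_ i) := Df v.
  by apply: IH => //; [exact: Ck_onW|exact: Dg].
apply: Ck_on_ext => // x /set_mem Ux.
have gx := Og _ (UO _ Ux).
by rewrite derive_comp ?derive_delta//; exact: Uf.
Qed.

Lemma Ck_on_comp_rV V N N' k (U : set V) (O : set 'rV[R]_N) (f : V -> 'rV[R]_N)
    (g : 'rV[R]_N -> 'rV[R]_N') :
  open U -> open O -> (forall x, U x -> O (f x)) ->
  Ck_on k U f -> Ck_on k O g -> Ck_on k U (g \o f).
Proof.
move=> Uo Oo UO fk gk; apply/Ck_on_rV => // i.
apply: (@Ck_on_comp _ _ _ _ O f (fun y => g y 0 i)) => //.
by have /(@Ck_on_rV _ _ _ _ _ Oo)/(_ i) := gk.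
Qed.

End Ck.

(** * The mean value theorem along lines, and symmetry of second derivatives *)

Section mean_value.
Context {R : realType} {V : normedModType R}.
Implicit Types (g : V -> R) (x u v : V).

Lemma is_diff_line x u (s : R) :
  is_diff s (fun s : R => x + s *: u) ( *:%R^~ u).
Proof.
by apply: is_diff_eq; rewrite add0r.
Qed.

Lemma is_derive_line (W : normedModType R) (g : V -> W) x u (s : R) :
  differentiable g (x + s *: u) ->
  is_derive s 1 (fun s : R => g (x + s *: u)) ('D_u g (x + s *: u)).
Proof.
move=> gx; have [lx dl] := is_diff_line x u s.
have cx : differentiable (g \o (fun s : R => x + s *: u)) s.
  exact: differentiable_comp.
apply: DeriveDef; first exact: diff_derivable.
rewrite (_ : (fun _ => _) = g \o (fun s : R => x + s *: u))// deriveE//.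
by rewrite diff_comp// dl /= scale1r deriveE.
Qed.

Lemma mean_value_line g x u (t : R) : 0 < t ->
  (forall s, 0 <= s <= t -> differentiable g (x + s *: u)) ->
  exists2 s, 0 < s < t & g (x + t *: u) - g x = t * 'D_u g (x + s *: u).
Proof.
move=> t0 gd.
have [||s] := @MVT R (fun s => g (x + s *: u)) (fun s => 'D_u g (x + s *: u)) 0 t t0.
- move=> s; rewrite in_itv/= => /andP[/ltW s0 /ltW st].
  by apply: is_derive_line; apply: gd; rewrite s0.
- apply: continuous_in_subspaceT => s; rewrite inE/= in_itv/= => st.
  apply: differentiable_continuous; apply/derivable1_diffP.
  by have [] := is_derive_line (gd _ st).
rewrite in_itv/= scale0r addr0 subr0 => st E; exists s => //.
by rewrite E mulrC.
Qed.

Lemma eq_of_common_approx (a b : R) :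
  (forall e : R, 0 < e -> exists2 p, `|p - b| < e & `|p - a| < e) -> a = b.
Proof.
move=> ab; apply/eqP; rewrite -subr_eq0 -normr_le0; apply/ler_addgt0Pr => e e0.
have [|p pb pa] := ab (e / 2); first lra.
have -> : a - b = (p - b) - (p - a) by ring.
by rewrite add0r (splitr e) (le_trans (ler_normB _ _))// lerD// ltW.
Qed.

(** The second difference of [g] over the parallelogram spanned by t u and t v is symmetric in u and
    v. Two applications of the mean value theorem show that, divided by t^2, it tends to either
    mixed derivative. *)
Lemma Schwarz g (U : set V) x u v : open U -> U x -> Ck_on 2 U g ->
  'D_u ('D_v g) x = 'D_v ('D_u g) x.
Proof.
move=> Uo Ux gU.
pose mixed u v := forall e : R, 0 < e -> exists2 d : R, 0 < d & forall t : R, 0 < t < d ->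
  `|(g (x + t *: u + t *: v) - g (x + t *: u) - g (x + t *: v) + g x) / t ^+ 2
    - 'D_v ('D_u g) x| < e.
have main u1 v1 : mixed u1 v1.
  move=> e e0.
  have [gd /(_ u1)[dgd /(_ v1)/(_ _ Ux) ddc]] := gU.
  have : \forall y \near x, U y /\ `|'D_v1 ('D_u1 g) x - 'D_v1 ('D_u1 g) y| < e.
    near=> y; split; near: y; first exact: open_nbhs_nbhs.
    by move/cvgrPdist_lt : ddc; apply.
  move=> /nbhs_ballP[r /= r0 rU].
  have N0 : 0 < `|u1| + `|v1| + 1 by rewrite ltr_wpDl ?addr_ge0.
  exists (r / (`|u1| + `|v1| + 1)); first exact: divr_gt0.
  move=> t /andP[t0 tr].
  have inU a b : 0 <= a <= t -> 0 <= b <= t ->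
      U (x + a *: u1 + b *: v1) /\
      `|'D_v1 ('D_u1 g) x - 'D_v1 ('D_u1 g) (x + a *: u1 + b *: v1)| < e.
    move=> /andP[a0 at_] /andP[b0 bt]; apply: rU.
    rewrite -ball_normE /= -addrA opprD addNKr normrN.
    rewrite (le_lt_trans (ler_normD _ _))// !normrZ !ger0_norm//.
    rewrite (@le_lt_trans _ _ (t * (`|u1| + `|v1| + 1)))//.
      rewrite !mulrDr mulr1 -[leLHS]addr0; apply: lerD; last exact: ltW.
      by apply: lerD; exact: ler_wpM2r.
    by rewrite -ltr_pdivlMr.
  (* The second difference is the increment of [G] along [u1], and the derivative of [G] is in turn
     an increment of ['D_u1 g] along [v1]. *)
  pose G y := g (y + t *: v1) - g y.
  have dG a : 0 <= a <= t -> differentiable G (x + a *: u1) /\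
     'D_u1 G (x + a *: u1) = 'D_u1 g (x + a *: u1 + t *: v1) - 'D_u1 g (x + a *: u1).
    move=> at_; have [U1 _] := inU a t at_ ltac:(lra).
    have [U0 _] := inU a 0 at_ ltac:(lra).
    rewrite scale0r addr0 in U0.
    have sd : is_diff (x + a *: u1) (fun y => y + t *: v1) id.
      have -> : (fun y => y + t *: v1) = id + cst (t *: v1) by [].
      by apply: is_diff_eq; rewrite addr0.
    have G1 : differentiable (g \o (fun y => y + t *: v1)) (x + a *: u1).
      by apply: differentiable_comp; [exact: ex_diff|exact: gd].
    have -> : G = (g \o (fun y => y + t *: v1)) - g by [].
    split; first by apply: differentiableB => //; exact: gd.
    rewrite deriveB; [|exact: diff_derivable|by apply: diff_derivable; exact: gd].
    congr (_ - _); rewrite !deriveE//; last exact: gd.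
    by rewrite diff_comp//; [rewrite /= diff_val|exact: gd].
  have [|a /andP[a0 at_] E1] := @mean_value_line G x u1 t t0.
    by move=> s st; have [] := dG s st.
  have [|b /andP[b0 bt] E2] := @mean_value_line ('D_u1 g) (x + a *: u1) v1 t t0.
    by move=> s st; apply: dgd; have [] := inU a s ltac:(lra) st.
  have -> : g (x + t *: u1 + t *: v1) - g (x + t *: u1) - g (x + t *: v1) + g x
     = G (x + t *: u1) - G x by rewrite /G; ring.
  rewrite E1 (dG a ltac:(lra)).2 E2.
  have -> : t * (t * 'D_v1 ('D_u1 g) (x + a *: u1 + b *: v1)) / t ^+ 2 =
     'D_v1 ('D_u1 g) (x + a *: u1 + b *: v1) by field; rewrite gt_eqF.
  by rewrite distrC; have [] := inU a b ltac:(lra) ltac:(lra).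
apply: eq_of_common_approx => e e0.
have [d1 d10 H1] := main u v e e0.
have [d2 d20 H2] := main v u e e0.
pose d := Num.min d1 d2 / 2.
have d0 : 0 < d by rewrite divr_gt0// lt_min d10.
have dd1 : d < d1 by rewrite /d /Num.min; case: ifP => ?; lra.
have dd2 : d < d2 by rewrite /d /Num.min; case: ifP => ?; lra.
have {}H1 := H1 d; have {}H2 := H2 d; rewrite d0 dd1 dd2 in H1 H2.
exists ((g (x + d *: u + d *: v) - g (x + d *: u) - g (x + d *: v) + g x) / d ^+ 2).
  by exact: H1.
move: (H2 isT).
have -> : x + d *: v + d *: u = x + d *: u + d *: v by rewrite addrAC.
suff -> : g (x + d *: u + d *: v) - g (x + d *: v) - g (x + d *: u) + g x =
  g (x + d *: u + d *: v) - g (x + d *: u) - g (x + d *: v) + g x by [].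
by ring.
Unshelve. all: by end_near. Qed.

End mean_value.

(** * The inverse function theorem *)

Section linear_rV.
Context {R : realType}.

Lemma linear_rV_continuous (W : normedModType R) N (f : {linear 'rV[R]_N -> W}) :
  continuous f.
Proof.
have -> : (f : _ -> _) = (fun v => \sum_(i < N) v 0 i *: f (delta_mx 0 i)).
  apply/funext => v; rewrite {1}(row_sum_delta v) linear_sum.
  by apply: eq_bigr => i _; rewrite linearZ.
move=> v; have /(_ v Logic.I) : Ck_on 0 setT
    (fun v : 'rV[R]_N => \sum_(i < N) v 0 i *: f (delta_mx 0 i)); last by [].
apply: Ck_on_sum; first exact: openT.
move=> i _ w _; apply: (@continuousZr_tmp _ _ _ (fun v : 'rV[R]_N => v 0 i)).
exact: coord_continuous.
Qed.

Lemma mulmx_continuous N N' (A : 'M[R]_(N, N')) :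
  continuous (fun v : 'rV[R]_N => v *m A).
Proof. exact: (@linear_rV_continuous _ _ (mulmxr A : {linear 'rV[R]_N -> 'rV[R]_N'})). Qed.

Lemma Ck_on_mulmx N N' (A : 'M[R]_(N, N')) k U :
  Ck_on k U (fun v : 'rV[R]_N => v *m A).
Proof.
apply: (@Ck_on_linear _ _ _ _ _ (mulmxr A : {linear 'rV[R]_N -> 'rV[R]_N'})).
exact: mulmx_continuous.
Qed.

Lemma mulmx_norm_bound N N' (A : 'M[R]_(N, N')) :
  exists2 C : R, 0 < C & forall v : 'rV[R]_N, `|v *m A| <= C * `|v|.
Proof.
exists (\sum_i \sum_j `|A i j| + 1) => [|v].
  by rewrite ltr_wpDl// sumr_ge0// => i _; rewrite sumr_ge0.
have S0 : 0 <= \sum_i \sum_j `|A i j|.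
  by rewrite sumr_ge0// => i _; rewrite sumr_ge0.
apply: rV_norm_le => [|j]; first by rewrite mulr_ge0// addr_ge0.
rewrite mulrDl mul1r -[leLHS]addr0 lerD// mxE (le_trans (ler_norm_sum _ _ _))//.
rewrite mulr_suml ler_sum// => i _; rewrite normrM mulrC ler_pM//.
  by rewrite (bigD1 j)//= lerDl sumr_ge0.
exact: ler_norm_coord.
Qed.

End linear_rV.

Section inverse_function.
Context {R : realType} {m : nat}.
Implicit Types (f : 'rV[R]_m -> 'rV[R]_m) (U : set 'rV[R]_m) (x y v : 'rV[R]_m).

Lemma ball_line (x a b : 'rV[R]_m) (r s : R) : ball x r a -> ball x r b ->
  0 <= s <= 1 -> ball x r (a + s *: (b - a)).
Proof.
rewrite -!ball_normE /= => xa xb /andP[s0 s1].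
have -> : x - (a + s *: (b - a)) = (1 - s) *: (x - a) + s *: (x - b).
  by apply/rowP => i; rewrite !mxE; ring.
rewrite (le_lt_trans (ler_normD _ _))// !normrZ !ger0_norm ?subr_ge0//.
have [->|s_neq1] := eqVneq s 1; first by rewrite subrr mul0r add0r mul1r.
have s1' : s < 1 by rewrite lt_neqAle s_neq1.
have : (1 - s) * `|x - a| < (1 - s) * r by rewrite ltr_pM2l ?subr_gt0.
have : s * `|x - b| <= s * r by rewrite ler_wpM2l// ltW.
lra.
Qed.

(** The mean value theorem is applied to one coordinate at a time; the factor [m] counts the partial
    derivatives of that coordinate, each bounded by [c]. *)
Lemma lipschitz_of_small_derivative f (x0 : 'rV[R]_m) (r c : R) :
  0 <= c ->
  (forall x, ball x0 r x -> differentiable f x) ->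
  (forall x, ball x0 r x -> forall i j,
     `|'D_(delta_mx 0 i) f x 0 j| <= c) ->
  forall x y, ball x0 r x -> ball x0 r y ->
    `|f y - f x| <= c *+ m * `|y - x|.
Proof.
move=> c0 fd fb x y xr yr.
apply: rV_norm_le => [|j]; first by rewrite mulr_ge0// mulrn_wge0.
have lr s : 0 <= s <= 1 -> ball x0 r (x + s *: (y - x)) by exact: ball_line.
have [|s /andP[s0 s1]] := @mean_value_line _ _ (fun z => f z 0 j) x (y - x) 1 ltr01.
  by move=> s /lr/fd; exact: differentiable_coord_rV.
have sr : ball x0 r (x + s *: (y - x)) by apply: lr; rewrite !ltW.
rewrite scale1r mul1r (_ : x + (y - x) = y); last by rewrite addrC subrK.
rewrite !mxE => ->.
rewrite -derive_coord; last exact: fd.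
rewrite derive_delta; last exact: fd.
rewrite summxE (le_trans (ler_norm_sum _ _ _))//.
rewrite (@le_trans _ _ (\sum_(i < m) c * `|y - x|))//; last first.
  by rewrite sumr_const card_ord mulrnAl.
rewrite ler_sum// => i _; rewrite mxE normrM mulrC ler_pM//; first exact: fb.
exact: ler_norm_coord.
Qed.

(* The map is inverted by minimising the sup-distance of [f] to the target; at
   a minimiser a Newton step would otherwise decrease the distance. *)
Lemma surjective_near_id f (x0 y : 'rV[R]_m) (r : R) : 0 < r ->
  (forall x x', `|x - x0| <= r -> `|x' - x0| <= r ->
     `|(f x - x) - (f x' - x')| <= 2^-1 * `|x - x'|) ->
  `|y - f x0| < r / 4 -> exists2 x, `|x - x0| < r & f x = y.
Proof.
move=> r0 fl yr.
pose K := [set x : 'rV[R]_m | `|x - x0| <= r].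
have x0K : K x0 by rewrite /K/= subrr normr0 ltW.
have K_compact : compact K.
  have <- : closed_ball x0 r = K.
    rewrite closed_ballE//; apply/seteqP; split => x.
      by rewrite /closed_ball_ /K/= distrC.
    by rewrite /closed_ball_ /K/= distrC.
  apply: bounded_closed_compact; last exact: closed_ball_closed.
  rewrite closed_ballE//; exists (`|x0| + r); split; first exact: num_real.
  move=> M xM x /= xr; rewrite ltW// (le_lt_trans _ xM)//.
  rewrite -[x in leLHS](subrK x0) addrC (le_trans (ler_normD _ _))// lerD//.
  by rewrite distrC.
have flip x x' : K x -> K x' -> `|f x - f x'| <= 2 * `|x - x'|.
  move=> xK x'K; have := fl _ _ xK x'K.
  have -> : f x - f x' = (f x - x - (f x' - x')) + (x - x').
    by apply/rowP => i; rewrite !mxE; ring.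
  have := ler_normD (f x - x - (f x' - x')) (x - x').
  have := normr_ge0 (x - x'); lra.
have fc : {within K, continuous (fun x => `|f x - y|)}.
  apply/subspace_continuousP => x xK; apply/cvgrPdist_lt => e e0.
  near=> z.
  have zK : K z by near: z; exact: withinT.
  have := flip z x zK xK.
  rewrite (le_lt_trans (ler_dist_dist _ _))//.
  have -> : f x - y - (f z - y) = f x - f z by rewrite opprB addrA subrK.
  rewrite (le_lt_trans (flip _ _ xK zK))// mulrC -ltr_pdivlMr//.
  near: z; rewrite near_withinE; near=> z => _; near: z.
  by apply: (@cvgr_dist_lt _ _ _ _ _ id x); [exact: cvg_id|rewrite divr_gt0].
have [x /set_mem xK xmin] := EVT_min_rV (ex_intro _ _ x0K) K_compact fc.
have fx0 : `|f x - y| <= `|f x0 - y| by apply: xmin; exact/mem_set.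
(* The minimiser is interior: |x - x0| is at most |x - x0| / 2 + 2 |y - f x0|, hence at most 4 |y -
   f x0|. This is where r / 4 comes from. *)
have xr : `|x - x0| < r.
  have := fl _ _ xK x0K.
  have : `|x - x0| <= `|f x - x - (f x0 - x0)| + (`|f x - y| + `|f x0 - y|).
    have -> : x - x0 = - (f x - x - (f x0 - x0)) + ((f x - y) - (f x0 - y)).
      by apply/rowP => i; rewrite !mxE; ring.
    rewrite (le_trans (ler_normD _ _))// normrN lerD// (le_trans (ler_normB _ _))//.
  move: fx0 yr; rewrite (distrC y) => fx0 yr.
  lra.
exists x => //; apply/eqP; rewrite -subr_eq0 -normr_eq0; apply/negPn/negP => d0.
have {}d0 : 0 < `|f x - y| by rewrite lt_neqAle eq_sym d0 normr_ge0.
pose d := `|f x - y|.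
(* At most a full Newton step, and no further than the distance to the boundary of [K]. *)
pose s := Num.min 1 ((r - `|x - x0|) / d).
have s0 : 0 < s by rewrite lt_min ltr01 divr_gt0// subr_gt0.
have s1 : s <= 1 by rewrite ge_min lexx.
have sd : s * d <= r - `|x - x0|.
  by rewrite -ler_pdivlMr// ge_min lexx orbT.
pose x' := x - s *: (f x - y).
have x'K : K x'.
  rewrite /K/= /x' addrAC (le_trans (ler_normB _ _))// normrZ gtr0_norm//.
  by move: sd; rewrite /d; lra.
have := xmin x' (mem_set x'K); apply/negP; rewrite -ltNge.
have xx' : x' - x = - (s *: (f x - y)) by rewrite /x' addrAC subrr add0r.
have := fl _ _ x'K xK; rewrite xx' normrN normrZ gtr0_norm// => fl'.
have -> : f x' - y = (f x' - x' - (f x - x)) + (1 - s) *: (f x - y).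
  rewrite scalerBl scale1r -xx'.
  by move: x' {x'K xx' fl'} => x'; apply/rowP => i; rewrite !mxE; ring.
apply: le_lt_trans (ler_normD _ _) _.
rewrite normrZ ger0_norm ?subr_ge0//.
have : 0 < s * `|f x - y| by rewrite mulr_gt0.
move: fl'; rewrite mulrBl mul1r; set p := s * _; lra.
Unshelve. all: by end_near. Qed.

End inverse_function.

Section inverse_function_theorem.
Context {R : realType}.

Lemma unitmx_of_ker0 m (A : 'M[R]_m) :
  (forall v : 'rV_m, v *m A = 0 -> v = 0) -> A \in unitmx.
Proof.
move=> A0; rewrite -row_free_unit -kermx_eq0; apply/eqP/row_matrixP => i.
by rewrite row0; apply: A0; apply/sub_kermxP/row_sub.
Qed.

Lemma Ck_on_prod (V : normedModType R) k (U : set V) (I : Type) (r : seq I)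
    (P : pred I) (f : I -> V -> R) : open U ->
  (forall i, P i -> Ck_on k U (f i)) ->
  Ck_on k U (fun x => \prod_(i <- r | P i) f i x).
Proof.
move=> Uo Uf; elim: r => [|i r IH].
  by under eq_fun do rewrite big_nil; exact: Ck_on_cst.
under eq_fun do rewrite big_cons.
by case Pi: (P i) => //; apply: Ck_onM => //; exact: Uf.
Qed.

Lemma Ck_on_det (V : normedModType R) k (U : set V) m (M : V -> 'M[R]_m) :
  open U -> (forall i j, Ck_on k U (fun x => M x i j)) ->
  Ck_on k U (fun x => \det (M x)).
Proof.
move=> Uo MU; rewrite /determinant; apply: Ck_on_sum => // s _.
apply: Ck_onM => //; first exact: (@Ck_on_cst _ _ R).
by apply: Ck_on_prod => // i _.
Qed.

(** Cramer's rule: the entries are cofactors divided by a determinant that does not vanish on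
    [U]. *)
Lemma Ck_on_invmx (V : normedModType R) k (U : set V) m (M : V -> 'M[R]_m) :
  open U -> (forall i j, Ck_on k U (fun x => M x i j)) ->
  (forall x, U x -> M x \in unitmx) ->
  forall i j, Ck_on k U (fun x => invmx (M x) i j).
Proof.
move=> Uo MU Mu i j.
suff : Ck_on k U (fun x => (\det (M x))^-1 * cofactor (M x) j i).
  apply: Ck_on_ext => // x /set_mem Ux.
  by rewrite /invmx Mu// mxE mxE.
apply: Ck_onM => //.
  apply: Ck_onV => //; last exact: Ck_on_det.
  by move=> x /Mu; rewrite unitmxE unitfE.
rewrite /cofactor; apply: Ck_onM => //; first exact: (@Ck_on_cst _ _ R).
apply: Ck_on_det => // a b.
by rewrite (_ : (fun _ => _) = fun x => M x (lift j a) (lift i b))//; apply/funext => x; rewrite !mxE.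
Qed.

Lemma jacobianE m n (f : 'rV[R]_m -> 'rV[R]_n) x i :
  differentiable f x -> row i (jacobian f x) = 'D_(delta_mx 0 i) f x.
Proof. by move=> fx; rewrite deriveEjacobian// rowE. Qed.

Lemma derive_mulmx (V : normedModType R) m n (f : V -> 'rV[R]_m) (A : 'M[R]_(m, n)) x v :
  differentiable f x ->
  differentiable (fun y => f y *m A) x /\ 'D_v (fun y => f y *m A) x = 'D_v f x *m A.
Proof.
move=> fx.
have dA z : differentiable (mulmxr A : {linear 'rV[R]_m -> 'rV[R]_n}) z.
  by apply: linear_differentiable; exact: linear_rV_continuous.
have dc : differentiable ((mulmxr A : {linear 'rV[R]_m -> 'rV[R]_n}) \o f) x.
  exact: differentiable_comp.
split => //; rewrite (_ : (fun _ => _) = (mulmxr A : {linear 'rV[R]_m -> 'rV[R]_n}) \o f)//.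
rewrite derive_comp// deriveE// diff_lin//.
exact: linear_rV_continuous.
Qed.

Lemma near_add0 (V : normedModType R) (x : V) (P : set V) :
  (\forall z \near x, P z) -> \forall h \near (0 : V), P (h + x).
Proof.
have : (fun h : V => h + x) @ (0 : V) --> x.
  rewrite -[X in _ --> X]add0r; apply: cvgD; [exact: cvg_id|exact: cvg_cst].
by move=> hx /hx.
Qed.

Lemma differentiable_approx (V W : normedModType R) (f : V -> W) x (e : R) :
  differentiable f x -> 0 < e ->
  \forall h \near (0 : V), `|f (h + x) - (f x + 'd f x h)| <= e * `|h|.
Proof. by move=> /diff_locallyP[_ fE] e0; exact: ((eqaddoP _ _ _ _).1 fE e e0). Qed.

Lemma differentiable_of_approx (V W : normedModType R) (f : V -> W) x
    (L : {linear V -> W}) : continuous L ->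
  (forall e : R, 0 < e ->
    \forall h \near (0 : V), `|f (h + x) - (f x + L h)| <= e * `|h|) ->
  differentiable f x /\ forall v, 'D_v f x = L v.
Proof.
move=> Lc fL.
have fE : f \o shift x = cst (f x) + L +o_0 id by apply/eqaddoP => e /fL.
have df := diff_unique Lc fE.
have fd : differentiable f x by apply/diff_locallyP; rewrite df.
by split=> // v; rewrite deriveE// df.
Qed.

(* A local inverse which is Lipschitz is differentiable as soon as the
   derivative of the map is invertible. *)
Lemma differentiable_local_inverse (V : normedModType R) (f g : V -> V) (y : V)
    (C D : R) (L : {linear V -> V}) :
  0 < C -> (\forall z \near y, f (g z) = z /\ `|g z - g y| <= C * `|z - y|) ->
  differentiable f (g y) -> continuous L -> 0 < D ->
  (forall v, `|L v| <= D * `|v|) -> (forall v, L ('d f (g y) v) = v) ->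
  differentiable g y /\ forall v, 'D_v g y = L v.
Proof.
move=> C0 yg fx Lc D0 LD Lf.
have fgy : f (g y) = y by have [] := nbhs_singleton yg.
apply: (@differentiable_of_approx _ _ _ _ L) => // e e0.
have e1 : 0 < e / (D * C) by rewrite divr_gt0// mulr_gt0.
have fE := differentiable_approx fx e1.
have yh := near_add0 yg.
have gh0 : (fun h => g (h + y) - g y) @ (0 : V) --> (0 : V).
  apply/cvgrPdist_le => d d0; near=> h.
  have [_] : f (g (h + y)) = h + y /\ `|g (h + y) - g y| <= C * `|h + y - y|.
    by near: h.
  rewrite sub0r normrN => /le_trans; apply; rewrite addrK mulrC -ler_pdivlMr//.
  near: h; apply/nbhs_ballP; exists (d / C) => /=; first exact: divr_gt0.
  by move=> h; rewrite -ball_normE/= sub0r normrN => /ltW.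
have {}fE := gh0 _ fE.
near=> h.
have [fh gh] : f (g (h + y)) = h + y /\ `|g (h + y) - g y| <= C * `|h + y - y|.
  by near: h.
set w := g (h + y) - g y in gh.
have wE : `|f (w + g y) - (f (g y) + 'd f (g y) w)| <= e / (D * C) * `|w|.
  by rewrite /w; near: h; exact: fE.
have -> : g (h + y) - (g y + L h) = L ('d f (g y) w - h).
  by rewrite linearB Lf /w opprD addrA.
rewrite (le_trans (LD _))//.
rewrite {1}/w subrK fh fgy in wE.
have {}wE : `|'d f (g y) w - h| <= e / (D * C) * `|w|.
  have -> : 'd f (g y) w - h = - (h + y - (y + 'd f (g y) w)).
    by rewrite opprB opprD [RHS]addrAC addrA (addrC y) addrK addrC.
  by rewrite normrN.
rewrite addrK in gh.
rewrite (@le_trans _ _ (D * (e / (D * C) * (C * `|h|))))//.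
  apply: ler_wpM2l; first exact: ltW.
  by apply: le_trans wE _; apply: ler_wpM2l => //; exact: ltW.
by rewrite le_eqVlt; apply/orP; left; apply/eqP; field; rewrite !gt_eqF.
Unshelve. all: by end_near. Qed.

(** After composition with the inverse of the Jacobian at [x0], the map is the identity plus a
    1/2-Lipschitz perturbation on a small ball. This gives surjectivity onto a ball, injectivity and
    a Lipschitz inverse. The inverse is defined on a whole ball because graph patches are later
    parametrised by balls. *)
Lemma inverse_function m (f : 'rV[R]_m -> 'rV[R]_m) U x0 :
  open U -> U x0 -> smooth_on U f -> jacobian f x0 \in unitmx ->
  exists (r : R) (g : 'rV[R]_m -> 'rV[R]_m) (D : set 'rV[R]_m),
    [/\ 0 < r, open D, D x0 & D `<=` U] /\
    [/\ forall x, D x -> ball (f x0) r (f x) /\ g (f x) = x,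
        forall y, ball (f x0) r y -> D (g y) /\ f (g y) = y &
        smooth_on (ball (f x0) r) g].
Proof.
move=> Uo Ux0 fU Ju; set J := jacobian f x0 in Ju.
have fd x : U x -> differentiable f x by have [+ _] := fU 1%N; exact.
pose h x := f x *m invmx J.
have hd x v : U x -> differentiable h x /\ 'D_v h x = 'D_v f x *m invmx J.
  by move=> /fd; exact: derive_mulmx.
pose k x := h x - x.
have kd x v : U x -> differentiable k x /\ 'D_v k x = 'D_v h x - v.
  move=> Ux; have [dh _] := hd x v Ux.
  have -> : k = h - id by [].
  split; first exact: differentiableB.
  by rewrite deriveB ?derive_id//; exact: diff_derivable.
(* Chosen so that [c *+ m] is at most 1/2, the required Lipschitz constant; [m.+1] also covers m =
   0. *)
pose c : R := 2^-1 / m.+1%:R.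
have c0 : 0 < c by rewrite divr_gt0.
have cm : c *+ m <= 2^-1.
  rewrite -[leLHS](mulr_natr c) mulrAC ler_pdivrMr//.
  by rewrite ler_wpM2l// ler_nat.
have ksmall : \forall x \near x0, U x /\ forall i j, `|'D_(delta_mx 0 i) k x 0 j| <= c.
  near=> x; split; first by near: x; exact: open_nbhs_nbhs.
  have Ux : U x by near: x; exact: open_nbhs_nbhs.
  near: x; apply: filter_forall => i; apply: filter_forall => j.
  have [_ /(_ (delta_mx 0 i)) cf] := fU 1%N.
  have /(_ x0 Ux0) : Ck_on 0 U (fun x => ('D_(delta_mx 0 i) f x *m invmx J) 0 j).
    move: j; apply/(Ck_on_rV 0 (fun x => 'D_(delta_mx 0 i) f x *m invmx J) Uo).
    exact: (@Ck_on_comp_rV _ _ _ _ 0 U setT ('D_(delta_mx 0 i) f)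
      (fun v => v *m invmx J) Uo openT (fun _ _ => Logic.I) cf (Ck_on_mulmx _ _ _)).
  move=> /cvgrPdist_le/(_ _ c0) nc; near=> x.
  have Ux : U x by near: x; exact: open_nbhs_nbhs.
  have [_ ->] := kd x (delta_mx 0 i) Ux.
  have [_ ->] := hd x (delta_mx 0 i) Ux.
  have E : 'D_(delta_mx 0 i) f x0 *m invmx J = delta_mx 0 i.
    by rewrite deriveEjacobian ?mulmxK//; exact: fd.
  have -> : ('D_(delta_mx 0 i) f x *m invmx J - delta_mx 0 i) 0 j =
      ('D_(delta_mx 0 i) f x *m invmx J) 0 j - ('D_(delta_mx 0 i) f x0 *m invmx J) 0 j.
    by rewrite E mxE [X in _ + X]mxE.
  by rewrite -normrN opprB; near: x.
have /nbhs_ballP[rho /= rho0 rhoP] := ksmall.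
have rU x : ball x0 rho x -> U x by move=> /rhoP[].
have klip x y : ball x0 rho x -> ball x0 rho y -> `|k y - k x| <= 2^-1 * `|y - x|.
  move=> xr yr; apply: le_trans (_ : c *+ m * `|y - x| <= _).
    have kd' z : ball x0 rho z -> differentiable k z.
      by move=> /rU Uz; have [] := kd z 0 Uz.
    have ks z : ball x0 rho z -> forall i j, `|'D_(delta_mx 0 i) k z 0 j| <= c.
      by move=> /rhoP[].
    exact: (lipschitz_of_small_derivative (ltW c0) kd' ks xr yr).
  by rewrite ler_wpM2r.
have Junit x : ball x0 rho x -> jacobian f x \in unitmx.
  move=> xr; have Ux := rU _ xr; apply: unitmx_of_ker0 => v vJ.
  have [kx Dk] := kd x v Ux; have [hx Dh] := hd x v Ux.
  have Dkv : 'D_v k x = - v.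
    by rewrite Dk Dh deriveEjacobian ?vJ ?mul0mx ?sub0r//; exact: fd.
  have : `|v| <= c *+ m * `|v|.
    rewrite -[in leLHS]normrN -Dkv; apply: rV_norm_le => [|j].
      by rewrite mulr_ge0// mulrn_wge0// ltW.
    rewrite derive_delta// summxE (le_trans (ler_norm_sum _ _ _))//.
    rewrite (@le_trans _ _ (\sum_(i < m) c * `|v|))//; last first.
      by rewrite sumr_const card_ord mulrnAl.
    rewrite ler_sum// => i _; rewrite mxE normrM mulrC ler_pM//.
      by have [_] := rhoP _ xr; exact.
    exact: ler_norm_coord.
  have : c *+ m * `|v| <= 2^-1 * `|v| by rewrite ler_wpM2r.
  have := normr_ge0 v; move=> v0 a b.
  by apply/eqP; rewrite -normr_eq0 eq_le v0 andbT; lra.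
pose r1 := rho / 2.
have r10 : 0 < r1 by rewrite divr_gt0.
have r1rho x : `|x - x0| <= r1 -> ball x0 rho x.
  by rewrite -ball_normE/= distrC => /le_lt_trans; apply; rewrite /r1; lra.
have [B B0 hB] := mulmx_norm_bound (invmx J).
(* The quarter is the radius demanded by [surjective_near_id], and [B] converts distances between
   values of [f] into distances between values of [h]. *)
pose r := r1 / 4 / B.
have r0 : 0 < r by rewrite divr_gt0// divr_gt0.
(* Since x - y is the increment of [h] minus that of [k], the latter contributes at most half of |x
   - y|, which is absorbed on the left. *)
have hlow x y : ball x0 rho x -> ball x0 rho y -> `|x - y| <= 2 * B * `|f x - f y|.
  move=> xr yr; have := klip _ _ yr xr.
  have : `|h x - h y| <= B * `|f x - f y| by rewrite /h -mulmxBl hB.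
  have : `|x - y| <= `|h x - h y| + `|k x - k y|.
    have -> : x - y = (h x - h y) - (k x - k y).
      by rewrite /k; apply/rowP => i; rewrite !mxE; ring.
    exact: ler_normB.
  rewrite -mulrA; lra.
have surj y : ball (f x0) r y -> exists2 x, `|x - x0| < r1 & f x = y.
  rewrite -ball_normE/= distrC => yr.
  have [||x xr hx] := @surjective_near_id _ _ h x0 (y *m invmx J) r1 r10.
  - by move=> x x' /r1rho xr /r1rho x'r; exact: klip.
  - rewrite /h -mulmxBl (le_lt_trans (hB _))// mulrC -ltr_pdivlMr//.
  by exists x => //; rewrite -[LHS](mulmxKV Ju) -/(h x) hx mulmxKV.
pose g y := xget x0 [set x | `|x - x0| < r1 /\ f x = y].
have gP y : ball (f x0) r y -> `|g y - x0| < r1 /\ f (g y) = y.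
  move=> /surj[x xr xy].
  by rewrite /g; case: xgetP => [z -> []//|/(_ x)]; rewrite /= xr xy => -[].
have grho y : ball (f x0) r y -> ball x0 rho (g y).
  by move=> /gP[gr _]; apply/r1rho/ltW.
(* Bootstrapping: the derivative of [g] is the inverse Jacobian of [f] composed with [g], so that
   each order of smoothness of [g] yields the next. *)
have gsmooth : smooth_on (ball (f x0) r) g.
  have gdiff y : ball (f x0) r y -> differentiable g y /\
      forall v, 'D_v g y = v *m invmx (jacobian f (g y)).
    move=> yr; have fgy : differentiable f (g y) by apply/fd/rU/grho.
    have [D D0 LD] := mulmx_norm_bound (invmx (jacobian f (g y))).
    pose L : {linear 'rV[R]_m -> 'rV[R]_m} := mulmxr (invmx (jacobian f (g y))).
    apply: (@differentiable_local_inverse _ f g y (2 * B) D L) => //.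
    - by rewrite mulr_gt0.
    - near=> z; have zr : ball (f x0) r z.
        by near: z; apply: open_nbhs_nbhs; split => //; exact: ball_open.
      have [_ fz] := gP z zr; have [_ fy] := gP y yr.
      by split=> //; rewrite -{2}fz -{2}fy hlow//; exact: grho.
    - exact: linear_rV_continuous.
    - move=> v; rewrite -deriveE// deriveEjacobian//.
      exact: (mulmxK (Junit _ (grho _ yr))).
  have bo : open (ball x0 rho) by exact: ball_open.
  have bo' : open (ball (f x0) r) by exact: ball_open.
  elim=> [|n IH].
    by move=> y /gdiff[gd _]; exact: differentiable_continuous.
  split=> [y /gdiff[]//|v].
  have inv_smooth i j : Ck_on n (ball x0 rho) (fun x => invmx (jacobian f x) i j).
    apply: Ck_on_invmx => // a b.
    have [_ /(_ (delta_mx 0 a))/(Ck_on_sub rU)/(@Ck_on_rV _ _ _ _ _ _ bo)/(_ b)] := fU n.+1.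
    apply: Ck_on_ext => // x /set_mem xr.
    by rewrite -jacobianE ?mxE//; exact/fd/rU.
  suff : Ck_on n (ball (f x0) r) ((fun x => v *m invmx (jacobian f x)) \o g).
    by apply: Ck_on_ext => // y /set_mem /gdiff[_ ->].
  apply: (Ck_on_comp_rV (O := ball x0 rho)) => //.
  apply/Ck_on_rV => // j.
  suff : Ck_on n (ball x0 rho) (fun x => \sum_i v 0 i * invmx (jacobian f x) i j).
    by apply: Ck_on_ext => // x _; rewrite mxE.
  apply: Ck_on_sum => // i _; apply: Ck_onM => //; exact: (@Ck_on_cst _ _ R).
exists r, g, [set x | `|x - x0| < r1 /\ ball (f x0) r (f x)]; split; split => //.
- rewrite openE => x [xr fx]; rewrite /interior.
  have Ux : U x by apply/rU/r1rho/ltW.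
  near=> z; split; near: z.
    have : open_nbhs x (ball x0 r1).
      by split; [exact: ball_open|rewrite -ball_normE/= distrC].
    by move/open_nbhs_nbhs; apply: filterS => z; rewrite -ball_normE/= distrC.
  have := differentiable_continuous (fd _ Ux); apply.
  by apply: open_nbhs_nbhs; split => //; exact: ball_open.
- by rewrite /= subrr normr0; split => //; exact: ballxx.
- by move=> x [/ltW/r1rho/rU].
- move=> x [xr fx]; split=> //.
  have [gx fgx] := gP _ fx; apply/eqP; rewrite -subr_eq0 -normr_le0.
  have := hlow (g (f x)) x (grho _ fx) (r1rho _ (ltW xr)).
  by rewrite fgx subrr normr0 mulr0.
- by move=> y yr; have [gy fgy] := gP _ yr; rewrite /= fgy.
Unshelve. all: by end_near. Qed.

End inverse_function_theorem.

(** * The Euclidean inner product and its comparison with the sup norm *)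

Section dot_product.
Context {R : realType} {N : nat}.
Implicit Types u v w : 'rV[R]_N.

Lemma dotE u v : dot u v = (u *m v^T) 0 0.
Proof. by rewrite /dot mxE; apply: eq_bigr => i _; rewrite mxE. Qed.

Lemma dotC u v : dot u v = dot v u.
Proof. by apply: eq_bigr => i _; rewrite mulrC. Qed.

Lemma dotDl u v w : dot (u + v) w = dot u w + dot v w.
Proof. by rewrite -big_split; apply: eq_bigr => i _; rewrite mxE mulrDl. Qed.

Lemma dotZl a u v : dot (a *: u) v = a * dot u v.
Proof. by rewrite /dot mulr_sumr; apply: eq_bigr => i _; rewrite mxE mulrA. Qed.

Lemma dotNl u v : dot (- u) v = - dot u v.
Proof. by rewrite -scaleN1r dotZl mulN1r. Qed.

Lemma dotBl u v w : dot (u - v) w = dot u w - dot v w.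
Proof. by rewrite dotDl dotNl. Qed.

Lemma dotDr u v w : dot u (v + w) = dot u v + dot u w.
Proof. by rewrite !(dotC u) dotDl. Qed.

Lemma dotZr a u v : dot u (a *: v) = a * dot u v.
Proof. by rewrite !(dotC u) dotZl. Qed.

Lemma dotNr u v : dot u (- v) = - dot u v.
Proof. by rewrite !(dotC u) dotNl. Qed.

Lemma dotBr u v w : dot u (v - w) = dot u v - dot u w.
Proof. by rewrite dotDr dotNr. Qed.

Lemma dot0l u : dot 0 u = 0.
Proof. by rewrite -(scale0r (0 : 'rV[R]_N)) dotZl mul0r. Qed.

Lemma dot0r u : dot u 0 = 0.
Proof. by rewrite dotC dot0l. Qed.

Lemma dot_ge0 u : 0 <= dot u u.
Proof. by apply: sumr_ge0 => i _; rewrite -expr2 sqr_ge0. Qed.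

Lemma dot_eq0 u : (dot u u == 0) = (u == 0).
Proof.
apply/idP/eqP => [|->]; last by rewrite dot0l.
rewrite /dot psumr_eq0; last by move=> i _; rewrite -expr2 sqr_ge0.
move=> /allP u0; apply/rowP => i; apply/eqP; rewrite mxE.
by have := u0 i (mem_index_enum _); rewrite -expr2 sqrf_eq0.
Qed.

Lemma dot_gt0 u : (0 < dot u u) = (u != 0).
Proof. by rewrite lt_neqAle eq_sym dot_eq0 dot_ge0 andbT. Qed.

Lemma dot_delta u i : dot u (delta_mx 0 i) = u 0 i.
Proof.
rewrite /dot (bigD1 i)//= mxE !eqxx mulr1 big1 ?addr0// => j ji.
by rewrite mxE (negbTE ji) andbF mulr0.
Qed.

Lemma sqr_coord_le_dot u i : (u 0 i) ^+ 2 <= dot u u.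
Proof.
rewrite /dot (bigD1 i)//= -expr2 lerDl sumr_ge0// => j _.
by rewrite -expr2 sqr_ge0.
Qed.

Lemma ball_of_dot u v r : 0 < r -> dot (v - u) (v - u) < r ^+ 2 -> ball u r v.
Proof.
move=> r0 uv; rewrite -ball_normE /= distrC; apply: rV_norm_lt => // i.
have : ((v - u) 0 i) ^+ 2 < r ^+ 2 by exact: le_lt_trans (sqr_coord_le_dot _ _) uv.
by rewrite -[ltLHS]real_normK ?num_real// ltr_pXn2r// nnegrE// ltW.
Qed.

Lemma norm_le_dot u : `|u| <= Num.sqrt (dot u u).
Proof.
apply: rV_norm_le => [|i]; first exact: sqrtr_ge0.
by rewrite -sqrtr_sqr ler_wsqrtr// sqr_coord_le_dot.
Qed.

End dot_product.

Section smooth_functions.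
Context {R : realType}.

Lemma Ck_on_id (V : normedModType R) k (U : set V) : Ck_on k U id.
Proof. by apply: (@Ck_on_linear R V V k U idfun) => x; exact: cvg_id. Qed.

Lemma Ck_on_coord N k U i : Ck_on k U (fun x : 'rV[R]_N => x 0 i).
Proof.
apply: (Ck_on_sub (O := setT)) => //.
exact: ((Ck_on_rV k id openT).1 (Ck_on_id _ _) i).
Qed.

Lemma derive_proj N i (x v : 'rV[R]_N) : 'D_v (fun x : 'rV[R]_N => x 0 i) x = v 0 i.
Proof.
rewrite -derive_coord; first by rewrite derive_id.
by have [+ _] := @Ck_on_id 'rV[R]_N 1 setT; exact.
Qed.

Lemma derive_expR_comp (V : normedModType R) (f : V -> R) x v :
  differentiable f x -> differentiable (expR \o f) x /\
  'D_v (expR \o f) x = expR (f x) * 'D_v f x.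
Proof.
move=> fx; have dE z : differentiable (expR : R -> R) z.
  by apply/derivable1_diffP; exact: derivable_expR.
have dc := differentiable_comp fx (dE _); split=> //.
have E : (expR : R -> R)^`()%classic (f x) = expR (f x).
  by rewrite derive1E; exact: (@derive_val _ _ _ _ _ _ _ (is_derive_expR (f x))).
by rewrite deriveE// diff_comp// /= diff1E// E -deriveE// -[LHS]/(_ * _) mulrC.
Qed.

Lemma Ck_on_expR (V : normedModType R) k (U : set V) (f : V -> R) : open U ->
  Ck_on k U f -> Ck_on k U (expR \o f).
Proof.
move=> Uo; elim: k f => [|k IH] f.
  move=> Uf x Ux; apply: continuous_comp; [exact: Uf|exact: continuous_expR].
move=> fk; have [Uf Df] := fk.
split=> [x Ux|v]; first by have [] := derive_expR_comp 0 (Uf _ Ux).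
suff : Ck_on k U ((expR \o f) \* 'D_v f).
  by apply: Ck_on_ext => // x /set_mem Ux; have [_ ->] := derive_expR_comp v (Uf _ Ux).
by apply: Ck_onM => //; [exact: IH (Ck_onW fk)|exact: Df].
Qed.

Lemma Ck_on_derive (V W : normedModType R) k (U : set V) (f : V -> W) v :
  Ck_on k.+1 U f -> Ck_on k U ('D_v f).
Proof. by move=> [_]; exact. Qed.

Lemma Ck_on_differentiable (V W : normedModType R) k (U : set V) (f : V -> W) x :
  Ck_on k.+1 U f -> U x -> differentiable f x.
Proof. by move=> [+ _]; exact. Qed.

Lemma Ck_on_continuous (V W : normedModType R) k (U : set V) (f : V -> W) x :
  Ck_on k U f -> U x -> {for x, continuous f}.
Proof.
case: k => [|k]; first exact.
by move=> fU /(Ck_on_differentiable fU)/differentiable_continuous.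
Qed.

Lemma Ck_onZ (V : normedModType R) k (U : set V) (a : R) (f : V -> R) : open U ->
  Ck_on k U f -> Ck_on k U (fun x => a * f x).
Proof. by move=> Uo; apply: Ck_onM => //; exact: (@Ck_on_cst _ _ R). Qed.

Lemma Ck_on_dot (V : normedModType R) N k (U : set V) (f g : V -> 'rV[R]_N) :
  open U -> Ck_on k U f -> Ck_on k U g -> Ck_on k U (fun x => dot (f x) (g x)).
Proof.
move=> Uo /(Ck_on_rV k f Uo) fU /(Ck_on_rV k g Uo) gU.
by apply: Ck_on_sum => // i _; apply: Ck_onM.
Qed.

Lemma derive_dot (V : normedModType R) N (f g : V -> 'rV[R]_N) x v :
  differentiable f x -> differentiable g x ->
  'D_v (fun y => dot (f y) (g y)) x = dot ('D_v f x) (g x) + dot (f x) ('D_v g x).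
Proof.
move=> fx gx.
have fi i := differentiable_coord_rV i fx; have gi i := differentiable_coord_rV i gx.
have -> : (fun y => dot (f y) (g y)) =
    \sum_(i < N) (fun y => f y 0 i) * (fun y => g y 0 i).
  by apply/funext => y; rewrite fct_sumE.
rewrite derive_sum; last first.
  by move=> i; apply: derivableM; exact: diff_derivable.
rewrite /dot -big_split; apply: eq_bigr => i _ /=.
rewrite deriveM; [|exact: diff_derivable|exact: diff_derivable].
by rewrite !derive_coord// addrC; congr (_ + _); exact: mulrC.
Qed.

End smooth_functions.

(** * Maximum principles *)

Section local_minimum.
Context {R : realType} {V : normedModType R}.
Implicit Types (u : V -> R) (x v : V) (U : set V).

Definition local_min u x := \forall y \near x, u x <= u y.

Lemma near_line x v (P : set V) : (\forall y \near x, P y) ->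
  exists2 t0 : R, 0 < t0 & forall t, 0 <= t <= t0 -> P (x + t *: v).
Proof.
move=> /nbhs_ballP[r /= r0 rP]; exists (r / (`|v| + 1)).
  by rewrite divr_gt0// ltr_wpDl.
move=> t /andP[t0 tr]; apply: rP; rewrite -ball_normE/= opprD addNKr normrN.
rewrite normrZ ger0_norm//.
have v1 : 0 < `|v| + 1 by rewrite ltr_wpDl.
rewrite (@le_lt_trans _ _ (r / (`|v| + 1) * `|v|))//; first by rewrite ler_wpM2r.
by rewrite mulrAC ltr_pdivrMr// ltr_pM2l// ltrDl.
Qed.

(** The mean value theorem locates nonnegative derivatives at points near [x] but not at [x];
    continuity transfers the sign. *)
Lemma ge0_of_frequently (f : V -> R) x : {for x, continuous f} ->
  (forall r : R, 0 < r -> exists2 y, ball x r y & 0 <= f y) -> 0 <= f x.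
Proof.
move=> fc fx; apply/ler_addgt0Pr => e e0.
move/cvgrPdist_lt : fc => /(_ e e0)/nbhs_ballP[r /= r0 rP].
have [y yr fy] := fx r r0; have := rP y yr; rewrite ltr_norml => /andP[xy _].
lra.
Qed.

Lemma local_min_derive_ge0 u x v U : open U -> U x -> Ck_on 1 U u ->
  local_min u x -> 0 <= 'D_v u x.
Proof.
move=> Uo Ux uU umin; apply: (@ge0_of_frequently ('D_v u) x) => [|r r0].
  exact: Ck_on_continuous (Ck_on_derive v uU) Ux.
have : \forall y \near x, [/\ U y, ball x r y & u x <= u y].
  near=> y; split; near: y => //; first exact: open_nbhs_nbhs.
  by apply: open_nbhs_nbhs; split; [exact: ball_open|exact: ballxx].
move=> /(near_line v)[t t0 tP].
have [|s /andP[s0 st] E] := @mean_value_line _ _ u x v t t0.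
  by move=> s /tP[Us _ _]; exact: Ck_on_differentiable uU Us.
have s0t : 0 <= s <= t by rewrite !ltW.
exists (x + s *: v); first by have [] := tP s s0t.
have : 0 <= u (x + t *: v) - u x.
  by rewrite subr_ge0; have [] := tP t; rewrite // (ltW t0) lexx.
by rewrite E pmulr_rge0.
Unshelve. all: by end_near. Qed.

Lemma local_min_derive u x v U : open U -> U x -> Ck_on 1 U u ->
  local_min u x -> 'D_v u x = 0.
Proof.
move=> Uo Ux uU umin; apply/eqP; rewrite eq_le.
rewrite (local_min_derive_ge0 v Uo Ux uU umin) andbT.
have := local_min_derive_ge0 (- v) Uo Ux uU umin.
have ux := Ck_on_differentiable uU Ux.
by rewrite !deriveE// linearN oppr_ge0.
Qed.

(** The first derivative vanishes at the minimum, so two applications of the mean value theorem turn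
    the nonnegative increment of [u] into a positive multiple of the second derivative at a nearby
    point. *)
Lemma local_min_derive2 u x v U : open U -> U x -> Ck_on 2 U u ->
  local_min u x -> 0 <= 'D_v ('D_v u) x.
Proof.
move=> Uo Ux uU umin; have u1 := Ck_onW uU.
have du := Ck_on_derive v uU.
apply: (@ge0_of_frequently ('D_v ('D_v u)) x) => [|r r0].
  exact: Ck_on_continuous (Ck_on_derive v du) Ux.
have : \forall y \near x, [/\ U y, ball x r y & u x <= u y].
  near=> y; split; near: y => //; first exact: open_nbhs_nbhs.
  by apply: open_nbhs_nbhs; split; [exact: ball_open|exact: ballxx].
move=> /(near_line v)[t t0 tP].
have [|s /andP[s0 st] E] := @mean_value_line _ _ u x v t t0.
  by move=> s /tP[Us _ _]; exact: Ck_on_differentiable uU Us.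
have [|s' /andP[s'0 s't] E'] := @mean_value_line _ _ ('D_v u) x v s s0.
  move=> s' /andP[s'0 s's]; have [Us _ _] := tP s' ltac:(rewrite s'0/=; lra).
  exact: Ck_on_differentiable du Us.
have s0t : 0 <= s' <= t by rewrite ltW//=; lra.
exists (x + s' *: v); first by have [] := tP s' s0t.
have : 0 <= u (x + t *: v) - u x.
  by rewrite subr_ge0; have [] := tP t; rewrite // (ltW t0) lexx.
rewrite (local_min_derive v Uo Ux u1 umin) subr0 in E'.
by rewrite E pmulr_rge0// E' pmulr_rge0.
Unshelve. all: by end_near. Qed.

End local_minimum.

(** * The elliptic operator of graphs and Hopf's barrier function *)

Section elliptic_operator.
Context {R : realType} {m : nat}.
Implicit Types (u : 'rV[R]_m -> R) (x p b : 'rV[R]_m).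
Local Notation e i := (delta_mx 0 i : 'rV[R]_m).

(** Its inner product with xi is p_i xi_j - p_j xi_i, the term of Lagrange's identity: |p|^2 |xi|^2
    - (p, xi)^2 is half the sum of the squares of these over all i and j. *)
Definition skew_vec p (i j : 'I_m) : 'rV[R]_m := p 0 i *: e j - p 0 j *: e i.

(* The operator [sum a_ij d_i d_j + d_b] with [a = (1 + |p|^2) I - p^T p], in
   which Lagrange's identity exhibits [a] as a sum of squares. *)
Definition elliptic_op p b u x : R :=
  \sum_i 'D_(e i) ('D_(e i) u) x
  + 2^-1 * (\sum_i \sum_j 'D_(skew_vec p i j) ('D_(skew_vec p i j) u) x)
  + 'D_b u x.

(** In the sum-of-squares form every second-order term is a pure second derivative, so the
    one-variable test applies term by term and no coefficient matrix has to be diagonalised. *)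
Lemma elliptic_op_min u x p b U : open U -> U x -> Ck_on 2 U u ->
  local_min u x -> 0 <= elliptic_op p b u x.
Proof.
move=> Uo Ux uU umin; have D2 v := local_min_derive2 v Uo Ux uU umin.
rewrite /elliptic_op (local_min_derive b Uo Ux (Ck_onW uU) umin) addr0.
rewrite addr_ge0 ?sumr_ge0// mulr_ge0// sumr_ge0// => i _.
by rewrite sumr_ge0.
Qed.

Lemma derive2_lin u1 u2 (c : R) x v U : open U -> U x ->
  Ck_on 2 U u1 -> Ck_on 2 U u2 ->
  'D_v (fun y => u1 y + c * u2 y) x = 'D_v u1 x + c * 'D_v u2 x /\
  'D_v ('D_v (fun y => u1 y + c * u2 y)) x
   = 'D_v ('D_v u1) x + c * 'D_v ('D_v u2) x.
Proof.
move=> Uo Ux U1 U2.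
have D w1 w2 : Ck_on 1 U w1 -> Ck_on 1 U w2 -> forall y, U y ->
    'D_v (fun y => w1 y + c * w2 y) y = 'D_v w1 y + c * 'D_v w2 y.
  move=> W1 W2 y Uy.
  have d1 : derivable w1 y v by exact: diff_derivable (Ck_on_differentiable W1 Uy).
  have d2 : derivable w2 y v by exact: diff_derivable (Ck_on_differentiable W2 Uy).
  have -> : (fun y => w1 y + c * w2 y) = w1 + c *: w2 by [].
  have E := deriveD d1 (derivableZ (k := c) d2).
  by apply: etrans E _; congr (_ + _); exact: (@deriveZ _ _ _ w2 c y v d2).
split; first by apply: D => //; exact: Ck_onW.
rewrite -(D ('D_v u1) ('D_v u2))//; try exact: Ck_on_derive.
apply: near_eq_derive; near=> y; apply: D; try exact: Ck_onW.
by near: y; exact: open_nbhs_nbhs.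
Unshelve. all: by end_near. Qed.

Lemma elliptic_op_lin u1 u2 (c : R) x p b U : open U -> U x ->
  Ck_on 2 U u1 -> Ck_on 2 U u2 ->
  elliptic_op p b (fun y => u1 y + c * u2 y) x
   = elliptic_op p b u1 x + c * elliptic_op p b u2 x.
Proof.
move=> Uo Ux U1 U2; have D v := derive2_lin c v Uo Ux U1 U2.
have alg (A B C A' B' C' : R) : A + c * A' + 2^-1 * (B + c * B') + (C + c * C') =
    A + 2^-1 * B + C + c * (A' + 2^-1 * B' + C') by ring.
have sums (I : finType) (F G : I -> R) :
    \sum_i (F i + c * G i) = \sum_i F i + c * \sum_i G i.
  by rewrite big_split mulr_sumr.
apply: etrans _ (alg _ _ _ _ _ _); congr (_ + _ * _ + _); last exact: (D b).1.
  by apply: etrans _ (sums _ _ _); apply: eq_bigr => i _; exact: (D _).2.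
apply: etrans _ (sums _ _ _); apply: eq_bigr => i _.
by apply: etrans _ (sums _ _ _); apply: eq_bigr => j _; exact: (D _).2.
Qed.

(** Hopf's barrier, without the customary additive constant; its level sets are the Euclidean
    spheres about [y]. *)
Definition gauss_bump (al : R) (y x : 'rV[R]_m) : R :=
  expR (- al * dot (x - y) (x - y)).

Lemma Ck_on_gauss_bump al y k U : open U -> Ck_on k U (gauss_bump al y).
Proof.
move=> Uo; apply: (Ck_on_expR (f := fun x => - al * dot (x - y) (x - y))) => //.
apply: Ck_onZ => //.
have sU : Ck_on k U (fun x : 'rV[R]_m => x - y).
  by apply: (Ck_onD (f := id) (g := cst (- y))) => //; [exact: Ck_on_id|exact: Ck_on_cst].
exact: Ck_on_dot.
Qed.

Lemma derive_gauss_bump al y v x :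
  'D_v (gauss_bump al y) x = gauss_bump al y x * (- 2 * al * dot (x - y) v).
Proof.
have ds z : differentiable (fun x : 'rV[R]_m => x - y) z /\
    'D_v (fun x : 'rV[R]_m => x - y) z = v.
  have -> : (fun x : 'rV[R]_m => x - y) = id - cst y by [].
  have di : differentiable (id : 'rV[R]_m -> 'rV[R]_m) z by exact: ex_diff.
  split; first exact: differentiableB.
  rewrite deriveB; [|exact: derivable_id|exact: derivable_cst].
  by rewrite derive_id derive_cst subr0.
have dd : differentiable (fun x => dot (x - y) (x - y)) x.
  have sU : Ck_on 1 setT (fun x : 'rV[R]_m => dot (x - y) (x - y)).
    have sU : Ck_on 1 setT (fun x : 'rV[R]_m => x - y).
      apply: (Ck_onD (f := id) (g := cst (- y))); [exact: openT|exact: Ck_on_id|].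
      exact: Ck_on_cst.
    by apply: Ck_on_dot => //; exact: openT.
  exact: Ck_on_differentiable sU _.
have dal : differentiable (fun x => - al * dot (x - y) (x - y)) x.
  by have -> : (fun x => - al * dot (x - y) (x - y)) =
    - al *: (fun x => dot (x - y) (x - y)) by []; exact: differentiableZ.
have [_ E] := derive_expR_comp v dal; apply: etrans E _; congr (_ * _).
have E := @deriveZ _ _ _ (fun x => dot (x - y) (x - y)) (- al) x v (diff_derivable dd).
apply: etrans E _; rewrite derive_dot; [|exact: (ds x).1|exact: (ds x).1].
by rewrite (ds x).2 (dotC v) -[LHS]/(_ * _); ring.
Qed.

Lemma derive2_gauss_bump al y v x :
  'D_v ('D_v (gauss_bump al y)) x =
  gauss_bump al y x * (4 * al ^+ 2 * dot (x - y) v ^+ 2 - 2 * al * dot v v).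
Proof.
have -> : 'D_v (gauss_bump al y) =
    gauss_bump al y \* (fun x => - 2 * al * dot (x - y) v).
  by apply/funext => z; rewrite derive_gauss_bump.
have dl z : differentiable (fun x => - 2 * al * dot (x - y) v) z /\
    'D_v (fun x => - 2 * al * dot (x - y) v) z = - 2 * al * dot v v.
  have -> : (fun x => - 2 * al * dot (x - y) v) =
      (- 2 * al) *: ((fun x => dot x v) - cst (dot y v)).
    by apply/funext => w; rewrite dotBl.
  have -> : (fun x : 'rV[R]_m => dot x v) = \sum_i (v 0 i *: (fun x : 'rV[R]_m => x 0 i)).
    by apply/funext => w; rewrite fct_sumE; apply: eq_bigr => i _; rewrite mulrC.
  have dp i : differentiable (fun x : 'rV[R]_m => x 0 i) z.
    exact: differentiable_coord.
  have ds : differentiable (\sum_i (v 0 i *: (fun x : 'rV[R]_m => x 0 i))) z.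
    by apply: differentiable_sum => i; exact: differentiableZ.
  split; first by apply: differentiableZ; exact: differentiableB.
  rewrite deriveZ; last by apply: diff_derivable; exact: differentiableB.
  rewrite deriveB; [|exact: diff_derivable|exact: derivable_cst].
  rewrite derive_cst subr0 derive_sum; last first.
    by move=> i; apply: diff_derivable; exact: differentiableZ.
  congr (_ * _); apply: eq_bigr => i _.
  rewrite deriveZ; last exact: diff_derivable.
  by rewrite derive_proj.
have dg : differentiable (gauss_bump al y) x.
  by apply: (Ck_on_differentiable (Ck_on_gauss_bump al y 1 openT)).
rewrite deriveM; [|exact: diff_derivable|by apply: diff_derivable; exact: (dl x).1].
rewrite (dl x).2 derive_gauss_bump -[_ *: _]/(_ * _) -[X in _ + X]/(_ * _).
ring.
Qed.

End elliptic_operator.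

Section euclidean_norm.
Context {R : realType} {N : nat}.
Implicit Types u v w : 'rV[R]_N.

Definition enorm u := Num.sqrt (dot u u).

Lemma sqr_enorm u : enorm u ^+ 2 = dot u u.
Proof. by rewrite sqr_sqrtr// dot_ge0. Qed.

Lemma enorm_ge0 u : 0 <= enorm u.
Proof. exact: sqrtr_ge0. Qed.

Lemma enormN u : enorm (- u) = enorm u.
Proof. by rewrite /enorm dotNl dotNr opprK. Qed.

Lemma Cauchy_Schwarz_dot u v : dot u v ^+ 2 <= dot u u * dot v v.
Proof.
have [->|v0] := eqVneq v 0; first by rewrite !dot0r mulr0 expr0n.
have vv : 0 < dot v v by rewrite dot_gt0.
have := dot_ge0 (dot v v *: u - dot u v *: v).
rewrite !dotBl !dotBr !dotZl !dotZr (dotC v u).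
have -> : dot v v * (dot v v * dot u u) - dot v v * (dot u v * dot u v) -
  (dot u v * (dot v v * dot u v) - dot u v * (dot u v * dot v v)) =
  dot v v * (dot u u * dot v v - dot u v ^+ 2) by ring.
by rewrite pmulr_rge0// subr_ge0.
Qed.

Lemma dot_le_enorm u v : dot u v <= enorm u * enorm v.
Proof.
apply: (le_trans (ler_norm _)); rewrite -sqrtr_sqr -sqrtrM ?dot_ge0//.
by rewrite ler_wsqrtr// Cauchy_Schwarz_dot.
Qed.

Lemma ler_enormD u v : enorm (u + v) <= enorm u + enorm v.
Proof.
rewrite -(@ler_pXn2r _ 2) ?nnegrE ?addr_ge0 ?enorm_ge0//.
rewrite sqr_enorm dotDl !dotDr (dotC v u) sqrrD !sqr_enorm.
by have := dot_le_enorm u v; lra.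
Qed.

Lemma parallelogram u v :
  dot (u + v) (u + v) = 2 * dot u u + 2 * dot v v - dot (u - v) (u - v).
Proof. by rewrite !dotDl !dotDr !dotNl !dotNr (dotC v u); ring. Qed.

Lemma continuous_dot (T : topologicalType) (f g : T -> 'rV[R]_N) x :
  {for x, continuous f} -> {for x, continuous g} ->
  {for x, continuous (fun y => dot (f y) (g y))}.
Proof.
move=> fx gx; rewrite /dot /prop_for /continuous_at.
pose F := nbhs x; have FF : Filter F by exact: nbhs_filter.
suff H (s : seq 'I_N) : (fun y => \sum_(i <- s) f y 0 i * g y 0 i) @ F -->
    (\sum_(i <- s) f x 0 i * g x 0 i) by exact: H.
elim: s => [|i s IH].
  by under eq_fun do rewrite big_nil; rewrite big_nil; exact: cvg_cst.
under eq_fun do rewrite big_cons.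
rewrite big_cons; apply: cvgD => //.
by apply: cvgM; exact: cvg_coord.
Qed.

Lemma continuous_sub_cst y : continuous (fun x : 'rV[R]_N => x - y).
Proof.
move=> x; have H : Ck_on 0 setT (fun x : 'rV[R]_N => x - y).
  apply: (Ck_onD (f := id) (g := cst (- y))); first exact: openT.
    exact: Ck_on_id.
  exact: Ck_on_cst.
exact: (H x Logic.I).
Qed.

Lemma continuous_sqdist y : continuous (fun x : 'rV[R]_N => dot (x - y) (x - y)).
Proof.
move=> x; have c := @continuous_sub_cst y x.
exact: (@continuous_dot 'rV[R]_N (fun x => x - y) (fun x => x - y) x c c).
Qed.

Lemma compact_edisk y (r : R) : compact [set x : 'rV[R]_N | dot (x - y) (x - y) <= r].
Proof.
apply: bounded_closed_compact; last first.
  apply: (@closed_comp _ _ (fun x : 'rV[R]_N => dot (x - y) (x - y)) [set t | t <= r]).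
    by move=> x _; exact: continuous_sqdist.
  exact: closed_le.
exists (`|y| + Num.sqrt r); split; first exact: num_real.
move=> M xM x /= xr; rewrite ltW// (le_lt_trans _ xM)//.
rewrite -[x in leLHS](subrK y) addrC (le_trans (ler_normD _ _))// lerD//.
by rewrite (le_trans (norm_le_dot _))// ler_wsqrtr.
Qed.

End euclidean_norm.

(** * Hopf's strong minimum principle *)

Section strong_maximum_principle.
Context {R : realType} {m : nat}.
Implicit Types (u : 'rV[R]_m -> R) (x y z p b : 'rV[R]_m).
Local Notation e i := (delta_mx 0 i : 'rV[R]_m).
Local Notation dist2 x y := (dot (x - y) (x - y)).

(** Twice the trace of the skew part of the operator plus the squared length of the drift: the only
    feature of the coefficients on which the exponent of the barrier depends. *)
Definition op_size p b : R :=
  \sum_i \sum_j dot (skew_vec p i j) (skew_vec p i j) + dot b b.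

(** The skew directions add a nonnegative multiple of al^2, which is dropped; the drift is absorbed
    through 2 (x - y, b) <= |x - y|^2 + |b|^2, which costs the 1 in 4 al - 1. *)
Lemma elliptic_op_bump_gt0 p b al y x : 0 < al ->
  op_size p b + 2 * m%:R < (4 * al - 1) * dist2 x y ->
  0 < elliptic_op p b (gauss_bump al y) x.
Proof.
move=> al0; rewrite /op_size => hal.
set S := \sum_i \sum_j dot (x - y) (skew_vec p i j) ^+ 2.
set T := \sum_i \sum_j dot (skew_vec p i j) (skew_vec p i j) in hal *.
have S0 : 0 <= S by rewrite sumr_ge0// => i _; rewrite sumr_ge0// => j _; exact: sqr_ge0.
have E : elliptic_op p b (gauss_bump al y) x = gauss_bump al y x *
   (4 * al ^+ 2 * (dist2 x y + 2^-1 * S) - 2 * al * (m%:R + 2^-1 * T)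
    - 2 * al * dot (x - y) b).
  have sums (I : finType) (F G : I -> R) (A B C : R) :
      \sum_i A * (B * F i - C * G i) = A * (B * \sum_i F i - C * \sum_i G i).
    by rewrite -mulr_sumr sumrB !mulr_sumr.
  have E1 : \sum_i 'D_(e i) ('D_(e i) (gauss_bump al y)) x = gauss_bump al y x *
     (4 * al ^+ 2 * dist2 x y - 2 * al * m%:R).
    under eq_bigr do rewrite derive2_gauss_bump.
    rewrite sums; congr (_ * (_ * _ - _ * _)).
      by apply: eq_bigr => i _; rewrite dot_delta expr2.
    rewrite -[X in X%:R](card_ord m) -sumr_const; apply: eq_bigr => i _.
    by rewrite dot_delta mxE !eqxx.
  have E2 : \sum_i \sum_j 'D_(skew_vec p i j) ('D_(skew_vec p i j) (gauss_bump al y)) x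
     = gauss_bump al y x * (4 * al ^+ 2 * S - 2 * al * T).
    under eq_bigr do under eq_bigr do rewrite derive2_gauss_bump.
    by under eq_bigr do rewrite sums; rewrite sums.
  have alg (G q s t k w : R) : G * (4 * al ^+ 2 * q - 2 * al * k) +
     2^-1 * (G * (4 * al ^+ 2 * s - 2 * al * t)) + G * (- 2 * al * w) =
     G * (4 * al ^+ 2 * (q + 2^-1 * s) - 2 * al * (k + 2^-1 * t) - 2 * al * w) by field.
  apply: etrans _ (alg _ _ _ _ _ _); congr (_ + _ * _ + _) => //.
  exact: derive_gauss_bump.
rewrite E mulr_gt0 ?expR_gt0//.
have := dot_ge0 (x - y - b); rewrite dotBl !(dotBr _ (x - y)) (dotC b).
move: S0 hal; move: (dot (x - y) (x - y)) (dot (x - y) b) (dot b b) => q s bb.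
clearbody S T => S0 hal hs.
have : 0 < al * ((4 * al - 1) * q - (T + bb + 2 * m%:R)).
  by rewrite mulr_gt0// subr_gt0.
have : 0 <= al ^+ 2 * S by rewrite mulr_ge0// sqr_ge0.
have : 0 <= al * (q - s - (s - bb)) by rewrite mulr_ge0// ltW.
lra.
Qed.

(** If [u] were positive at a point [x1] close to [x0], let [z] be a zero of [u] nearest to [x1].
    Some ball touches the zero set only at [z], and subtracting a small multiple of Hopf's barrier
    creates an interior minimum near [z] at which the operator is negative. *)
Theorem strong_min_principle u (p b : 'rV[R]_m -> 'rV[R]_m) U (C : R) x0 :
  open U -> U x0 -> Ck_on 2 U u -> (forall x, U x -> 0 <= u x) -> u x0 = 0 ->
  (forall x, U x -> op_size (p x) (b x) <= C) ->
  (forall x, U x -> elliptic_op (p x) (b x) u x <= 0) ->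
  \forall x \near x0, u x = 0.
Proof.
move=> Uo Ux0 uU u0 ux0 opC Lu.
have uc x : U x -> {for x, continuous u} by exact: Ck_on_continuous uU.
have /nbhs_ballP[r /= r0 rU] : nbhs x0 U by exact: open_nbhs_nbhs.
(* Room for the construction: [x1] lies within rho of [x0], the zeros considered within 2 rho, and
   the ball about [z] within 3 rho. *)
pose rho := r / 4.
have rho0 : 0 < rho by rewrite divr_gt0.
have inU x : enorm (x - x0) < 4 * rho -> U x.
  move=> xr; apply/rU/ball_of_dot => //; rewrite -sqr_enorm ltr_pXn2r// ?nnegrE ?enorm_ge0 ?ltW//.
  by apply: lt_le_trans xr _; rewrite /rho; lra.
suff main x1 : enorm (x1 - x0) < rho -> ~ (0 < u x1).
  have /nbhs_ballP : nbhs (dot (x0 - x0) (x0 - x0)) (ball (0 : R) (rho ^+ 2)).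
    apply: open_nbhs_nbhs; split; first exact: ball_open.
    by rewrite subrr dot0l; apply: ballxx; rewrite exprn_gt0.
  move=> _; have := @continuous_sqdist _ _ x0 x0.
  rewrite /continuous_at subrr dot0l => /cvgrPdist_lt/(_ (rho ^+ 2)).
  rewrite exprn_gt0// => /(_ isT); apply: filterS => x.
  rewrite sub0r normrN ger0_norm ?dot_ge0// -sqr_enorm ltr_pXn2r ?nnegrE ?enorm_ge0 ?ltW//.
  move=> xr; apply/eqP; rewrite eq_le u0 ?andbT.
    by rewrite leNgt; apply/negP; exact: main.
  by apply: inU; lra.
move=> x1r ux1.
pose K := [set x | dist2 x x0 <= (2 * rho) ^+ 2].
have KE x : K x <-> enorm (x - x0) <= 2 * rho.
  rewrite /K /= -sqr_enorm ler_pXn2r ?nnegrE ?enorm_ge0//.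
  by rewrite mulr_ge0// ltW.
have KU x : K x -> U x by move=> /KE xr; apply: inU; lra.
pose O := [set x | U x /\ u x != 0].
have Oo : open O.
  rewrite openE => x [Ux uxn0].
  have un : nbhs (u x) [set t | t != 0] by apply: open_nbhs_nbhs; split => //; exact: open_neq.
  exact: filterI (open_nbhs_nbhs (conj Uo Ux)) (uc x Ux _ un).
have Zc : compact (K `&` ~` O).
  by apply: compact_closedI; [exact: compact_edisk|exact: open_closedC].
have ZP x : (K `&` ~` O) x <-> K x /\ u x = 0.
  split=> [[Kx nO]|[Kx ux]]; split=> //.
    by apply/eqP; apply/negPn/negP => uxn; apply: nO; split=> //; exact: KU.
  by move=> [_]; rewrite ux eqxx.
have Zx0 : (K `&` ~` O) x0.
  by apply/ZP; split=> //; apply/KE; rewrite subrr /enorm dot0l sqrtr0 mulr_ge0// ltW.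
have [z /set_mem/ZP[Kz uz] zmin] := EVT_min_rV (ex_intro _ _ Zx0) Zc
  (continuous_subspaceT (@continuous_sqdist R m x1)).
have {}zmin x : K x -> u x = 0 -> dist2 z x1 <= dist2 x x1.
  by move=> Kx ux; apply: zmin; apply/mem_set/ZP.
have d2_gt0 : 0 < dist2 z x1.
  rewrite dot_gt0 subr_eq0; apply/eqP => zx1.
  by move: ux1; rewrite -zx1 uz ltxx.
(* The squared radius of the ball about [y] having the segment from [x1] to [z] as diameter. *)
pose q := dist2 z x1 / 4.
have q0 : 0 < q by rewrite divr_gt0.
have d2_lt : enorm (z - x1) < rho.
  rewrite -(@ltr_pXn2r _ 2) ?nnegrE ?enorm_ge0 ?ltW// sqr_enorm.
  apply: le_lt_trans (zmin x0 Zx0.1 ux0) _; rewrite -sqr_enorm -enormN opprB.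
  by rewrite ltr_pXn2r ?nnegrE ?enorm_ge0 ?ltW.
(* The closed ball about this midpoint meets the sphere about [x1] through [z] only at [z]. By
   minimality of [z], [u] is therefore positive on the rest of it; the parallelogram law makes the
   inclusion strict. *)
pose y := 2^-1 *: (x1 + z).
have yx1 : y - x1 = 2^-1 *: (z - x1) by apply/rowP => i; rewrite !mxE; field.
have zy : z - y = 2^-1 *: (z - x1) by apply/rowP => i; rewrite !mxE; field.
have zy_q : dist2 z y = q by rewrite zy dotZl dotZr /q; field.
have yx1_q : dist2 y x1 = q by rewrite yx1 dotZl dotZr /q; field.
have touch x : dist2 x y <= q -> x != z -> 0 < u x.
  move=> xy xz.
  have xx1 : dist2 x x1 < dist2 z x1.
    have -> : x - x1 = (x - y) + (y - x1) by rewrite subrKA.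
    have : 0 < dist2 x z by rewrite dot_gt0 subr_eq0.
    have -> : x - z = (x - y) - (y - x1) by rewrite yx1 -zy opprB addrA subrK.
    have -> : dist2 z x1 = 4 * q by rewrite /q; field.
    by rewrite (parallelogram (x - y) (y - x1)) yx1_q; lra.
  have Kx : K x.
    apply/KE; have := ler_enormD (x - x1) (x1 - x0); rewrite subrKA.
    have : enorm (x - x1) < rho.
      apply: le_lt_trans d2_lt; rewrite -(@ler_pXn2r _ 2) ?nnegrE ?enorm_ge0//.
      by rewrite !sqr_enorm ltW.
    lra.
  rewrite lt_neqAle u0 ?andbT; last exact: KU.
  apply/eqP => ux; have := zmin x Kx (esym ux); rewrite leNgt; exact/negP/negPn.
(* Half the radius of the other ball, which keeps [N] away from the centre [y], where the operator
   is not positive on the barrier. *)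
pose N := [set x | dist2 x z <= q / 4].
have Nc : compact N by exact: compact_edisk.
have NU x : N x -> U x.
  move=> Nx; apply: inU; have := ler_enormD (x - z) (z - x0); rewrite subrKA.
  have : enorm (x - z) <= enorm (z - x1).
    rewrite -(@ler_pXn2r _ 2) ?nnegrE ?enorm_ge0// !sqr_enorm.
    by apply: le_trans Nx _; rewrite /q; move: (dist2 z x1) d2_gt0 => *; lra.
  by move/KE : Kz; lra.
have Nfar x : N x -> q / 4 <= dist2 x y.
  move=> Nx.
  have h1 : enorm (x - z) <= enorm (z - y) / 2.
    rewrite -(@ler_pXn2r _ 2) ?nnegrE ?divr_ge0 ?enorm_ge0//.
    rewrite expr_div_n !sqr_enorm zy_q; apply: le_trans Nx _.
    by rewrite -[4]/(2 * 2)%:R -natrX.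
  have := ler_enormD (z - x) (x - y); rewrite subrKA -(enormN (z - x)) opprB => h2.
  have h3 : enorm (z - y) / 2 <= enorm (x - y) by lra.
  rewrite -zy_q -!sqr_enorm.
  have : (enorm (z - y) / 2) ^+ 2 <= enorm (x - y) ^+ 2.
    by rewrite ler_pXn2r ?nnegrE ?divr_ge0 ?enorm_ge0.
  by rewrite expr_div_n -[4]/(2 * 2)%:R -natrX.
have C0 : 0 <= C.
  apply: le_trans (opC x0 Ux0); rewrite /op_size addr_ge0 ?dot_ge0//.
  by rewrite sumr_ge0// => i _; rewrite sumr_ge0// => j _; exact: dot_ge0.
(* On [N] the squared distance to [y] is at least q / 4, and (4 al - 1) q / 4 equals C + 2 m + 1 + 3
   q / 4, above the threshold of [elliptic_op_bump_gt0]. *)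
pose al := (C + 2 * m%:R + 1) / q + 1.
have al0 : 0 < al.
  by rewrite addr_gt0// divr_gt0// ltr_wpDl// addr_ge0// mulr_ge0.
have alP x : N x -> 0 < elliptic_op (p x) (b x) (gauss_bump al y) x.
  move=> Nx; apply: elliptic_op_bump_gt0 => //.
  apply: (@le_lt_trans _ _ (C + 2 * m%:R)); first by rewrite lerD2r; exact/opC/NU.
  have al1 : 1 <= al.
    rewrite lerDr divr_ge0//; last exact: ltW.
    by rewrite addr_ge0// addr_ge0// mulr_ge0.
  apply: (@lt_le_trans _ _ ((4 * al - 1) * (q / 4))); last first.
    by rewrite ler_wpM2l; [|lra|exact: Nfar].
  have -> : (4 * al - 1) * (q / 4) = (C + 2 * m%:R + 1) + 3 / 4 * q.
    by rewrite /al; field; rewrite gt_eqF.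
  lra.
(* The part of the boundary sphere of [N] inside the touching ball. It is compact and avoids [z], so
   [u] is bounded below there by some dl > 0; any dl serves if it is empty. *)
pose S := N `&` ([set x | q / 4 <= dist2 x z] `&` [set x | dist2 x y <= q]).
have uN D : D `<=` N -> {within D, continuous u}.
  move=> DN; apply: continuous_in_subspaceT => x /set_mem/DN/NU.
  exact: uc.
have [dl dl0 dlP] : exists2 dl, 0 < dl & forall x, S x -> dl <= u x.
  have Sc : compact S.
    apply: compact_closedI => //; apply: closedI.
      apply: (@closed_comp _ _ (fun x : 'rV[R]_m => dist2 x z) [set t | q / 4 <= t]).
        by move=> x _; exact: continuous_sqdist.
      exact: closed_ge.
    apply: (@closed_comp _ _ (fun x : 'rV[R]_m => dist2 x y) [set t | t <= q]).
      by move=> x _; exact: continuous_sqdist.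
    exact: closed_le.
  have [S0|S0] := pselect (S !=set0).
    have [c /set_mem Sc' cmin] := EVT_min_rV S0 Sc (uN S (@subIsetl _ _ _)).
    exists (u c); last by move=> x Sx; apply: cmin; exact: mem_set.
    have [Nc' [/= cz cy]] := Sc'; apply: touch => //.
    by rewrite -subr_eq0 -dot_eq0 gt_eqF// (lt_le_trans _ cz)// divr_gt0.
  by exists 1 => // x Sx; exfalso; apply: S0; exists x.
pose ep := dl / 2.
have ep0 : 0 < ep by rewrite divr_gt0.
(* On [S] the choice ep = dl / 2 keeps [h] positive. On the rest of the boundary u >= 0 and the
   barrier is smaller than at [z]. Both values exceed [h z], so a minimum over [N] is interior. *)
pose h x := u x + (- ep) * gauss_bump al y x.
have bc : Ck_on 2 setT (gauss_bump al y) by apply: Ck_on_gauss_bump; exact: openT.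
have bU : Ck_on 2 U (gauss_bump al y) by exact: Ck_on_sub bc.
have hU : Ck_on 2 U h by exact: (Ck_onD Uo uU (Ck_onZ (- ep) Uo bU)).
have Nz : N z by rewrite /N/= subrr dot0l divr_ge0// ltW.
have hN : {within N, continuous h}.
  apply: continuous_in_subspaceT => x /set_mem/NU Ux.
  exact: Ck_on_continuous hU Ux.
have [xb /set_mem Nxb xbmin] := EVT_min_rV (ex_intro _ _ Nz) Nc hN.
have hz : h xb <= - ep * expR (- al * q).
  by apply: le_trans (xbmin z (mem_set Nz)) _; rewrite /h uz add0r /gauss_bump zy_q.
have [xbz|xbz] := ltP (dist2 xb z) (q / 4).
  have hmin : local_min h xb.
    have : open_nbhs xb [set x | dist2 x z < q / 4].
      split=> //; apply: (@open_comp _ _ (fun x : 'rV[R]_m => dist2 x z) [set t | t < q / 4]).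
        by move=> x _; exact: continuous_sqdist.
      exact: open_lt.
    move=> /open_nbhs_nbhs; apply: filterS => x xz.
    by apply: xbmin; apply/mem_set/ltW.
  have Uxb := NU _ Nxb.
  have := elliptic_op_min (p xb) (b xb) Uo Uxb hU hmin.
  rewrite (elliptic_op_lin (- ep) (p xb) (b xb) Uo Uxb uU bU) leNgt => /negP; apply.
  by rewrite mulNr subr_lt0 (le_lt_trans (Lu xb Uxb))// mulr_gt0// alP.
have bump_le1 : gauss_bump al y xb <= 1.
  rewrite -expR0 ler_expR mulNr oppr_le0 mulr_ge0 ?dot_ge0//; exact: ltW.
have [xby|xby] := leP (dist2 xb y) q.
  have ud : dl <= u xb by apply: dlP.
  have e0 : 0 < ep * expR (- al * q) by rewrite mulr_gt0// expR_gt0.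
  have e1 : ep * gauss_bump al y xb <= ep * 1 by rewrite ler_pM2l.
  move: hz; rewrite /h !(mulNr ep) leNgt => /negP; apply.
  apply: (@lt_trans _ _ 0); first by rewrite oppr_lt0.
  rewrite subr_gt0 (le_lt_trans e1)// mulr1 (lt_le_trans _ ud)// /ep.
  by rewrite ltr_pdivrMr// ltr_pMr// ltr1n.
have e1 : ep * gauss_bump al y xb < ep * expR (- al * q).
  by rewrite ltr_pM2l// ltr_expR !mulNr ltrN2 ltr_pM2l.
move: hz; rewrite /h !(mulNr ep) leNgt => /negP; apply.
by rewrite ltr_wpDl ?ltrN2// u0//; exact: NU.
Unshelve. all: by end_near. Qed.

End strong_maximum_principle.

(** * Self-shrinking graphs *)

Section has_derivative.
Context {R : realType} {V : normedModType R}.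
Implicit Types (f g : V -> R) (x v : V).

(** Differentiability is bundled with the value, so that the derivative of a long expression is
    assembled by the rules below without side conditions. *)
Definition has_D f x v (d : R) := differentiable f x /\ 'D_v f x = d.

Lemma has_D_cst (c : R) x v : has_D (fun _ => c) x v 0.
Proof. by split; [exact: differentiable_cst|exact: derive_cst]. Qed.

Lemma has_DD f g x v df dg : has_D f x v df -> has_D g x v dg ->
  has_D (fun y => f y + g y) x v (df + dg).
Proof.
move=> [fx <-] [gx <-]; split; first exact: differentiableD.
exact: (deriveD (diff_derivable fx) (diff_derivable gx)).
Qed.

Lemma has_DM f g x v df dg : has_D f x v df -> has_D g x v dg ->
  has_D (fun y => f y * g y) x v (df * g x + f x * dg).
Proof.
move=> [fx <-] [gx <-]; split; first exact: differentiableM.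
have E := deriveM (diff_derivable fx) (diff_derivable gx).
have -> : (fun y => f y * g y) = f * g by [].
by rewrite E addrC; congr (_ + _); exact: mulrC.
Qed.

Lemma has_DZ f x v df (c : R) : has_D f x v df ->
  has_D (fun y => c * f y) x v (c * df).
Proof.
by move=> fx; have := has_DM (has_D_cst c x v) fx; rewrite mul0r add0r.
Qed.

Lemma has_DB f g x v df dg : has_D f x v df -> has_D g x v dg ->
  has_D (fun y => f y - g y) x v (df - dg).
Proof.
move=> fx /(has_DZ (-1)) gx; have := has_DD fx gx; rewrite mulN1r.
by under eq_fun do rewrite mulN1r.
Qed.

Lemma has_D_sum (I : Type) (s : seq I) (f : I -> V -> R) x v (df : I -> R) :
  (forall i, has_D (f i) x v (df i)) ->
  has_D (fun y => \sum_(i <- s) f i y) x v (\sum_(i <- s) df i).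
Proof.
move=> fx; elim: s => [|i s IH].
  by rewrite big_nil; under eq_fun do rewrite big_nil; exact: has_D_cst.
by rewrite big_cons; under eq_fun do rewrite big_cons; exact: has_DD.
Qed.

Lemma has_D_eq f x v d d' : d = d' -> has_D f x v d -> has_D f x v d'.
Proof. by move=> ->. Qed.

Lemma has_D_Ck f x v U : Ck_on 1 U f -> U x -> has_D f x v ('D_v f x).
Proof. by move=> fU Ux; split=> //; exact: Ck_on_differentiable fU Ux. Qed.

Lemma has_D_near_eq f g x v d : {near x, f =1 g} -> has_D f x v d -> has_D g x v d.
Proof.
move=> fg [fx <-]; split; first exact: near_eq_differentiable fx.
by apply: near_eq_derive; apply: filterS fg => y ->.
Qed.

End has_derivative.

(** * The graph equation and its linearisation *)

Section graph_equation.
Context {R : realType} {m : nat}.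
Implicit Types (f u : 'rV[R]_m -> R) (x p b v : 'rV[R]_m).
Local Notation e i := (delta_mx 0 i : 'rV[R]_m).

Definition grad f x : 'rV[R]_m := \row_i 'D_(e i) f x.

Definition laplacian f x : R := \sum_i 'D_(e i) ('D_(e i) f) x.

(* The equation [g^ij f_ij = (x . Df - f) / 2] of self-shrinking graphs,
   multiplied by [1 + |Df|^2]. *)
Definition shrinker_graph_expr f x : R :=
  (1 + dot (grad f x) (grad f x)) *
    (laplacian f x - 2^-1 * ('D_x f x - f x))
  - \sum_i \sum_j grad f x 0 i * grad f x 0 j * 'D_(e i) ('D_(e j) f) x.

Definition shrinker_graph U f := forall x, U x -> shrinker_graph_expr f x = 0.

Lemma derive_grad f x v : differentiable f x -> 'D_v f x = dot v (grad f x).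
Proof.
by move=> fx; rewrite derive_delta//; apply: eq_bigr => i _; rewrite mxE.
Qed.

Lemma derive_dirD f x v w : differentiable f x ->
  'D_(v + w) f x = 'D_v f x + 'D_w f x.
Proof. by move=> fx; rewrite !derive_grad// dotDl. Qed.

Lemma derive_dirZ f x (a : R) v : differentiable f x -> 'D_(a *: v) f x = a * 'D_v f x.
Proof. by move=> fx; rewrite !derive_grad// dotZl. Qed.

Lemma bilinear_skew (H : 'rV[R]_m -> 'rV[R]_m -> R) p i j :
  (forall a v w z, H (v + a *: w) z = H v z + a * H w z) ->
  (forall v w, H v w = H w v) ->
  H (skew_vec p i j) (skew_vec p i j) = p 0 i ^+ 2 * H (e j) (e j)
    - 2 * (p 0 i * p 0 j * H (e i) (e j)) + p 0 j ^+ 2 * H (e i) (e i).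
Proof.
move=> H1 H0.
have H2 a v w z : H z (v + a *: w) = H z v + a * H z w by rewrite H0 H1 !(H0 z).
have H00 z : H 0 z = 0.
  by have := H1 1 0 0 z; rewrite scaler0 addr0 mul1r; lra.
have -> : skew_vec p i j = 0 + p 0 i *: e j + (- p 0 j) *: e i.
  by rewrite /skew_vec add0r scaleNr.
by rewrite H1 !H2 !H1 !(H0 _ 0) !H00 (H0 (e j) (e i)); ring.
Qed.

Lemma derive2_skew u x p i j U : open U -> U x -> Ck_on 2 U u ->
  'D_(skew_vec p i j) ('D_(skew_vec p i j) u) x =
  p 0 i ^+ 2 * 'D_(e j) ('D_(e j) u) x - 2 * (p 0 i * p 0 j * 'D_(e i) ('D_(e j) u) x)
  + p 0 j ^+ 2 * 'D_(e i) ('D_(e i) u) x.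
Proof.
move=> Uo Ux u2.
apply: (@bilinear_skew (fun v w => 'D_v ('D_w u) x)) => [a v w z|v w].
  have dz := Ck_on_differentiable (Ck_on_derive z u2) Ux.
  apply: etrans (derive_dirD _ _ dz) _; congr (_ + _); exact: derive_dirZ.
exact: Schwarz Uo Ux u2.
Qed.

(** Each of the two square terms of the skew directions sums to |p|^2 times the Laplacian, and the
    mixed terms to twice the quadratic form; the factor 1/2 restores the usual coefficients. *)
Lemma elliptic_opE u x p b U : open U -> U x -> Ck_on 2 U u ->
  elliptic_op p b u x = (1 + dot p p) * laplacian u x
   - \sum_i \sum_j p 0 i * p 0 j * 'D_(e i) ('D_(e j) u) x + 'D_b u x.
Proof.
move=> Uo Ux u2; rewrite /elliptic_op; congr (_ + _).
have -> : \sum_i \sum_j 'D_(skew_vec p i j) ('D_(skew_vec p i j) u) x =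
   \sum_i \sum_j (p 0 i ^+ 2 * 'D_(e j) ('D_(e j) u) x
     - 2 * (p 0 i * p 0 j * 'D_(e i) ('D_(e j) u) x)
     + p 0 j ^+ 2 * 'D_(e i) ('D_(e i) u) x).
  by apply: eq_bigr => i _; apply: eq_bigr => j _; exact: derive2_skew Uo Ux u2.
rewrite -/(laplacian u x).
pose F i j := p 0 i * p 0 j * 'D_(e i) ('D_(e j) u) x.
pose G i := 'D_(e i) ('D_(e i) u) x.
rewrite -[X in _ = _ - X]/(\sum_i \sum_j F i j).
have -> : \sum_i \sum_j (p 0 i ^+ 2 * 'D_(e j) ('D_(e j) u) x
     - 2 * (p 0 i * p 0 j * 'D_(e i) ('D_(e j) u) x)
     + p 0 j ^+ 2 * 'D_(e i) ('D_(e i) u) x) =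
   dot p p * laplacian u x - 2 * (\sum_i \sum_j F i j) + dot p p * laplacian u x.
  have E1 : \sum_i \sum_j p 0 i ^+ 2 * G j = dot p p * laplacian u x.
    rewrite /dot mulr_suml; apply: eq_bigr => i _.
    by rewrite mulr_sumr; apply: eq_bigr => j _; rewrite expr2.
  have E2 : \sum_i \sum_j p 0 j ^+ 2 * G i = dot p p * laplacian u x.
    by rewrite exchange_big.
  rewrite -{1}E1 -E2 mulr_sumr -sumrB -big_split; apply: eq_bigr => i _ /=.
  rewrite mulr_sumr -sumrB -big_split; apply: eq_bigr => j _ /=.
  by [].
by move: (laplacian u x) (\sum_i _) (dot p p) => A B C; field.
Qed.

Lemma Ck_on_grad f k U : open U -> Ck_on k.+1 U f -> Ck_on k U (grad f).
Proof.
move=> Uo fU; apply/(Ck_on_rV k (grad f) Uo) => i.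
have -> : (fun x => grad f x 0 i) = 'D_(e i) f by apply/funext => x; rewrite mxE.
exact: Ck_on_derive.
Qed.

(** The first-order coefficients of the linearised equation. The summands come from differentiating
    1 + |Df|^2, the term x . Df, and the products f_i f_j, in this order. *)
Definition drift f x : 'rV[R]_m :=
  (2 * (laplacian f x - 2^-1 * ('D_x f x - f x))) *: grad f x
  + (- (2^-1 * (1 + dot (grad f x) (grad f x)))) *: x
  + (-2) *: (\row_j \sum_i grad f x 0 i * 'D_(e i) ('D_(e j) f) x).

(** Here [g] and [F] stand for the gradient and Hessian of f, [d], [H] and [lu] for the gradient,
    Hessian and Laplacian of u = D_v f, [q] for the bracket in the equation, [dv] for D_v f and [xu]
    for D_x u. The right side is the differentiated equation, in which [dv] cancels. *)
Lemma drift_algebra (g d : 'I_m -> R) (F H : 'I_m -> 'I_m -> R) (lu q dv xu : R) :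
  (forall i j, F i j = F j i) ->
  (1 + \sum_i g i * g i) * lu - \sum_i \sum_j g i * g j * H i j +
   ((2 * q) * (\sum_i g i * d i) + (- (2^-1 * (1 + \sum_i g i * g i))) * xu +
    (-2) * (\sum_j (\sum_i g i * F i j) * d j)) =
  (0 + \sum_i (d i * g i + g i * d i)) * q +
  (1 + \sum_i g i * g i) * (lu - 2^-1 * (dv + xu - dv)) -
  \sum_i \sum_j ((d i * g j + g i * d j) * F i j + g i * g j * H i j).
Proof.
move=> Fsym.
have -> : \sum_i (d i * g i + g i * d i) = 2 * \sum_i g i * d i.
  by rewrite mulr_sumr; apply: eq_bigr => i _; ring.
have -> : \sum_i \sum_j ((d i * g j + g i * d j) * F i j + g i * g j * H i j) =
    2 * (\sum_j (\sum_i g i * F i j) * d j) + \sum_i \sum_j g i * g j * H i j.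
  have E1 : \sum_i \sum_j g i * d j * F i j = \sum_j (\sum_i g i * F i j) * d j.
    rewrite exchange_big; apply: eq_bigr => j _; rewrite mulr_suml.
    by apply: eq_bigr => i _; ring.
  have E2 : \sum_i \sum_j d i * g j * F i j = \sum_j (\sum_i g i * F i j) * d j.
    apply: eq_bigr => i _; rewrite mulr_suml.
    by apply: eq_bigr => j _; rewrite Fsym; ring.
  have -> : 2 * (\sum_j (\sum_i g i * F i j) * d j) =
      \sum_i \sum_j d i * g j * F i j + \sum_i \sum_j g i * d j * F i j.
    by rewrite E1 E2; ring.
  rewrite -!big_split; apply: eq_bigr => i _; rewrite -!big_split.
  by apply: eq_bigr => j _ /=; ring.
move: (\sum_i g i * g i) (\sum_i g i * d i) (\sum_j _) (\sum_i _) => A B C D.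
by field.
Qed.

(* The zero-order terms cancel: translations and dilations combine so that
   directional derivatives of [f] solve an equation without potential. *)
Lemma elliptic_op_derive f U x v : open U -> U x -> Ck_on 3 U f ->
  shrinker_graph U f -> elliptic_op (grad f x) (drift f x) ('D_v f) x = 0.
Proof.
move=> Uo Ux f3 fpde.
have f2 := Ck_onW f3; have f1 := Ck_onW f2.
set u := 'D_v f.
have u2 : Ck_on 2 U u by exact: Ck_on_derive.
have u1 := Ck_onW u2.
have du := Ck_on_differentiable u1 Ux.
have D1 i : has_D ('D_(e i) f) x v ('D_(e i) u x).
  apply: has_D_eq (has_D_Ck v (Ck_on_derive (e i) f2) Ux).
  exact: Schwarz Uo Ux f2.
have D2 i j : has_D ('D_(e i) ('D_(e j) f)) x v ('D_(e i) ('D_(e j) u) x).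
  apply: has_D_eq (has_D_Ck v (Ck_on_derive (e i) (Ck_on_derive (e j) f3)) Ux).
  apply: etrans (Schwarz v (e i) Uo Ux (Ck_on_derive (e j) f3)) _.
  apply: near_eq_derive; apply: filterS (open_nbhs_nbhs (conj Uo Ux)) => y Uy.
  exact: (Schwarz v (e j) Uo Uy f2).
have Dg i : has_D (fun y => grad f y 0 i) x v ('D_(e i) u x).
  by have := D1 i; congr has_D; apply/funext => y; rewrite mxE.
have Dx i : has_D (fun y : 'rV[R]_m => y 0 i) x v (v 0 i).
  split; first exact: differentiable_coord.
  by rewrite derive_proj.
(* The direction varies with the point, so the derivative is expanded in partial derivatives first.
   The extra term ['D_v f x] is the one that the derivative of - f cancels. *)
have DE : has_D (fun y => 'D_y f y) x v ('D_v f x + 'D_x u x).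
  have fE : \forall y \near x, \sum_i (y : 'rV[R]_m) 0 i * 'D_(e i) f y = 'D_y f y.
    apply: filterS (open_nbhs_nbhs (conj Uo Ux)) => y Uy; apply/esym/derive_delta.
    exact: (Ck_on_differentiable f1).
  apply: (has_D_near_eq fE).
  apply: has_D_eq (has_D_sum (index_enum _) (fun i => has_DM (Dx i) (D1 i))).
  apply: etrans (big_split _ _ _ _ _) _; congr (_ + _); apply/esym/derive_delta => //.
  exact: Ck_on_differentiable f1 Ux.
have Dlap : has_D (laplacian f) x v (laplacian u x).
  exact: has_D_sum (fun i => D2 i i).
have Df := has_D_Ck v f1 Ux.
have DP := has_DB (has_DM (has_DD (has_D_cst 1 x v) (has_D_sum (index_enum _) (fun i => has_DM (Dg i) (Dg i))))
  (has_DB Dlap (has_DZ 2^-1 (has_DB DE Df))))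
  (has_D_sum (index_enum _) (fun i => has_D_sum (index_enum _) (fun j =>
     has_DM (has_DM (Dg i) (Dg j)) (D2 i j)))).
have E0 : 'D_v (shrinker_graph_expr f) x = 0.
  have fE : \forall y \near x, shrinker_graph_expr f y = cst 0 y.
    by apply: filterS (open_nbhs_nbhs (conj Uo Ux)) => y; exact: fpde.
  by apply: etrans (near_eq_derive v fE) _; exact: derive_cst.
move: DP => [_ DP].
have Dg_u w : 'D_w u x = \sum_i w 0 i * 'D_(e i) u x by exact: derive_delta.
have Sf i j : 'D_(e i) ('D_(e j) f) x = 'D_(e j) ('D_(e i) f) x by exact: Schwarz Uo Ux f2.
apply: etrans (elliptic_opE _ _ Uo Ux u2) _; apply: etrans _ E0; apply: etrans _ (esym DP).
apply: etrans _ (drift_algebra _ _ _ _ _ _ _ Sf); congr (_ + _).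
apply: etrans (derive_dirD _ _ du) _; congr (_ + _); last first.
  apply: etrans (derive_dirZ _ _ du) _; congr (_ * _).
  by apply: etrans (Dg_u _) _; apply: eq_bigr => j _; rewrite mxE.
apply: etrans (derive_dirD _ _ du) _; congr (_ + _); apply: etrans (derive_dirZ _ _ du) _ => //.
by congr (_ * _); exact: Dg_u.
Unshelve. all: by end_near. Qed.

End graph_equation.

Section graph_maximum_principles.
Context {R : realType} {m : nat}.
Implicit Types (f u : 'rV[R]_m -> R) (x p b v : 'rV[R]_m) (U : set 'rV[R]_m).
Local Notation e i := (delta_mx 0 i : 'rV[R]_m).

Lemma Ck_on_drift f U : open U -> Ck_on 2 U f -> Ck_on 0 U (drift f).
Proof.
move=> Uo f2; have f1 := Ck_onW f2; have f0 := Ck_onW f1.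
have fg := Ck_on_grad Uo f1.
have fgi i : Ck_on 0 U (fun x => grad f x 0 i) by exact: (Ck_on_rV 0 (grad f) Uo).1.
have fd : Ck_on 0 U (fun x => 'D_x f x).
  suff : Ck_on 0 U (fun x => \sum_i x 0 i * 'D_(e i) f x).
    apply: Ck_on_ext => // x /set_mem Ux; apply/esym/derive_delta.
    exact: Ck_on_differentiable f1 Ux.
  exact: (Ck_on_sum (index_enum _) Uo (fun i _ => Ck_onM Uo (Ck_on_coord 0 U i) (Ck_on_derive (e i) f1))).
have fl : Ck_on 0 U (fun x => laplacian f x).
  exact: (Ck_on_sum (index_enum _) Uo (fun i _ => Ck_on_derive (e i) (Ck_on_derive (e i) f2))).
have fW : Ck_on 0 U (fun x => dot (grad f x) (grad f x)) by exact: Ck_on_dot.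
have fQ := Ck_onD Uo fl (Ck_onZ (-1) Uo (Ck_onZ 2^-1 Uo (Ck_onD Uo fd (Ck_onZ (-1) Uo f0)))).
apply/(Ck_on_rV 0 (drift f) Uo) => j.
have fS : Ck_on 0 U (fun x => \sum_i grad f x 0 i * 'D_(e i) ('D_(e j) f) x).
  exact: (Ck_on_sum (index_enum _) Uo (fun i _ =>
    Ck_onM Uo (fgi i) (Ck_on_derive (e i) (Ck_on_derive (e j) f2)))).
have H := Ck_onD Uo (Ck_onD Uo (Ck_onM Uo (Ck_onZ 2 Uo fQ) (fgi j))
   (Ck_onM Uo (Ck_onZ (-1) Uo (Ck_onZ 2^-1 Uo (Ck_onD Uo (@Ck_on_cst _ _ R 0 U 1) fW)))
     (Ck_on_coord 0 U j))) (Ck_onZ (-2) Uo fS).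
apply: Ck_on_ext H => // x _ /=.
by rewrite !mxE !mulN1r.
Qed.

(** With the coefficients evaluated on [f] itself, the equation is linear in ['D_v f]. They are
    continuous, so [op_size] is bounded on a small ball and Hopf's principle applies there. *)
Theorem derive_graph_vanishes f U x0 v : open U -> U x0 -> Ck_on 3 U f ->
  shrinker_graph U f -> (forall x, U x -> 0 <= 'D_v f x) -> 'D_v f x0 = 0 ->
  \forall x \near x0, 'D_v f x = 0.
Proof.
move=> Uo Ux0 f3 fpde f0 fx0; have f2 := Ck_onW f3; have f1 := Ck_onW f2.
pose S x := op_size (grad f x) (drift f x).
have fg := Ck_on_grad Uo f1.
have fgi i : Ck_on 0 U (fun x => grad f x 0 i) by exact: (Ck_on_rV 0 (grad f) Uo).1.
have Sc : Ck_on 0 U S.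
  have dd := Ck_on_dot Uo (Ck_on_drift Uo f2) (Ck_on_drift Uo f2).
  have sk i j : Ck_on 0 U (fun x => skew_vec (grad f x) i j).
    apply/(Ck_on_rV 0 (fun x => skew_vec (grad f x) i j) Uo) => k.
    have H := Ck_onD Uo (Ck_onZ (e j 0 k) Uo (fgi i)) (Ck_onZ (- e i 0 k) Uo (fgi j)).
    by apply: Ck_on_ext H => // x _ /=; rewrite !mxE; ring.
  have ss := Ck_on_sum (index_enum _) Uo (fun i (_ : true) => Ck_on_sum (index_enum _) Uo (fun j (_ : true) =>
    Ck_on_dot Uo (sk i j) (sk i j))).
  exact: Ck_onD Uo ss dd.
have SU : \forall x \near x0, U x /\ S x <= S x0 + 1.
  have Sx0 : \forall x \near x0, S x <= S x0 + 1.
    have /cvgrPdist_le/(_ 1 ltr01) Sn := Sc x0 Ux0; near=> x.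
    have : `|S x0 - S x| <= 1 by near: x.
    by rewrite ler_norml => /andP[+ _]; rewrite lerNl opprB lerBlDl.
  exact: filterI (open_nbhs_nbhs (conj Uo Ux0)) Sx0.
have /nbhs_ballP[r /= r0 rU] := SU.
have bo : open (ball x0 r) by exact: ball_open.
have bU : ball x0 r `<=` U by move=> x /rU[].
have u2 : Ck_on 2 (ball x0 r) ('D_v f) by exact: Ck_on_sub bU (Ck_on_derive v f3).
apply: (@strong_min_principle _ _ ('D_v f) (grad f) (drift f) (ball x0 r) (S x0 + 1) x0) => //.
- exact: ballxx.
- by move=> x /bU; exact: f0.
- by move=> x /rU[].
- by move=> x /bU Ux; rewrite (elliptic_op_derive v Uo Ux f3 fpde).
Unshelve. all: by end_near. Qed.

(** The squared length of the position vector of the graph point above [x]. *)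
Definition sqnorm_graph f x : R := dot x x + f x ^+ 2.

Lemma Ck_on_sqnorm_graph f k U : open U -> Ck_on k U f -> Ck_on k U (sqnorm_graph f).
Proof.
move=> Uo fU; have H := Ck_onD Uo (Ck_on_dot Uo (Ck_on_id k U) (Ck_on_id k U)) (Ck_onM Uo fU fU).
by apply: Ck_on_ext H => // x _ /=; rewrite /sqnorm_graph expr2.
Qed.

(** Where the gradient vanishes, the operator is the Laplacian plus the drift - x / 2, and the
    equation says that the Laplacian of f is - f / 2. The Laplacian contributes 2 m - f^2 and the
    drift - |x|^2. *)
Lemma elliptic_op_sqnorm_graph f U x : open U -> U x -> Ck_on 2 U f ->
  shrinker_graph_expr f x = 0 -> grad f x = 0 ->
  elliptic_op (grad f x) (drift f x) (sqnorm_graph f) x =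
  2 * m%:R - sqnorm_graph f x.
Proof.
move=> Uo Ux f2 fpde g0; have f1 := Ck_onW f2.
have fd := Ck_on_differentiable f1 Ux.
have Dx0 v : 'D_v f x = 0 by rewrite derive_grad// g0 dot0r.
have Dc (y : 'rV[R]_m) i v : has_D (fun y : 'rV[R]_m => y 0 i) y v (v 0 i).
  by split; [exact: differentiable_coord|rewrite derive_proj].
have D1 y v : U y -> has_D (sqnorm_graph f) y v (2 * dot y v + 2 * (f y * 'D_v f y)).
  move=> Uy; have Df := has_D_Ck v f1 Uy.
  have H := has_DD (has_D_sum (index_enum 'I_m) (fun i => has_DM (Dc y i v) (Dc y i v)))
     (has_DM Df Df).
  have -> : sqnorm_graph f = (fun y => \sum_i y 0 i * y 0 i + f y * f y).
    by apply/funext => z; rewrite /sqnorm_graph expr2.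
  apply: has_D_eq H; rewrite big_split/= -[X in X + _ + _]/(dot v y) -[X in _ + X + _]/(dot y v).
  by rewrite (dotC v); ring.
have D2 i : 'D_(e i) ('D_(e i) (sqnorm_graph f)) x = 2 * (1 + f x * 'D_(e i) ('D_(e i) f) x).
  have fE : \forall y \near x, 2 * (y : 'rV[R]_m) 0 i + 2 * (f y * 'D_(e i) f y)
     = 'D_(e i) (sqnorm_graph f) y.
    apply: filterS (open_nbhs_nbhs (conj Uo Ux)) => y Uy; have [_ ->] := D1 y (e i) Uy.
    by rewrite dot_delta.
  have H := has_DD (has_DZ 2 (Dc x i (e i))) (has_DZ 2 (has_DM (has_D_Ck (e i) f1 Ux)
    (has_D_Ck (e i) (Ck_on_derive (e i) f2) Ux))).
  have [_ E] := has_D_near_eq fE H; apply: etrans E _.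
  by rewrite Dx0 mxE !eqxx; move: ('D_(e i) _ x) => A; rewrite mulr1; ring.
have lap_f : laplacian f x = - (2^-1 * f x).
  move: fpde; rewrite /shrinker_graph_expr g0 dot0l addr0 mul1r Dx0 big1.
    by rewrite sub0r subr0 mulrN opprK => /eqP; rewrite addr_eq0 => /eqP.
  by move=> i _; rewrite big1// => j _; rewrite !mxE !mul0r.
have V2 := Ck_on_sqnorm_graph Uo f2.
apply: etrans (elliptic_opE _ _ Uo Ux V2) _; rewrite g0 dot0l addr0 mul1r.
have [_ Db] := D1 x (drift f x) Ux.
have drift0 : drift f x = - 2^-1 *: x.
  rewrite /drift g0 dot0l addr0 mulr1 scaler0 add0r.
  apply/rowP => j; rewrite !mxE big1 ?mulr0 ?addr0// => i _.
  by rewrite mxE mul0r.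
have E : laplacian (sqnorm_graph f) x = 2 * m%:R + 2 * (f x * laplacian f x).
  apply: etrans (eq_bigr _ (fun i _ => D2 i)) _; rewrite -mulr_sumr big_split/= -mulr_sumr.
  by rewrite sumr_const card_ord -mulr_natl mulr1 mulrDr.
rewrite E Db Dx0 mulr0 mulr0 addr0 lap_f drift0 dotZr big1; last first.
  by move=> i _; rewrite big1// => j _; rewrite !mxE !mul0r.
by rewrite /sqnorm_graph; move: (dot x x) => q; field.
Qed.

Lemma local_min_graph_barrier f U x v (ep : R) : open U -> U x -> Ck_on 3 U f ->
  shrinker_graph U f -> grad f x = 0 -> 0 < ep ->
  local_min (fun y => 'D_v f y + ep * sqnorm_graph f y) x ->
  sqnorm_graph f x <= 2 * m%:R.
Proof.
move=> Uo Ux f3 fpde g0 ep0 fmin; have f2 := Ck_onW f3.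
have u2 := Ck_on_derive v f3; have V2 := Ck_on_sqnorm_graph Uo f2.
have H2 : Ck_on 2 U (fun y => 'D_v f y + ep * sqnorm_graph f y).
  exact: Ck_onD Uo u2 (Ck_onZ ep Uo V2).
have := elliptic_op_min (grad f x) (drift f x) Uo Ux H2 fmin.
have E := elliptic_op_lin ep (grad f x) (drift f x) Uo Ux u2 V2.
rewrite -[X in 0 <= X]/(elliptic_op (grad f x) (drift f x) (fun y => 'D_v f y + ep * sqnorm_graph f y) x) E.
rewrite (elliptic_op_derive v Uo Ux f3 fpde) add0r pmulr_rge0//.
by rewrite (elliptic_op_sqnorm_graph Uo Ux f2 (fpde x Ux) g0) subr_ge0.
Qed.

End graph_maximum_principles.

(** * Mean curvature of graphs *)

Section orthogonal_matrices.
Context {R : realType}.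

Definition orthomx N (Q : 'M[R]_N) := Q *m Q^T = 1%:M.

Lemma orthomx_tr N (Q : 'M[R]_N) : orthomx Q -> Q^T *m Q = 1%:M.
Proof. exact: mulmx1C. Qed.

Lemma dot_orthomx N (Q : 'M[R]_N) u v : orthomx Q -> dot (u *m Q) (v *m Q) = dot u v.
Proof. by move=> QQ; rewrite !dotE trmx_mul mulmxA -(mulmxA u) QQ mulmx1. Qed.

Lemma dot_mulmx_tr N N' (Q : 'M[R]_(N, N')) u v : dot (u *m Q) v = dot u (v *m Q^T).
Proof. by rewrite !dotE trmx_mul trmxK mulmxA. Qed.

Lemma dot_row_mx N (a b : R) (u v : 'rV[R]_N) :
  dot (row_mx a%:M u : 'rV_(1 + N)) (row_mx b%:M v) = a * b + dot u v.
Proof.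
rewrite /dot big_split_ord/= big_ord1 !row_mxEl !mxE !eqxx !mulr1n; congr (_ + _).
by apply: eq_bigr => i _; rewrite !row_mxEr.
Qed.

Lemma trmx_scale n1 n2 (a : R) (A : 'M[R]_(n1, n2)) : (a *: A)^T = a *: A^T.
Proof. by apply/matrixP => i j; rewrite !mxE. Qed.

Lemma mulmx_rank1 N (v : 'rV[R]_N) : v^T *m v *m (v^T *m v) = dot v v *: (v^T *m v).
Proof.
rewrite mulmxA -(mulmxA v^T) [X in v^T *m X]mx11_scalar -dotE mul_mx_scalar.
by rewrite scalemxAl.
Qed.

Lemma orthomx_reflection N (v : 'rV[R]_N) : dot v v != 0 ->
  orthomx (1%:M - (2 / dot v v) *: (v^T *m v)).
Proof.
move=> vv; rewrite /orthomx linearB/= trmx1 trmx_scale trmx_mul trmxK.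
set c := 2 / dot v v; have cc : c * (c * dot v v) = c + c by rewrite /c; field.
rewrite mulmxBl !mulmxBr !mulmx1 !mul1mx -!scalemxAl -!scalemxAr mulmx_rank1.
rewrite !scalerA -mulrA cc; set a := v^T *m v.
by rewrite scalerDl opprB addrK subrK.
Qed.

(** The reflection exchanging [nu] and the first basis vector; when they coincide the identity is
    taken. The determinant may be -1, so frames are only required to be orthogonal. *)
Lemma Householder N (nu : 'rV[R]_N.+1) : dot nu nu = 1 ->
  exists Q : 'M[R]_N.+1, orthomx Q /\ row 0 Q = nu.
Proof.
move=> nu1; pose v := nu - delta_mx 0 0.
have [v0|v0] := eqVneq v 0.
  exists 1%:M; split; first by rewrite /orthomx trmx1 mulmx1.
  by rewrite row1; apply/esym/eqP; rewrite -subr_eq0 -/v v0.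
have vv : dot v v = 2 - 2 * nu 0 0.
  rewrite dotBl !dotBr nu1 !dot_delta (dotC _ nu) dot_delta mxE !eqxx.
  by rewrite mulr1n; ring.
have vvn0 : dot v v != 0 by rewrite dot_eq0.
exists (1%:M - (2 / dot v v) *: (v^T *m v)); split; first exact: orthomx_reflection.
rewrite linearB/= row1 linearZ/= row_mul.
have -> : row 0 v^T *m v = v 0 0 *: v.
  by apply/rowP => j; rewrite !mxE big_ord1 !mxE.
rewrite scalerA.
have -> : 2 / dot v v * v 0 0 = -1.
  rewrite vv !mxE !eqxx mulr1n; field.
  by rewrite -vv.
by rewrite scaleN1r opprK /v addrC subrK.
Qed.

End orthogonal_matrices.

Section hypersurface.
Context {R : realType} {m : nat}.
Implicit Types (F : 'rV[R]_m -> 'rV[R]_m.+1) (x : 'rV[R]_m) (nu w : 'rV[R]_m.+1).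
Local Notation e i := (delta_mx 0 i : 'rV[R]_m).

Lemma normal_frame_unit (J : 'M[R]_(m, m.+1)) nu :
  row_free J -> dot nu nu = 1 -> J *m nu^T = 0 ->
  (col_mx nu J : 'M[R]_(1 + m)) \in unitmx.
Proof.
move=> Jfree nu1 Jnu; apply: unitmx_of_ker0 => v.
rewrite -(hsubmxK v) mul_row_col => vE.
have v0 : lsubmx v = 0.
  have : (lsubmx v *m nu + rsubmx v *m J) *m nu^T = 0 by rewrite vE mul0mx.
  rewrite mulmxDl -!mulmxA Jnu mulmx0 addr0.
  have -> : nu *m nu^T = 1%:M by rewrite [LHS]mx11_scalar -dotE nu1.
  by rewrite mulmx1.
move: vE; rewrite v0 mul0mx add0r => vJ.
suff -> : rsubmx v = 0 by rewrite row_mx0.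
by apply/eqP; move: vJ => /eqP; rewrite (mulmx_free_eq0 _ Jfree).
Qed.

Lemma normal_line (J : 'M[R]_(m, m.+1)) nu w :
  row_free J -> dot nu nu = 1 -> J *m nu^T = 0 -> J *m w^T = 0 ->
  w = dot w nu *: nu.
Proof.
move=> Jfree nu1 Jnu Jw; apply/eqP; rewrite -subr_eq0; apply/eqP.
have Cu := normal_frame_unit Jfree nu1 Jnu.
apply: trmx_inj; rewrite trmx0 -[LHS](mulKmx Cu); set z := w - _.
suff -> : (col_mx nu J : 'M[R]_(1 + m)) *m z^T = 0 by rewrite mulmx0.
rewrite mul_col_mx.
have -> : J *m z^T = 0.
  by rewrite /z linearB/= trmx_scale mulmxBr -scalemxAr Jw Jnu scaler0 subr0.
have -> : nu *m z^T = 0.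
  by rewrite [LHS]mx11_scalar -dotE /z dotBr dotZr nu1 mulr1 dotC subrr raddf0.
exact: col_mx0.
Qed.

Lemma tangent_space (J : 'M[R]_(m, m.+1)) nu w :
  row_free J -> dot nu nu = 1 -> J *m nu^T = 0 -> dot w nu = 0 -> (w <= J)%MS.
Proof.
move=> Jfree nu1 Jnu wnu; have Cu := normal_frame_unit Jfree nu1 Jnu.
have := mulmxKV Cu w; set c := w *m _.
rewrite -(hsubmxK c) mul_row_col => wE.
have c0 : lsubmx c = 0.
  have : (lsubmx c *m nu + rsubmx c *m J) *m nu^T = 0.
    by rewrite wE [LHS]mx11_scalar -dotE wnu raddf0.
  rewrite mulmxDl -!mulmxA Jnu mulmx0 addr0.
  have -> : nu *m nu^T = 1%:M by rewrite [LHS]mx11_scalar -dotE nu1.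
  by rewrite mulmx1.
by rewrite -wE c0 mul0mx add0r submxMl.
Qed.

Lemma normal_part_hypersurface F x nu w :
  row_free (jacobian F x) -> dot nu nu = 1 -> jacobian F x *m nu^T = 0 ->
  normal_part F x w = dot w nu *: nu.
Proof.
move=> Jfree nu1 Jnu; rewrite /normal_part; set J := jacobian F x in Jfree Jnu *.
have cap0 : (kermx J^T :&: <<J>>)%MS = 0.
  apply/eqP; rewrite -submx0; apply/rV_subP => v; rewrite sub_capmx genmxE.
  move=> /andP[/sub_kermxP vJ /submxP[c vE]]; rewrite submx0 -dot_eq0 dotE.
  by rewrite {2}vE trmx_mul mulmxA vJ mul0mx mxE.
have tw : (w - dot w nu *: nu <= <<J>>)%MS.
  rewrite genmxE; apply: (tangent_space Jfree nu1 Jnu).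
  by rewrite dotBl dotZl nu1 mulr1 subrr.
have nw : (dot w nu *: nu <= kermx J^T)%MS.
  apply/sub_kermxP; rewrite -scalemxAl -[X in _ *: X]trmxK trmx_mul trmxK Jnu.
  by rewrite trmx0 scaler0.
have -> : w = dot w nu *: nu + (w - dot w nu *: nu) by rewrite addrC subrK.
rewrite mulmxDl (proj_mx_id cap0 nw) (proj_mx_0 cap0 tw) addr0.
by rewrite addrC subrK.
Qed.

(** In codimension one both sides of the vector equation are multiples of the unit normal, so
    comparing coefficients suffices. *)
Lemma mean_curvature_scalar F x nu :
  row_free (jacobian F x) -> dot nu nu = 1 -> jacobian F x *m nu^T = 0 ->
  mean_curvature F x = - (2^-1 *: normal_part F x (F x)) <->
  \sum_i \sum_j invmx (induced_metric F x) i j * dot ('D_(e i) ('D_(e j) F) x) nu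
  = - (2^-1 * dot (F x) nu).
Proof.
move=> Jfree nu1 Jnu.
have -> : mean_curvature F x = (\sum_i \sum_j invmx (induced_metric F x) i j *
    dot ('D_(e i) ('D_(e j) F) x) nu) *: nu.
  rewrite /mean_curvature scaler_suml; apply: eq_bigr => i _.
  rewrite scaler_suml; apply: eq_bigr => j _.
  rewrite /second_fundamental_form (normal_part_hypersurface _ Jfree nu1 Jnu).
  by rewrite scalerA.
rewrite (normal_part_hypersurface _ Jfree nu1 Jnu) scalerA -scaleNr.
split=> [H|->//].
by have := congr1 (fun v => dot v nu) H; rewrite !dotZl nu1 !mulr1.
Qed.

(* Sherman-Morrison, in coordinates changed by [P]. *)
Lemma trace_metric (P H : 'M[R]_m) (p : 'rV[R]_m) : P \in unitmx ->
  let g := P *m (1%:M + p^T *m p) *m P^T in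
  let h := P *m H *m P^T in
  (1 + dot p p) * (\sum_i \sum_j invmx g i j * h i j) =
  (1 + dot p p) * \tr H - \sum_i \sum_j p 0 i * p 0 j * H i j.
Proof.
move=> Pu g h; set q := dot p p.
have q1 : 1 + q != 0 by rewrite gt_eqF// ltr_pwDl// dot_ge0.
pose B := 1%:M - (1 + q)^-1 *: (p^T *m p).
have pp : p^T *m p *m (p^T *m p) = q *: (p^T *m p).
  exact: mulmx_rank1.
have g0B : (1%:M + p^T *m p) *m B = 1%:M.
  rewrite /B mulmxBr mulmx1 -scalemxAr mulmxDl mul1mx pp.
  by rewrite -[X in _ *: (X + _)]scale1r -scalerDl scalerA mulVf// scale1r addrK.
have BT : B^T = B by rewrite /B linearB/= trmx1 trmx_scale trmx_mul trmxK.
pose Pi := invmx P.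
have gi : invmx g = Pi^T *m B *m Pi.
  have gB : g *m (Pi^T *m B *m Pi) = 1%:M.
    rewrite /g !mulmxA -(mulmxA _ P^T) -trmx_mul mulVmx// trmx1 mulmx1.
    by rewrite -(mulmxA P) g0B mulmx1 mulmxV.
  have gu : g \in unitmx by case/mulmx1_unit : gB.
  by rewrite -[LHS]mulmx1 -gB mulKmx.
have -> : \sum_i \sum_j invmx g i j * h i j = \tr (invmx g *m h^T).
  rewrite /mxtrace; apply: eq_bigr => i _; rewrite [RHS]mxE.
  by apply: eq_bigr => j _; rewrite [h^T j i]mxE.
have -> : \tr (invmx g *m h^T) = \tr (B *m H^T).
  rewrite gi /h !trmx_mul trmxK -2!mulmxA (mulmxA Pi) mulVmx// mul1mx.
  rewrite mxtrace_mulC -!mulmxA -trmx_mul mulVmx// trmx1 mulmx1.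
  by [].
rewrite /B mulmxBl mul1mx linearB/= mxtrace_tr -scalemxAl mxtraceZ mulrBr mulrA mulfV// mul1r.
congr (_ - _); rewrite -mulmxA mxtrace_mulC -[LHS]/(\tr _) /mxtrace big_ord1 mxE.
apply: eq_bigr => i _; rewrite !mxE mulr_suml.
by apply: eq_bigr => j _; rewrite !mxE; ring.
Qed.

End hypersurface.

Section graph_geometry.
Context {R : realType} {m : nat}.
Implicit Types (f : 'rV[R]_m -> R) (Q : 'M[R]_m.+1) (x y v p : 'rV[R]_m).
Local Notation e i := (delta_mx 0 i : 'rV[R]_m).

(* The first row of [Q] is the direction of projection. *)
Definition frame_point Q (a : R) y : 'rV[R]_m.+1 := (row_mx a%:M y : 'rV[R]_(1 + m)) *m Q.

Definition graph_map Q f y := frame_point Q (f y) y.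

(** Left unnormalised: its component along the direction of projection is 1 and its squared length
    is 1 + |Df|^2. *)
Definition graph_normal Q f y := frame_point Q 1 (- grad f y).

Lemma dot_frame_point Q a b y y' : orthomx Q ->
  dot (frame_point Q a y) (frame_point Q b y') = a * b + dot y y'.
Proof. by move=> QQ; rewrite /frame_point dot_orthomx// dot_row_mx. Qed.

Lemma frame_point_linear Q (c a b : R) y y' :
  frame_point Q (a + c * b) (y + c *: y') = frame_point Q a y + c *: frame_point Q b y'.
Proof.
rewrite /frame_point scalemxAl -mulmxDl; congr (_ *m _).
rewrite scale_row_mx add_row_mx; congr row_mx.
by apply/matrixP => i j; rewrite !ord1 !mxE !eqxx !mulr1n.
Qed.

Lemma Ck_on_frame_point (V : normedModType R) k (U : set V) Q (a : V -> R) (g : V -> 'rV[R]_m) :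
  open U -> Ck_on k U a -> Ck_on k U g -> Ck_on k U (fun x : V => frame_point Q (a x) (g x)).
Proof.
move=> Uo aU gU.
have rU : Ck_on k U (fun x : V => row_mx (a x)%:M (g x) : 'rV[R]_(1 + m)).
  apply/(Ck_on_rV k (fun x : V => row_mx (a x)%:M (g x) : 'rV[R]_(1 + m)) Uo) => i.
  have := splitP i; case=> j ij.
    have -> : (fun x : V => (row_mx (a x)%:M (g x) : 'rV[R]_(1 + m)) 0 i) = a.
      apply/funext => x; have -> : i = lshift m j by exact: val_inj.
      by rewrite row_mxEl ord1 mxE eqxx mulr1n.
    by [].
  have -> : (fun x : V => (row_mx (a x)%:M (g x) : 'rV[R]_(1 + m)) 0 i) = (fun x : V => g x 0 j).
    by apply/funext => x; have -> : i = rshift 1 j by [exact: val_inj]; rewrite row_mxEr.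
  exact: (Ck_on_rV k g Uo).1.
have H := @Ck_on_comp_rV _ _ _ _ k U setT (fun x : V => row_mx (a x)%:M (g x) : 'rV[R]_(1 + m))
  (fun v : 'rV[R]_m.+1 => v *m Q) Uo openT (fun _ _ => Logic.I) rU (Ck_on_mulmx Q k setT).
by apply: Ck_on_ext H.
Qed.

Lemma has_D_dot (V : normedModType R) N (g : V -> 'rV[R]_N) (w : 'rV[R]_N) (x v : V) :
  differentiable g x -> has_D (fun y : V => dot (g y) w) x v (dot ('D_v g x) w).
Proof.
move=> gx; have gi i : has_D (fun y : V => g y 0 i) x v ('D_v g x 0 i).
  by split; [exact: differentiable_coord_rV|rewrite derive_coord].
have H := has_D_sum (index_enum 'I_N) (fun i => has_DM (gi i) (has_D_cst (w 0 i) x v)).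
apply: has_D_eq H; rewrite /dot; apply: eq_bigr => i _.
by rewrite mulr0 addr0.
Qed.

Lemma derive_frame_point (V : normedModType R) Q (a : V -> R) (g : V -> 'rV[R]_m) (x v : V) U :
  open U -> U x -> Ck_on 1 U a -> Ck_on 1 U g ->
  'D_v (fun z => frame_point Q (a z) (g z)) x = frame_point Q ('D_v a x) ('D_v g x).
Proof.
move=> Uo Ux aU gU; have fU := Ck_on_frame_point Q Uo aU gU.
have fx := Ck_on_differentiable fU Ux; have gx := Ck_on_differentiable gU Ux.
apply/rowP => k; have [_ E] := has_D_dot (delta_mx 0 k) v fx.
rewrite -!(dot_delta _ k) -E.
pose z := (delta_mx 0 k : 'rV[R]_m.+1) *m Q^T : 'rV[R]_(1 + m).
have pz (b : R) (y : 'rV[R]_m) : dot (frame_point Q b y) (delta_mx 0 k) =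
    b * lsubmx z 0 0 + dot y (rsubmx z).
  rewrite /frame_point dot_mulmx_tr -/z -[in LHS](hsubmxK z) [lsubmx z in LHS]mx11_scalar.
  exact: dot_row_mx.
have -> : (fun y : V => dot (frame_point Q (a y) (g y)) (delta_mx 0 k)) =
   (fun y : V => a y * lsubmx z 0 0 + dot (g y) (rsubmx z)) by apply/funext => y; rewrite pz.
have H := has_DD (has_DM (has_D_Ck v aU Ux) (has_D_cst (lsubmx z 0 0) x v)) (has_D_dot (rsubmx z) v gx).
by rewrite H.2 pz mulr0 addr0.
Qed.

(** * Graphs in an arbitrary parametrisation *)

Section reparametrized_graph.
Variables (F : 'rV[R]_m -> 'rV[R]_m.+1) (D B : set 'rV[R]_m) (f : 'rV[R]_m -> R).
Variables (psi : 'rV[R]_m -> 'rV[R]_m) (Q : 'M[R]_m.+1) (x : 'rV[R]_m).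
Hypotheses (Do : open D) (Bo : open B) (Dx : D x) (psiB : forall z, D z -> B (psi z)).
Hypotheses (f2 : Ck_on 2 B f) (psi2 : Ck_on 2 D psi) (QQ : orthomx Q).
Hypothesis FE : forall z, D z -> F z = graph_map Q f (psi z).
Hypothesis psiu : jacobian psi x \in unitmx.

Let p := grad f (psi x).
Let w := graph_normal Q f (psi x).
Let P := jacobian psi x.
Let f1 := Ck_onW f2.
Let psi1 := Ck_onW psi2.

Lemma Ck_on_comp_graph k : Ck_on k B f -> Ck_on k D psi -> Ck_on k D (f \o psi).
Proof. by move=> fk psik; exact: (Ck_on_comp Do psiB psik fk). Qed.

Lemma Ck_on_graph_param k : Ck_on k B f -> Ck_on k D psi -> Ck_on k D F.
Proof.
move=> fk psik; have := Ck_on_frame_point Q Do (Ck_on_comp_graph fk psik) psik.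
by apply: Ck_on_ext => // z /set_mem Dz; rewrite FE.
Qed.

Lemma derive_graph_param z v : D z ->
  'D_v F z = frame_point Q ('D_('D_v psi z) f (psi z)) ('D_v psi z).
Proof.
move=> Dz; have E : \forall y \near z, F y = frame_point Q ((f \o psi) y) (psi y).
  by apply: filterS (open_nbhs_nbhs (conj Do Dz)) => y; exact: FE.
apply: etrans (near_eq_derive v E) _.
apply: etrans (derive_frame_point Q v Do Dz (Ck_on_comp_graph f1 psi1) psi1) _.
have E2 := derive_comp v (Ck_on_differentiable psi1 Dz) (Ck_on_differentiable f1 (psiB Dz)).
exact: (congr1 (fun t => frame_point Q t ('D_v psi z)) E2).
Qed.

Let fpx : differentiable f (psi x).
Proof. by apply: Ck_on_differentiable f1 _; exact: psiB. Qed.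

Let Fx : differentiable F x.
Proof. exact: Ck_on_differentiable (Ck_on_graph_param f1 psi1) Dx. Qed.

Lemma dot_graph_normal v : dot ('D_v F x) w = 0.
Proof.
rewrite derive_graph_param// dot_frame_point// mulr1 dotNr derive_grad//.
by rewrite subrr.
Qed.

Lemma jacobian_graph_normal : jacobian F x *m w^T = 0.
Proof.
apply/row_matrixP => i; rewrite row_mul jacobianE// row0.
by rewrite [LHS]mx11_scalar -dotE dot_graph_normal raddf0.
Qed.

Lemma row_free_graph_param : row_free (jacobian F x).
Proof.
rewrite -kermx_eq0; apply/eqP/row_matrixP => i; rewrite row0.
set v := row i _; have : v *m jacobian F x = 0 by apply/sub_kermxP/row_sub.
rewrite -deriveEjacobian// derive_graph_param// => E.
have := dot_frame_point ('D_('D_v psi x) f (psi x)) ('D_('D_v psi x) f (psi x))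
  ('D_v psi x) ('D_v psi x) QQ.
rewrite E dot0l => /esym/eqP; rewrite paddr_eq0 ?dot_ge0//; last by rewrite -expr2 sqr_ge0.
move=> /andP[_]; rewrite dot_eq0 => /eqP.
rewrite deriveEjacobian; last exact: Ck_on_differentiable psi1 Dx.
by move=> vP; rewrite -(mulmxK psiu v) vP mul0mx.
Qed.

Lemma graph_normal_sqr : dot w w = 1 + dot p p.
Proof. by rewrite dot_frame_point// mulr1 dotNl dotNr opprK. Qed.

Let w_gt0 : 0 < 1 + dot p p.
Proof. by rewrite ltr_pwDl// dot_ge0. Qed.

Lemma metric_graph_param : induced_metric F x = P *m (1%:M + p^T *m p) *m P^T.
Proof.
have psix := Ck_on_differentiable psi1 Dx.
have PE a b : P a b = 'D_(e a) psi x 0 b by rewrite -jacobianE// [RHS]mxE.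
apply/matrixP => i j.
have -> : P *m (1%:M + p^T *m p) *m P^T = P *m P^T + (P *m p^T) *m (p *m P^T).
  by rewrite mulmxDr mulmx1 mulmxDl !mulmxA.
have -> : induced_metric F x i j = dot ('D_(e i) psi x) ('D_(e j) psi x) +
    dot ('D_(e i) psi x) p * dot p ('D_(e j) psi x).
  rewrite mxE !derive_graph_param// dot_frame_point// addrC; congr (_ + _ * _).
    exact: derive_grad.
  by rewrite dotC; exact: derive_grad.
rewrite [RHS]mxE; congr (_ + _); first by rewrite [RHS]mxE; apply: eq_bigr => k _; rewrite [P^T k j]mxE !PE.
rewrite [RHS]mxE big_ord1; congr (_ * _).
  by rewrite [RHS]mxE; apply: eq_bigr => k _; rewrite [p^T k 0]mxE PE.
by rewrite [RHS]mxE; apply: eq_bigr => k _; rewrite [P^T k j]mxE PE.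
Qed.

(** The normal [w] is frozen at [x]. Then the second derivatives of [psi] are multiplied by
    differences of partial derivatives of [f] that vanish at [x], and only the Hessian of [f]
    survives. *)
Lemma second_derivative_graph_param i j : dot ('D_(e i) ('D_(e j) F) x) w =
  (P *m (\matrix_(l, k) 'D_(e l) ('D_(e k) f) (psi x)) *m P^T) i j.
Proof.
have F2 := Ck_on_graph_param f2 psi2.
have dF := Ck_on_differentiable (Ck_on_derive (e j) F2) Dx.
have [_ <-] := has_D_dot w (e i) dF.
have psix z k v : D z -> has_D (fun y => psi y 0 k) z v ('D_v psi z 0 k).
  move=> Dz; have dz := Ck_on_differentiable psi1 Dz.
  by split; [exact: differentiable_coord_rV|rewrite derive_coord].
have E1 : \forall z \near x, dot ('D_(e j) F z) w =
    \sum_k 'D_(e j) psi z 0 k * ('D_(e k) f (psi z) - p 0 k).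
  apply: filterS (open_nbhs_nbhs (conj Do Dx)) => z Dz.
  rewrite derive_graph_param// dot_frame_point// mulr1 dotNr derive_delta; last first.
    by apply: Ck_on_differentiable f1 _; exact: psiB.
  by rewrite /dot -sumrB; apply: eq_bigr => k _; rewrite mulrBr.
apply: etrans (near_eq_derive (e i) E1) _.
have dj k : has_D (fun z => 'D_(e j) psi z 0 k) x (e i) ('D_(e i) ('D_(e j) psi) x 0 k).
  have dd := Ck_on_differentiable (Ck_on_derive (e j) psi2) Dx.
  by split; [exact: differentiable_coord_rV|rewrite derive_coord].
have dk k : has_D (fun z => 'D_(e k) f (psi z)) x (e i)
    (\sum_l 'D_(e i) psi x 0 l * 'D_(e l) ('D_(e k) f) (psi x)).
  have dpsi := Ck_on_differentiable psi1 Dx.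
  have dfk : differentiable ('D_(e k) f) (psi x).
    by apply: Ck_on_differentiable (Ck_on_derive (e k) f2) _; exact: psiB.
  split; first exact: differentiable_comp dpsi dfk.
  by apply: etrans (derive_comp (e i) dpsi dfk) _; exact: derive_delta.
have H := has_D_sum (index_enum _) (fun k => has_DM (dj k) (has_DB (dk k) (has_D_cst (p 0 k) x (e i)))).
rewrite H.2 [RHS]mxE; apply: eq_bigr => k _.
have -> : p 0 k = 'D_(e k) f (psi x) by rewrite mxE.
rewrite subrr mulr0 add0r subr0 mulrC mxE [P^T k j]mxE.
have psx := Ck_on_differentiable psi1 Dx.
have PE a b : P a b = 'D_(e a) psi x 0 b by rewrite -jacobianE// [RHS]mxE.
by rewrite PE; congr (_ * _); apply: eq_bigr => l _; rewrite PE mxE.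
Qed.

(** The trace of the second fundamental form does not depend on [psi], by [trace_metric]. The
    equivalence serves in both directions: it yields the graph equation of M, and, with the identity
    for [psi], the self-shrinker equation of the cross section. *)
Lemma graph_param_shrinker :
  mean_curvature F x = - (2^-1 *: normal_part F x (F x)) <->
  shrinker_graph_expr f (psi x) = 0.
Proof.
pose c := (Num.sqrt (1 + dot p p))^-1.
have c0 : 0 < c by rewrite invr_gt0 sqrtr_gt0.
have nu1 : dot (c *: w) (c *: w) = 1.
  rewrite dotZl dotZr graph_normal_sqr mulrA -expr2 exprVn sqr_sqrtr ?ltW//.
  by rewrite mulVf// gt_eqF.
have Jnu : jacobian F x *m (c *: w)^T = 0.
  by rewrite trmx_scale -scalemxAr jacobian_graph_normal scaler0.
apply: (iff_trans (mean_curvature_scalar row_free_graph_param nu1 Jnu)).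
pose S := \sum_i \sum_j invmx (induced_metric F x) i j *
   (P *m (\matrix_(l, k) 'D_(e l) ('D_(e k) f) (psi x)) *m P^T) i j.
have -> : \sum_i \sum_j invmx (induced_metric F x) i j *
    dot ('D_(e i) ('D_(e j) F) x) (c *: w) = c * S.
  rewrite mulr_sumr; apply: eq_bigr => i _; rewrite mulr_sumr; apply: eq_bigr => j _.
  by rewrite dotZr second_derivative_graph_param mulrCA.
have -> : - (2^-1 * dot (F x) (c *: w)) =
    c * (2^-1 * ('D_(psi x) f (psi x) - f (psi x))).
  rewrite FE// dotZr dot_frame_point// mulr1 dotNr derive_grad//.
  by rewrite mulrCA -mulrN -mulrN opprB.
have := trace_metric (\matrix_(l, k) 'D_(e l) ('D_(e k) f) (psi x)) p psiu.
rewrite /= -metric_graph_param -/S => SE.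
have trE : \tr (\matrix_(l, k) 'D_(e l) ('D_(e k) f) (psi x)) = laplacian f (psi x).
  by rewrite /mxtrace; apply: eq_bigr => i _; rewrite mxE.
have sumE : \sum_i \sum_j p 0 i * p 0 j * (\matrix_(l, k) 'D_(e l) ('D_(e k) f) (psi x)) i j
   = \sum_i \sum_j p 0 i * p 0 j * 'D_(e i) ('D_(e j) f) (psi x).
  by apply: eq_bigr => i _; apply: eq_bigr => j _; rewrite mxE.
rewrite trE sumE in SE.
have -> : shrinker_graph_expr f (psi x) = (1 + dot p p) *
    (S - 2^-1 * ('D_(psi x) f (psi x) - f (psi x))).
  by rewrite [RHS]mulrBr SE /shrinker_graph_expr mulrBr addrAC.
split=> [/(mulfI (lt0r_neq0 c0)) ->|]; first by rewrite subrr mulr0.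
by move/eqP; rewrite mulf_eq0 gt_eqF//= subr_eq0 => /eqP ->.
Qed.

End reparametrized_graph.

End graph_geometry.

(** * Graph patches of a self-shrinker *)

Section open_sets.

Lemma open_preimageI (S T : topologicalType) (f : S -> T) (A : set S) (B : set T) :
  open A -> (forall x, A x -> {for x, continuous f}) -> open B ->
  open (A `&` f @^-1` B).
Proof.
move=> Ao fA Bo; rewrite openE => x [Ax Bfx].
apply: (filterI (open_nbhs_nbhs (conj Ao Ax))).
exact: (fA x Ax _ (open_nbhs_nbhs (conj Bo Bfx))).
Qed.

Lemma within_continuous_at (S T : topologicalType) (f : S -> T) (A : set S) x :
  open A -> {within A, continuous f} -> A x -> {for x, continuous f}.
Proof. by move=> Ao; rewrite continuous_open_subspace// => + Ax; apply; exact: mem_set. Qed.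

End open_sets.

Section charts.
Context {R : realType} {m : nat} {M : topologicalType}.
Implicit Types (phi psi : chart R m M).

Lemma chart_continuous phi x : is_chart phi -> cdom phi x -> {for x, continuous (cmap phi)}.
Proof. by move=> [Do _ c _ _]; exact: within_continuous_at. Qed.

Lemma chart_inv_continuous phi p :
  is_chart phi -> crange phi p -> {for p, continuous (cinv phi)}.
Proof. by move=> [_ Ro _ c _]; exact: within_continuous_at. Qed.

Lemma chart_invK phi p : is_chart phi -> crange phi p ->
  cdom phi (cinv phi p) /\ cmap phi (cinv phi p) = p.
Proof. by move=> [_ _ _ _ K] [x Dx <-]; rewrite K. Qed.

Lemma chart_image_open phi (D : set 'rV[R]_m) :
  is_chart phi -> open D -> D `<=` cdom phi -> open (cmap phi @` D).
Proof.
move=> ch Do Dsub; have [_ Ro _ _ K] := ch.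
have -> : cmap phi @` D = crange phi `&` cinv phi @^-1` D.
  apply/seteqP; split=> [_ [x Dx <-]|p [rp Dp]].
    by split; [exists x => //; exact: Dsub|rewrite /= K//; exact: Dsub].
  by exists (cinv phi p) => //; have [] := chart_invK ch rp.
by apply: open_preimageI => // p; exact: chart_inv_continuous.
Qed.

Lemma open_overlap phi psi : is_chart phi -> is_chart psi -> open (overlap phi psi).
Proof.
move=> ch1 ch2; apply: open_preimageI.
- by case: ch1.
- by move=> x; exact: chart_continuous.
- by case: ch2.
Qed.

End charts.

(** * Continuity of the Gauss map *)

Section gauss_map.
Context {R : realType} {m : nat} {M : topologicalType}.
Variables (A : set (chart R m M)) (X gamma : M -> 'rV[R]_m.+1).
Hypotheses (HA : smooth_atlas A) (HX : immersion A X) (Hg : is_gauss_map A X gamma).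

(** The generalised cross product of the rows of [J]; the cofactors of row 0 do not involve that
    row, which is filled with 0. *)
Definition cross_product (J : 'M[R]_(m, m.+1)) : 'rV[R]_m.+1 :=
  \row_j cofactor (col_mx 0 J : 'M[R]_(1 + m)) 0 j.

Lemma dot_cross_product (J : 'M[R]_(m, m.+1)) u :
  dot u (cross_product J) = \det (col_mx u J : 'M[R]_(1 + m)).
Proof.
rewrite (expand_det_row _ (0 : 'I_(1 + m))) /dot; apply: eq_bigr => j _.
rewrite mxE; congr (_ * _).
  have -> : (0 : 'I_(1 + m)) = lshift m (0 : 'I_1) by exact: val_inj.
  by rewrite col_mxEu.
rewrite /cofactor; congr (_ * \det _); apply/matrixP => a b; rewrite !mxE.
have -> : lift (0 : 'I_(1 + m)) a = rshift 1 a by exact: val_inj.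
by case: splitP => k //= ka; exfalso; have := ltn_ord k; rewrite -ka.
Qed.

Lemma cross_product_orthogonal (J : 'M[R]_(m, m.+1)) : J *m (cross_product J)^T = 0.
Proof.
apply/row_matrixP => i; rewrite row_mul row0 [LHS]mx11_scalar -dotE dot_cross_product.
suff -> : \det (col_mx (row i J) J : 'M[R]_(1 + m)) = 0 by rewrite raddf0.
apply: (@determinant_alternate _ _ _ (lshift m (0 : 'I_1)) (rshift 1 i)) => // j.
by rewrite col_mxEu col_mxEd mxE.
Qed.

(** The cross product is normal, hence a multiple of gamma, and the factor is the determinant that
    the orientation makes positive. The pointwise specification of gamma thus becomes a formula in
    the Jacobian, from which continuity follows. *)
Lemma gauss_map_formula phi x : A phi -> cdom phi x ->
  let N := cross_product (jacobian (X \o cmap phi) x) in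
  0 < dot N N /\ gamma (cmap phi x) = (Num.sqrt (dot N N))^-1 *: N.
Proof.
move=> Aphi Dx; have [nu1 Jnu dpos] := Hg Aphi Dx.
have [_ /(_ x Dx) Jfree] := HX Aphi.
set J := jacobian _ x in Jnu dpos Jfree *; set nu := gamma _ in nu1 Jnu dpos *.
move=> N; have NE := normal_line Jfree nu1 Jnu (cross_product_orthogonal J).
rewrite -/N dotC dot_cross_product in NE.
set c := \det _ in NE dpos.
have NN : dot N N = c ^+ 2 by rewrite NE dotZl dotZr nu1 mulr1 expr2.
rewrite NN exprn_gt0//; split=> //.
by rewrite sqrtr_sqr gtr0_norm// {1}NE scalerA mulVf ?scale1r// gt_eqF.
Qed.

Lemma continuous_gauss_chart phi x : A phi -> cdom phi x ->
  {for x, continuous (gamma \o cmap phi)}.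
Proof.
move=> Aphi Dx; have [ch _ _] := HA; have [Do _ _ _ _] := ch phi Aphi.
pose N z := cross_product (jacobian (X \o cmap phi) z).
have [Fs _] := HX Aphi.
have Jc i j : Ck_on 0 (cdom phi) (fun z => jacobian (X \o cmap phi) z i j).
  have := (Ck_on_rV 0 ('D_(delta_mx 0 i) (X \o cmap phi)) Do).1
    (Ck_on_derive (delta_mx 0 i) (Fs 1%N)) j.
  apply: Ck_on_ext => // z /set_mem Dz.
  rewrite -jacobianE; first by rewrite [LHS]mxE.
  exact: Ck_on_differentiable (Fs 1%N) Dz.
have Nc : Ck_on 0 (cdom phi) N.
  apply/(Ck_on_rV 0 N Do) => j.
  have -> : (fun z => N z 0 j) = (fun z => cofactor
      (col_mx 0 (jacobian (X \o cmap phi) z) : 'M[R]_(1 + m)) 0 j).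
    by apply/funext => z; rewrite mxE.
  rewrite /cofactor; apply: (Ck_onM Do (@Ck_on_cst _ _ R 0 _ _)).
  apply: (Ck_on_det Do) => a b.
  have -> : (fun z => row' (0 : 'I_(1 + m)) (col' j
      (col_mx 0 (jacobian (X \o cmap phi) z) : 'M[R]_(1 + m))) a b) =
      (fun z => jacobian (X \o cmap phi) z a (lift j b)).
    apply/funext => z; rewrite mxE mxE.
    have -> : lift (0 : 'I_(1 + m)) a = rshift 1 a by exact: val_inj.
    by rewrite col_mxEd.
  exact: Jc.
have gE : \forall z \near x, (Num.sqrt (dot (N z) (N z)))^-1 *: N z = (gamma \o cmap phi) z.
  apply: filterS (open_nbhs_nbhs (conj Do Dx)) => z Dz.
  by have [_ E] := gauss_map_formula Aphi Dz; exact: esym E.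
apply: near_eq_continuous gE _.
have [NN _] := gauss_map_formula Aphi Dx.
have Nx : {for x, continuous N} by exact: Nc.
have dc : {for x, continuous (fun z => dot (N z) (N z))} by exact: continuous_dot.
have Sc : {for x, continuous (fun z => Num.sqrt (dot (N z) (N z)))}.
  exact: (continuous_comp dc (@sqrt_continuous _ _)).
have Vc : {for x, continuous (fun z => (Num.sqrt (dot (N z) (N z)))^-1)}.
  by apply: (cvgV _ Sc); rewrite gt_eqF// sqrtr_gt0.
exact: (cvgZ Vc Nx).
Qed.

Lemma continuous_gauss : continuous gamma.
Proof.
move=> p; have [ch cov _] := HA; have [phi Aphi rp] := cov p.
have chp := ch phi Aphi; have [Dp Kp] := chart_invK chp rp.
have [_ Ro _ _ _] := chp.
have gE : \forall q \near p, ((gamma \o cmap phi) \o cinv phi) q = gamma q.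
  apply: filterS (open_nbhs_nbhs (conj Ro rp)) => q rq /=.
  by have [_ ->] := chart_invK chp rq.
apply: near_eq_continuous gE _.
apply: continuous_comp; first exact: chart_inv_continuous chp rp.
exact: continuous_gauss_chart Aphi Dp.
Qed.

End gauss_map.

Section frame_coordinates.
Context {R : realType} {m : nat}.
Implicit Types (Q : 'M[R]_m.+1) (v w : 'rV[R]_m.+1) (y : 'rV[R]_m).

Definition tcoord Q v : 'rV[R]_m := rsubmx (v *m Q^T : 'rV[R]_(1 + m)).
Definition ncoord Q v : R := dot v (row 0 Q).

Lemma frame_coordK Q v : orthomx Q -> frame_point Q (ncoord Q v) (tcoord Q v) = v.
Proof.
move=> QQ; rewrite /frame_point /tcoord.
have -> : (ncoord Q v)%:M = lsubmx (v *m Q^T : 'rV[R]_(1 + m)).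
  rewrite [RHS]mx11_scalar; congr _%:M; rewrite !mxE; apply: eq_bigr => k _.
  by rewrite !mxE; congr (_ * Q _ _); exact: val_inj.
by rewrite hsubmxK -mulmxA (orthomx_tr QQ) mulmx1.
Qed.

Lemma tcoord_frame_point Q a y : orthomx Q -> tcoord Q (frame_point Q a y) = y.
Proof. by move=> QQ; rewrite /tcoord /frame_point -mulmxA QQ mulmx1 row_mxKr. Qed.

Lemma row0_frame_point Q : row 0 Q = frame_point Q 1 0.
Proof.
rewrite /frame_point rowE; congr (_ *m _); apply/rowP => j; rewrite !mxE.
case: splitP => k jk; rewrite !mxE.
  by rewrite !ord1 !eqxx /=; have -> : j == 0 by apply/eqP/val_inj; rewrite /= jk ord1.
by have -> : j == 0 = false by apply/negbTE/eqP => j0; move: jk; rewrite j0.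
Qed.

Lemma ncoord_frame_point Q a y : orthomx Q -> ncoord Q (frame_point Q a y) = a.
Proof.
by move=> QQ; rewrite /ncoord row0_frame_point dot_frame_point// dot0r mulr1 addr0.
Qed.

Lemma tcoordE Q v : tcoord Q v = v *m rsubmx (Q^T : 'M[R]_(m.+1, 1 + m)).
Proof. by rewrite mulmx_rsub. Qed.

Lemma tcoordD Q v w : tcoord Q (v + w) = tcoord Q v + tcoord Q w.
Proof. by rewrite !tcoordE mulmxDl. Qed.

Lemma tcoordZ Q a v : tcoord Q (a *: v) = a *: tcoord Q v.
Proof. by rewrite !tcoordE scalemxAl. Qed.

Lemma tcoord_continuous Q : continuous (tcoord Q).
Proof.
move=> v; have -> : tcoord Q = (fun v => v *m rsubmx (Q^T : 'M[R]_(m.+1, 1 + m))).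
  by apply/funext => w; rewrite tcoordE.
exact: mulmx_continuous.
Qed.

Lemma Ck_on_tcoord (V : normedModType R) Q k U (g : V -> 'rV[R]_m.+1) : open U ->
  Ck_on k U g -> Ck_on k U (fun x => tcoord Q (g x)).
Proof.
move=> Uo gU; have H := @Ck_on_comp_rV _ _ _ _ k U setT g
  (fun v => v *m rsubmx (Q^T : 'M[R]_(m.+1, 1 + m))) Uo openT (fun _ _ => Logic.I) gU
  (Ck_on_mulmx _ _ _).
by apply: Ck_on_ext H => // x _ /=; rewrite tcoordE.
Qed.

Lemma Ck_on_ncoord (V : normedModType R) Q k U (g : V -> 'rV[R]_m.+1) : open U ->
  Ck_on k U g -> Ck_on k U (fun x => ncoord Q (g x)).
Proof. by move=> Uo gU; apply: Ck_on_dot => //; exact: Ck_on_cst. Qed.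

Lemma derive_tcoord (V : normedModType R) Q (g : V -> 'rV[R]_m.+1) (x v : V) :
  differentiable g x -> 'D_v (fun x => tcoord Q (g x)) x = tcoord Q ('D_v g x).
Proof.
move=> gx; have -> : (fun x => tcoord Q (g x)) =
    (fun x => g x *m rsubmx (Q^T : 'M[R]_(m.+1, 1 + m))).
  by apply/funext => y; rewrite tcoordE.
by rewrite tcoordE; have [_ ->] := derive_mulmx (rsubmx (Q^T : 'M[R]_(m.+1, 1 + m))) v gx.
Qed.

End frame_coordinates.

(** * Existence of graph patches *)

Section graph_patches.
Context {R : realType} {m : nat} {M : topologicalType}.
Variables (A : set (chart R m M)) (X gamma : M -> 'rV[R]_m.+1).

(** [G] inverts the projection of M along the first row of [Q]. The fields gather what is needed of
    M near a point, including, in [patch_chart], the compatibility with the given atlas. *)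
Record graph_patch (Q : 'M[R]_m.+1) (B : set 'rV[R]_m) (f : 'rV[R]_m -> R)
    (G : 'rV[R]_m -> M) : Prop := GraphPatch {
  patch_smooth : smooth_on B f ;
  patch_continuous : forall y, B y -> {for y, continuous G} ;
  patch_open : open (G @` B) ;
  patch_X : forall y, B y -> X (G y) = graph_map Q f y ;
  patch_shrinker : shrinker_graph B f ;
  patch_gauss : forall y, B y -> gamma (G y) =
    (Num.sqrt (1 + dot (grad f y) (grad f y)))^-1 *: graph_normal Q f y ;
  patch_chart : forall phi, A phi ->
    smooth_on (B `&` G @^-1` crange phi) (cinv phi \o G) }.

Hypotheses (HA : smooth_atlas A) (HS : self_shrinker A X) (Hg : is_gauss_map A X gamma).

(** The projection along gamma(p) has only normal vectors in its kernel, so it is invertible on the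
    tangent space at [p], and the inverse function theorem makes it a coordinate system. *)
Lemma exists_graph_patch (p : M) (Q : 'M[R]_m.+1) : orthomx Q -> row 0 Q = gamma p ->
  exists (r : R) f G, [/\ 0 < r, graph_patch Q (ball (tcoord Q (X p)) r) f G &
    G (tcoord Q (X p)) = p].
Proof.
move=> QQ Qp; have [ch cov trans] := HA; have [HX Hmc] := HS.
have [phi Aphi [x0 Dx0 px0]] := cov p.
have chp := ch phi Aphi; have [Do Ro _ _ cinvK] := chp.
set D := cdom phi in Do Dx0 *.
pose F := X \o cmap phi; have [Fs Ffree] := HX phi Aphi.
pose psi x := tcoord Q (F x).
have psis : smooth_on D psi by move=> k; apply: Ck_on_tcoord => //; exact: Fs.
have Fx0 := Ck_on_differentiable (Fs 1%N) Dx0.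
have gp1 : dot (gamma p) (gamma p) = 1 by rewrite -px0; have [] := Hg Aphi Dx0.
have Ju : jacobian psi x0 \in unitmx.
  apply: unitmx_of_ker0 => v.
  rewrite -deriveEjacobian; last exact: Ck_on_differentiable (psis 1%N) Dx0.
  rewrite derive_tcoord// => t0.
  have n0 : ncoord Q ('D_v F x0) = 0.
    rewrite /ncoord Qp deriveEjacobian// -px0; have [_ Jnu _] := Hg Aphi Dx0.
    by rewrite dotE -mulmxA Jnu mulmx0 mxE.
  have := frame_coordK ('D_v F x0) QQ; rewrite t0 n0 /frame_point raddf0 row_mx0 mul0mx.
  rewrite deriveEjacobian// => /esym/eqP; rewrite mulmx_free_eq0 ?Ffree//.
  by move/eqP.
have [r0 [theta [D1 [[r00 D1o D1x0 D1D] [D1P thetaP thetas]]]]] :=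
  inverse_function Do Dx0 psis Ju.
have y0E : psi x0 = tcoord Q (X p) by rewrite /psi /F /= px0.
have theta0 : theta (psi x0) = x0 by have [_] := D1P x0 D1x0.
pose G y := cmap phi (theta y).
pose f y := ncoord Q (F (theta y)).
have b0o : open (ball (psi x0) r0) by exact: ball_open.
have Gc y : ball (psi x0) r0 y -> {for y, continuous G}.
  move=> yr; have [D1y _] := thetaP y yr.
  apply: (@continuous_comp _ _ _ theta (cmap phi)).
    exact: Ck_on_continuous (thetas 0%N) yr.
  exact: chart_continuous chp (D1D _ D1y).
have y0b : ball (psi x0) r0 (psi x0) by exact: ballxx.
(* The graph normal has component 1 along [gamma p]. Keeping that of gamma positive decides which of
   the two unit normals gamma is on the whole patch. *)
have gpos : \forall y \near psi x0, 0 < dot (gamma (G y)) (gamma p).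
  have gc : {for psi x0, continuous (fun y => gamma (G y))}.
    apply: (@continuous_comp _ _ _ G gamma); first exact: Gc.
    exact: (continuous_gauss HA HX Hg).
  have dc : {for psi x0, continuous (fun y => dot (gamma (G y)) (gamma p))}.
    exact: (@continuous_dot _ _ _ (fun y => gamma (G y)) (fun=> gamma p) _ gc (@cst_continuous _ _ _ _)).
  apply: (dc [set t | 0 < t]); apply: open_nbhs_nbhs; split; first exact: open_gt.
  by rewrite /= /G theta0 px0 gp1 ltr01.
have /nbhs_ballP[r1 /= r10 r1P] := gpos.
pose r := Num.min r0 r1.
have rr0 : 0 < r by rewrite lt_min r00.
pose B := ball (psi x0) r.
have Bo : open B by exact: ball_open.
have B0 y : B y -> ball (psi x0) r0 y by apply: le_ball; rewrite ge_min lexx.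
have B1 y : B y -> ball (psi x0) r1 y by apply: le_ball; rewrite ge_min lexx orbT.
pose D2 := D1 `&` psi @^-1` B.
have D2o : open D2.
  apply: (@open_preimageI _ _ psi D1 B D1o _ Bo) => x /D1D Dx.
  exact: Ck_on_continuous (psis 0%N) Dx.
have D2B z : D2 z -> B (psi z) by case.
have fs : smooth_on B f.
  have FT k : Ck_on k B (F \o theta).
    apply: (@Ck_on_comp_rV _ _ _ _ k B D1 theta F Bo D1o) => //.
    - by move=> y /B0/thetaP[].
    - by apply: Ck_on_sub (thetas k) => y; exact: B0.
    - by apply: Ck_on_sub (Fs k).
  by move=> k; apply: Ck_on_ncoord.
have FE z : D2 z -> F z = graph_map Q f (psi z).
  move=> [D1z _]; have [_ tz] := D1P z D1z.
  by rewrite /graph_map /f tz /psi frame_coordK.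
have psi2 : Ck_on 2 D2 psi by apply: Ck_on_sub (psis 2%N) => z [/D1D].
have D2theta y : B y -> D2 (theta y) /\ psi (theta y) = y.
  by move=> By; have [D1y py] := thetaP y (B0 y By); split => //; split => //; rewrite /= py.
(* Invertibility was known at the centre only; differentiating the identity theta o psi = id gives
   it at every point of the patch. *)
have psiu y : B y -> jacobian psi (theta y) \in unitmx.
  move=> By; have [D2y py] := D2theta y By; apply: unitmx_of_ker0 => v.
  have dpsi : differentiable psi (theta y).
    exact: Ck_on_differentiable (psis 1%N) (D1D _ D2y.1).
  have dtheta : differentiable theta (psi (theta y)).
    by rewrite py; exact: Ck_on_differentiable (thetas 1%N) (B0 y By).
  rewrite -deriveEjacobian// => pv0.
  have E : \forall z \near theta y, (theta \o psi) z = id z.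
    by apply: filterS (open_nbhs_nbhs (conj D2o D2y)) => z [/D1P[]].
  have := near_eq_derive v E; rewrite derive_id => <-.
  by apply: etrans (derive_comp v dpsi dtheta) _; rewrite pv0 derive0.
exists r, f, G; split; [exact: rr0| |by rewrite -y0E /G theta0].
rewrite -y0E -/B; split.
- exact: fs.
- by move=> y /B0; exact: Gc.
- have -> : G @` B = cmap phi @` D2.
    apply/seteqP; split=> [_ [y By <-]|_ [x [D1x Bx] <-]].
      by exists (theta y) => //; have [] := D2theta y By.
    by exists (psi x) => //; rewrite /G; have [_ ->] := D1P x D1x.
  by apply: chart_image_open => // x [/D1D].
- by move=> y By; have [D2y py] := D2theta y By; have := FE _ D2y; rewrite py.
- move=> y By; have [D2y py] := D2theta y By.
  have := graph_param_shrinker D2o D2y D2B (fs 2%N) psi2 QQ FE (psiu y By).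
  rewrite py => <-; exact: Hmc phi Aphi (theta y) (D1D _ D2y.1).
- move=> y By; have [D2y py] := D2theta y By.
  have Dy := D1D _ D2y.1.
  have [nu1 Jnu _] := Hg Aphi Dy.
  have Jw := jacobian_graph_normal D2o D2y D2B (fs 2%N) psi2 QQ FE.
  rewrite py in Jw.
  have wE := normal_line (Ffree _ Dy) nu1 Jnu Jw.
  rewrite -/(G y) in wE nu1.
  set w := graph_normal Q f y in wE Jw *; set c := dot w _ in wE.
  have wp : dot w (gamma p) = 1.
    by rewrite -Qp row0_frame_point dot_frame_point// dot0r mulr1 addr0.
  have c0 : 0 < c.
    move: wp; rewrite wE dotZl => cg.
    have gy : 0 < dot (gamma (G y)) (gamma p) by exact/r1P/B1.
    by rewrite -(pmulr_lgt0 _ gy) cg ltr01.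
  have ww : dot w w = c ^+ 2 by rewrite wE dotZl dotZr nu1 mulr1 expr2.
  have <- : dot w w = 1 + dot (grad f y) (grad f y).
    by rewrite dot_frame_point// mulr1 dotNl dotNr opprK.
  rewrite ww sqrtr_sqr gtr0_norm// {1}wE scalerA mulVf ?scale1r// gt_eqF//.
- move=> chi Achi k.
  have chchi := ch chi Achi; have [_ Rchi _ _ _] := chchi.
  have To : open (B `&` G @^-1` crange chi).
    by apply: (@open_preimageI _ _ G B (crange chi) Bo _ Rchi) => y /B0; exact: Gc.
  apply: (@Ck_on_comp_rV _ _ _ _ k _ (overlap phi chi) theta (cinv chi \o cmap phi)) => //.
  + exact: open_overlap.
  + by move=> y [By Gy]; split=> //; have [[/D1D]] := D2theta y By.
  + by apply: Ck_on_sub (thetas k) => y [/B0].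
  + exact: trans.
Qed.

End graph_patches.

(** * The image of the Gauss map *)

Section gauss_image.
Context {R : realType} {m : nat} {M : topologicalType}.
Variables (A : set (chart R m M)) (X gamma : M -> 'rV[R]_m.+1).
Hypotheses (HA : smooth_atlas A) (HS : self_shrinker A X) (Hg : is_gauss_map A X gamma).

Lemma gauss_unit p : dot (gamma p) (gamma p) = 1.
Proof.
have [_ cov _] := HA; have [phi Aphi [x Dx <-]] := cov p.
by have [] := Hg Aphi Dx.
Qed.

Lemma immersion_continuous : continuous X.
Proof.
move=> p; have [ch cov _] := HA; have [phi Aphi rp] := cov p.
have chp := ch phi Aphi; have [Dp Kp] := chart_invK chp rp.
have [_ Ro _ _ _] := chp; have [HX _] := HS; have [Fs _] := HX phi Aphi.
have E : \forall q \near p, ((X \o cmap phi) \o cinv phi) q = X q.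
  apply: filterS (open_nbhs_nbhs (conj Ro rp)) => q rq /=.
  by have [_ ->] := chart_invK chp rq.
apply: near_eq_continuous E _.
apply: (@continuous_comp _ _ _ (cinv phi) (X \o cmap phi)).
  exact: chart_inv_continuous chp rp.
exact: (Fs 0%N).
Qed.

Section patch.
Variables (Q : 'M[R]_m.+1) (B : set 'rV[R]_m) (f : 'rV[R]_m -> R) (G : 'rV[R]_m -> M).
Hypotheses (QQ : orthomx Q) (PG : graph_patch A X gamma Q B f G).

Lemma patch_tcoord y : B y -> tcoord Q (X (G y)) = y.
Proof. by move=> By; rewrite (patch_X PG By) tcoord_frame_point. Qed.

Lemma patch_near p : (G @` B) p ->
  \forall q \near p, B (tcoord Q (X q)) /\ G (tcoord Q (X q)) = q.
Proof.
move=> Bp; apply: filterS (open_nbhs_nbhs (conj (patch_open PG) Bp)) => q [y By <-].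
by rewrite patch_tcoord.
Qed.

(** Up to a constant the left side is a directional derivative of [f], hence solves the linear
    equation; the right side carries the sign and the zeros of the normal component. *)
Lemma patch_normal_component y (b0 : R) b' : B y ->
  b0 - 'D_b' f y =
  Num.sqrt (1 + dot (grad f y) (grad f y)) * dot (gamma (G y)) (frame_point Q b0 b').
Proof.
move=> By; rewrite (patch_gauss PG By) dotZl dot_frame_point// mul1r dotNl.
rewrite mulrA mulfV ?mul1r; last first.
  by rewrite gt_eqF// sqrtr_gt0 ltr_pwDl// dot_ge0.
rewrite derive_grad ?(dotC b')//.
by apply: Ck_on_differentiable (patch_smooth PG 1%N) By.
Qed.

Lemma patch_sqrt_ge1 y : 1 <= Num.sqrt (1 + dot (grad f y) (grad f y)).
Proof. by rewrite -[leLHS]sqrtr1 ler_wsqrtr// lerDl dot_ge0. Qed.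

Lemma patch_sqnorm y : B y -> dot (X (G y)) (X (G y)) = sqnorm_graph f y.
Proof.
by move=> By; rewrite (patch_X PG By) dot_frame_point// addrC -expr2.
Qed.

Lemma patch_grad0 y : B y -> gamma (G y) = row 0 Q -> grad f y = 0.
Proof.
move=> By; rewrite (patch_gauss PG By) row0_frame_point => E.
have := congr1 (tcoord Q) E; rewrite tcoordZ !tcoord_frame_point// => /eqP.
rewrite scaler_eq0 oppr_eq0 invr_eq0 => /orP[|/eqP //].
by rewrite gt_eqF// (lt_le_trans _ (patch_sqrt_ge1 y)).
Qed.

End patch.

Lemma exists_frame p : exists2 Q, orthomx Q & row 0 Q = gamma p.
Proof. by have [Q []] := Householder (gauss_unit p); exists Q. Qed.

Hypothesis HP : proper_map X.

Let V p := dot (X p) (X p).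

Lemma sqnorm_continuous : continuous V.
Proof.
move=> p; have Xp := @immersion_continuous p; exact: (continuous_dot Xp Xp).
Qed.

Lemma compact_sublevel (r : R) : compact [set p | V p <= r].
Proof.
have [_ /(_ _ (@compact_edisk R m.+1 0 r))] := HP; congr compact.
by apply/seteqP; split=> p; rewrite /= subr0.
Qed.

Variable a : 'rV[R]_m.+1.
Let w p := dot (gamma p) a.

Lemma gauss_component_continuous : continuous w.
Proof.
have [HX _] := HS; move=> p; have gp := @continuous_gauss _ _ _ _ _ _ HA HX Hg p.
exact: (continuous_dot gp (@cst_continuous _ _ a p)).
Qed.

Hypothesis w_ge0 : forall p, 0 <= w p.

(** In the patch centred at [p], with w >= 0 and the square root at least 1 and equal to 1 at the
    centre, the global minimum becomes a local minimum of a derivative of [f] plus [ep] times the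
    squared norm. *)
Lemma barrier_min_location (ep : R) p : 0 < ep ->
  (forall q, w p + ep * V p <= w q + ep * V q) -> V p <= 2 * m%:R.
Proof.
move=> ep0 pmin; have [Q QQ Qp] := exists_frame p.
have [r [f [G [r0 PG Gp]]]] := exists_graph_patch HA HS Hg QQ Qp.
set y0 := tcoord Q (X p) in PG Gp; set B := ball y0 r in PG.
have Bo : open B by exact: ball_open.
have By0 : B y0 by exact: ballxx.
have g0 : grad f y0 = 0 by apply: (patch_grad0 QQ PG By0); rewrite Gp.
rewrite /V -Gp (patch_sqnorm QQ PG By0).
pose a0 := ncoord Q a; pose a' := tcoord Q a.
have aE : frame_point Q a0 a' = a by exact: frame_coordK.
have Wy y : B y -> a0 + 'D_(- a') f y =
    Num.sqrt (1 + dot (grad f y) (grad f y)) * w (G y).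
  move=> By; rewrite /w -aE -(patch_normal_component QQ PG a0 a' By).
  have fy := Ck_on_differentiable (patch_smooth PG 1%N) By.
  by rewrite !derive_grad// dotNl.
apply: (@local_min_graph_barrier _ _ f B y0 (- a') ep Bo By0 (patch_smooth PG 3%N)
  (patch_shrinker PG) g0 ep0).
apply: filterS (open_nbhs_nbhs (conj Bo By0)) => y By.
rewrite -(lerD2l a0) !addrA Wy// Wy// g0 dot0l addr0 sqrtr1 mul1r Gp.
rewrite -!(patch_sqnorm QQ PG)// Gp; apply: le_trans (pmin (G y)) _.
by rewrite lerD2r ler_peMl// patch_sqrt_ge1.
Qed.

(** Outside the sublevel set [K], compact by properness, the term [ep * V] alone exceeds the value
    at [q0], because w >= 0. *)
Lemma exists_barrier_min (ep : R) (q0 : M) : 0 < ep ->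
  exists p, forall q, w p + ep * V p <= w q + ep * V q.
Proof.
move=> ep0; pose h p := w p + ep * V p.
have hc : continuous h.
  move=> p; apply: (@continuousD _ _ _ w (fun p => ep * V p)).
    exact: gauss_component_continuous.
  apply: (@continuousM _ _ (fun=> ep) V); first exact: cst_continuous.
  exact: sqnorm_continuous.
pose K := [set p | V p <= h q0 / ep].
have Kq0 : K q0 by rewrite /K/= ler_pdivlMr// /h mulrC lerDr.
have [p /set_mem Kp pmin] := compact_EVT_min (ex_intro _ _ Kq0)
  (@compact_sublevel (h q0 / ep)) (continuous_subspaceT hc).
exists p => q; have [Kq|Kq] := leP (V q) (h q0 / ep); first by apply: pmin; exact: mem_set.
apply: le_trans (pmin q0 (mem_set Kq0)) _; rewrite ltr_pdivrMr// mulrC in Kq.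
by rewrite (le_trans (ltW Kq))// lerDr.
Qed.

Lemma gauss_component_min (q0 : M) : exists p, forall q, w p <= w q.
Proof.
(* The barrier with ep = 1 serves only to show that the sublevel set V <= 2 m is not empty. *)
have [p1 p1min] := exists_barrier_min q0 ltr01.
have Kp1 : V p1 <= 2 * m%:R by exact: barrier_min_location ltr01 p1min.
have [p /set_mem Kp pmin] := compact_EVT_min
  (ex_intro (fun p => [set p | V p <= 2 * m%:R] p) _ Kp1)
  (@compact_sublevel _) (continuous_subspaceT gauss_component_continuous).
exists p => q; rewrite leNgt; apply/negP => wq.
have V1 : 0 < V q + 1 by rewrite ltr_wpDl// dot_ge0.
(* Small enough for w q + ep V q < w p. The minimum of this barrier lies in the compact set where w
   >= w p, which is a contradiction. *)
pose ep := (w p - w q) / (V q + 1).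
have ep0 : 0 < ep by rewrite divr_gt0// subr_gt0.
have [p2 p2min] := exists_barrier_min q0 ep0.
have Kp2 := barrier_min_location ep0 p2min.
have := p2min q; apply/negP; rewrite -ltNge.
apply: (@lt_le_trans _ _ (w p)).
  rewrite -ltrBrDl /ep mulrAC ltr_pdivrMr// ltr_pM2l ?subr_gt0//.
  by rewrite ltrDl.
apply: le_trans (pmin p2 (mem_set Kp2)) _.
by rewrite lerDl mulr_ge0 ?dot_ge0// ltW.
Qed.

End gauss_image.

(** * Constant Gauss map or tangent direction *)

Section gauss_dichotomy.
Context {R : realType} {m : nat} {M : topologicalType}.
Variables (A : set (chart R m M)) (X gamma : M -> 'rV[R]_m.+1).
Hypotheses (HA : smooth_atlas A) (HS : self_shrinker A X) (Hg : is_gauss_map A X gamma).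
Hypothesis Hc : connected [set: M].

(** The zero set is closed, and open by Hopf's principle: at a zero, [b] is tangent, so in the patch
    centred there the component is a derivative of [f] up to a positive factor. *)
Lemma gauss_component_vanishes (b : 'rV[R]_m.+1) p0 :
  (forall p, 0 <= dot (gamma p) b) -> dot (gamma p0) b = 0 ->
  forall p, dot (gamma p) b = 0.
Proof.
move=> b_ge0 bp0.
have wc := gauss_component_continuous HA HS Hg (a := b).
pose Z := [set p | dot (gamma p) b = 0].
suff ZT : Z = [set: M] by move=> p; have : [set: M] p by []; rewrite -ZT.
apply: Hc; first by exists p0.
- exists Z; last by rewrite setTI.
  rewrite openE => p Zp; have [Q QQ Qp] := exists_frame HA Hg p.
  have [r [f [G [r0 PG Gp]]]] := exists_graph_patch HA HS Hg QQ Qp.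
  set y0 := tcoord Q (X p) in PG Gp; set B := ball y0 r in PG.
  have Bo : open B by exact: ball_open.
  have By0 : B y0 by exact: ballxx.
  pose b' := tcoord Q b.
  have n0 : ncoord Q b = 0 by rewrite /ncoord Qp dotC.
  have bE : frame_point Q 0 b' = b by rewrite -n0; exact: frame_coordK.
  have Wy y : B y -> 'D_(- b') f y =
      Num.sqrt (1 + dot (grad f y) (grad f y)) * dot (gamma (G y)) b.
    move=> By; rewrite -bE -(patch_normal_component QQ PG 0 b' By) sub0r.
    have fy := Ck_on_differentiable (patch_smooth PG 1%N) By.
    by rewrite !derive_grad// dotNl.
  have Dge y : B y -> 0 <= 'D_(- b') f y.
    by move=> By; rewrite Wy// mulr_ge0.
  have D0 : 'D_(- b') f y0 = 0 by rewrite Wy// Gp Zp mulr0.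
  have near0 := derive_graph_vanishes Bo By0 (patch_smooth PG 3%N) (patch_shrinker PG) Dge D0.
  have Xc : {for p, continuous (fun q => tcoord Q (X q))}.
    apply: (@continuous_comp _ _ _ X (tcoord Q)); first exact: immersion_continuous HA HS p.
    exact: tcoord_continuous.
  have nearM : \forall q \near p, 'D_(- b') f (tcoord Q (X q)) = 0 by exact: Xc _ near0.
  have pB : (G @` B) p by exists y0.
  apply: filterS (filterI nearM (patch_near QQ PG pB)) => q [/= D0q [Bq Gq]].
  have := Wy _ Bq; rewrite D0q Gq => /esym/eqP; rewrite mulf_eq0 => /orP[|/eqP //].
  by rewrite gt_eqF// (lt_le_trans _ (patch_sqrt_ge1 f _)).
- exists Z; last by rewrite setTI.
  exact: (@closed_comp _ _ (fun p => dot (gamma p) b) [set t | t = 0] (fun p _ => wc p) (@closed_eq _ 0)).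
Qed.

Lemma gauss_map_dichotomy (a : 'rV[R]_m.+1) (q0 : M) : proper_map X ->
  (forall p, 0 <= dot (gamma p) a) ->
  (exists e, forall p, gamma p = e) \/ (forall p, dot (gamma p) a = 0).
Proof.
move=> HP a_ge0; have [p0 pmin] := gauss_component_min HA HS Hg HP a_ge0 q0.
have g1 := gauss_unit HA Hg.
set c := dot (gamma p0) a in pmin.
have [c0|c0] := eqVneq c 0; first by right; exact: gauss_component_vanishes c0.
left; exists (gamma p0) => p.
have cpos : 0 < c by rewrite lt_neqAle eq_sym c0 /c a_ge0.
have le1 q : dot (gamma q) (gamma p0) <= 1.
  have := dot_ge0 (gamma q - gamma p0); rewrite dotBl !dotBr !g1 (dotC (gamma p0)).
  by lra.
pose b := a - c *: gamma p0.
have bE q : dot (gamma q) b = dot (gamma q) a - c * dot (gamma q) (gamma p0).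
  by rewrite dotBr dotZr.
have b0 q : 0 <= dot (gamma q) b.
  rewrite bE subr_ge0 (le_trans _ (pmin q))// -[leRHS]mulr1 ler_pM2l//.
have bp : dot (gamma p) b = 0.
  by apply: (gauss_component_vanishes b0 (p0 := p0)); rewrite bE g1 mulr1 subrr.
(* Vanishing of (gamma, b) gives c (gamma(p), gamma(p0)) = (gamma(p), a) >= c, while the product of
   two unit vectors is at most 1. *)
have d1 : dot (gamma p) (gamma p0) = 1.
  apply/eqP; rewrite eq_le le1 -(ler_pM2l cpos) mulr1.
  by move: bp; rewrite bE => /eqP; rewrite subr_eq0 => /eqP <-; exact: pmin.
apply/eqP; rewrite -subr_eq0 -dot_eq0 dotBl !dotBr !g1 (dotC (gamma p0)) d1.
by rewrite !subrr.
Qed.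

End gauss_dichotomy.

(** * Lifting translations *)

Lemma continuous_pair (S T1 T2 : topologicalType) (f : S -> T1) (g : S -> T2) x :
  {for x, continuous f} -> {for x, continuous g} ->
  {for x, continuous (fun s => (f s, g s))}.
Proof. by move=> fx gx; exact: (@cvg_pair _ _ _ _ _ _ _ _ _ _ _ fx gx). Qed.

Section lifted_translations.
Context {R : realType} {N : nat} {M : topologicalType}.
Variables (X : M -> 'rV[R]_N) (a : 'rV[R]_N).
Implicit Types (T t s r : R) (D : set M) (F : R -> M -> M) (p q : M).

(* [F] lifts the translations along [a], for times less than [T] and starting
   points in [D]. *)
Definition is_lift T D F := forall q t, D q -> `|t| < T ->
  [/\ F 0 q = q, X (F t q) = X q + t *: a &
      {for (t, q), continuous (fun tq : R * M => F tq.1 tq.2)}].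

Hypothesis Mh : hausdorff_space M.
Hypothesis Xinj : forall p, exists2 U : set M, nbhs p U &
  forall q1 q2, U q1 -> U q2 -> X q1 = X q2 -> q1 = q2.

(** On the interval of times the coincidence set is open because X is locally injective, and
    relatively closed because M is Hausdorff. *)
Lemma path_lift_unique T (c1 c2 : R -> M) :
  (forall t, `|t| < T -> {for t, continuous c1}) ->
  (forall t, `|t| < T -> {for t, continuous c2}) ->
  (forall t, `|t| < T -> X (c1 t) = X (c2 t)) -> c1 0 = c2 0 ->
  forall t, `|t| < T -> c1 t = c2 t.
Proof.
move=> c1c c2c Xc c0 t tT.
pose I := [set t : R | `|t| < T].
have Io : open I by apply: (@open_comp _ _ (fun t : R => `|t|) [set s | s < T]);
  [move=> s _; exact: norm_continuous|exact: open_lt].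
have Iconn : connected I.
  apply/connected_intervalP => x y; rewrite /I /= !ltr_norml.
  move=> /andP[x1 x2] /andP[y1 y2] z /andP[xz zy].
  by rewrite ltr_norml (lt_le_trans x1 xz) (le_lt_trans zy y2).
pose E := I `&` [set s | c1 s = c2 s].
have T0 : 0 < T by apply: le_lt_trans tT.
suff EI : E = I by have : I t by []; rewrite -EI => -[].
apply: Iconn; first by exists 0; split=> //; rewrite /I /= normr0.
- exists E; last by rewrite /E setIA setIid.
  rewrite openE => s [Is cs]; have [U Us Uinj] := Xinj (c1 s).
  have n1 : \forall z \near s, U (c1 z) by exact: (c1c s Is).
  have n2 : \forall z \near s, U (c2 z) by apply: (c2c s Is); rewrite -cs.
  apply: filterS (filterI (open_nbhs_nbhs (conj Io Is)) (filterI n1 n2)) => z [Iz [U1 U2]].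
  by split=> //; apply: Uinj => //; exact: Xc.
- pose Ne := I `&` [set s | c1 s <> c2 s].
  have Neo : open Ne.
    rewrite openE => s [Is cs].
    have := Mh; rewrite open_hausdorff => /(_ (c1 s) (c2 s)).
    have csn : c1 s != c2 s by apply/eqP.
    move=> /(_ csn)[[U1 U2]] /= [/set_mem U1s /set_mem U2s] [U1o U2o /eqP U12].
    have n1 : \forall z \near s, U1 (c1 z).
      by apply: (c1c s Is); exact: open_nbhs_nbhs.
    have n2 : \forall z \near s, U2 (c2 z).
      by apply: (c2c s Is); exact: open_nbhs_nbhs.
    apply: filterS (filterI (open_nbhs_nbhs (conj Io Is)) (filterI n1 n2)) => z [Iz [z1 z2]].
    split=> //= cz; have : (U1 `&` U2) (c1 z) by split => //; rewrite cz.
    by rewrite U12.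
  exists (~` Ne); first exact: open_closedC.
  apply/seteqP; split=> z [Iz cz]; split=> //; first by move=> [].
  by apply: contrapT => ncz; apply: cz.
Qed.

Lemma lift_path_continuous T D F q t : is_lift T D F -> D q -> `|t| < T ->
  {for t, continuous (fun s => F s q)}.
Proof.
move=> FD Dq tT; have [_ _ Fc] := FD q t Dq tT.
have pc : {for t, continuous (fun s : R => (s, q))}.
  exact: (@continuous_pair _ _ _ id (fun=> q) t (@cvg_id _ _) (@cst_continuous _ _ q t)).
exact: (continuous_comp pc Fc).
Qed.

Lemma lift_unique T1 T2 D1 D2 F1 F2 q t :
  is_lift T1 D1 F1 -> is_lift T2 D2 F2 -> D1 q -> D2 q -> `|t| < T1 -> `|t| < T2 ->
  F1 t q = F2 t q.
Proof.
move=> L1 L2 D1q D2q t1 t2.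
have lt1 s : `|s| < Num.min T1 T2 -> `|s| < T1 by rewrite lt_min => /andP[].
have lt2 s : `|s| < Num.min T1 T2 -> `|s| < T2 by rewrite lt_min => /andP[].
apply: (@path_lift_unique (Num.min T1 T2) (fun s => F1 s q) (fun s => F2 s q)).
- by move=> s /lt1; exact: lift_path_continuous L1 D1q.
- by move=> s /lt2; exact: lift_path_continuous L2 D2q.
- move=> s sT; have [_ -> _] := L1 q s D1q (lt1 s sT).
  by have [_ -> _] := L2 q s D2q (lt2 s sT).
- by have [-> _ _] := L1 q t D1q t1; have [-> _ _] := L2 q t D2q t2.
- by rewrite lt_min t1.
Qed.

Lemma lift_sub T T' D D' F : T' <= T -> D' `<=` D -> is_lift T D F -> is_lift T' D' F.
Proof. by move=> TT DD FD q t /DD Dq tT; apply: FD => //; exact: lt_le_trans TT. Qed.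

Lemma nbhs_pair (t : R) q (P : set R) (S : set M) : nbhs t P -> nbhs q S ->
  \forall z \near (t, q), P z.1 /\ S z.2.
Proof.
by move=> tP qS; exists (P, S).
Qed.

Lemma open_time_ball T (t : R) : `|t| < T -> nbhs t [set s : R | `|s| < T].
Proof.
move=> tT; apply: open_nbhs_nbhs; split=> //.
apply: (@open_comp _ _ (fun t : R => `|t|) [set s | s < T]) => [s _|].
  exact: norm_continuous.
exact: open_lt.
Qed.

(** A local lift is chosen separately for each starting point. By uniqueness, neighbouring choices
    agree for all times below the common [T], which gives joint continuity. *)
Lemma lift_patch T D : open D ->
  (forall p, D p -> exists O F, [/\ open O, O p & is_lift T O F]) ->
  exists F, is_lift T D F.
Proof.
move=> Do HD.
have H p : exists OF : set M * (R -> M -> M), D p ->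
    [/\ open OF.1, OF.1 p & is_lift T OF.1 OF.2].
  have [Dp|nDp] := pselect (D p); last by exists (setT, fun _ q => q).
  by have [W [F ?]] := HD p Dp; exists (W, F).
have [OF OFP] := choice H.
exists (fun t q => (OF q).2 t q) => q t Dq tT.
have [Wo Oq L] := OFP q Dq; have [F0 FX Fc] := L q t Oq tT; split=> //.
have near1 : \forall z \near (t, q), (fun tq : R * M => (OF q).2 tq.1 tq.2) z =
    (fun tq : R * M => (OF tq.2).2 tq.1 tq.2) z.
  have DO : nbhs q (D `&` (OF q).1).
    by apply: filterI; exact: open_nbhs_nbhs.
  apply: filterS (nbhs_pair (open_time_ball tT) DO) => -[s q'] /= [sT [Dq' Wq']].
  have [_ Wq'' L'] := OFP q' Dq'.
  exact: (lift_unique L L' Wq' Wq'' sT sT).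
exact: near_eq_continuous near1 Fc.
Qed.

Hypothesis Xp : proper_map X.
Hypothesis local_lift : forall p, exists O T F,
  [/\ open O, O p, 0 < T & is_lift T O F].

Let Dr r := [set q | `|X q| < r].

Let Dr_open r : open (Dr r).
Proof.
have [Xc _] := Xp.
apply: (@open_comp _ _ (fun q => `|X q|) [set s | s < r]) => [q _|]; last exact: open_lt.
by apply: (@continuous_comp _ _ _ X (fun v => `|v|)); [exact: Xc|exact: norm_continuous].
Qed.

(** By properness the points with |X| <= r form a compact set, over which the lifespans of the local
    lifts have a positive lower bound. *)
Lemma uniform_lift r : exists T F, 0 < T /\ is_lift T (Dr r) F.
Proof.
have Kc : compact [set q | `|X q| <= r].
  have [_ Xk] := Xp; have /Xk : compact [set v : 'rV[R]_N | `|v| <= r].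
    apply: bounded_closed_compact.
      exists r; split; first exact: num_real.
      by move=> x rx v /= vr; rewrite (le_trans vr)// ltW.
    apply: (@closed_comp _ _ (fun v : 'rV[R]_N => `|v|) [set s | s <= r]) => [v _|].
      exact: norm_continuous.
    exact: closed_le.
  by [].
pose P T q := exists O F, [/\ open O, O q & is_lift T O F].
have nearP : \forall T \near 0^'+, [set q | `|X q| <= r] `<=` P T.
  have cov := (compact_near_coveringP _).1 Kc R (0^'+) P _.
  apply: cov => p _.
  have [W [T [F [Wo Wp T0 L]]]] := local_lift p.
  exists (W, [set s | s < T]) => /=.
    split; first exact: open_nbhs_nbhs.
    exact: nbhs_right_lt.
  move=> [q s] /= [Wq sT]; exists W, F; split=> //.
  by apply: lift_sub L => //; exact: ltW.
have [T [T0 PT]] : exists T, 0 < T /\ [set q | `|X q| <= r] `<=` P T.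
  have H : \forall T \near 0^'+, 0 < T /\ [set q | `|X q| <= r] `<=` P T.
    exact: filterI (nbhs_right_gt 0) nearP.
  exact: filter_ex H.
have [F L] := @lift_patch T (Dr r) (@Dr_open r) (fun p pr => PT p (ltW pr)).
by exists T, F.
Qed.

(** X moves along a straight line, so in time [T] an orbit stays within radius r + T |a|. The
    uniform lift over that larger ball is iterated with equal small steps. *)
Lemma long_lift r T : 0 < T -> exists F, is_lift T (Dr r) F.
Proof.
move=> T0; have [T1 [F1 [T10 L]]] := uniform_lift (r + T * `|a|).
have [n nT] : exists n : nat, T / n.+1%:R < T1.
  exists (Num.bound (T / T1)); rewrite ltr_pdivrMr// mulrC -ltr_pdivrMr//.
  have := archi_boundP (ltW (divr_gt0 T0 T10)); move/lt_le_trans; apply.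
  by rewrite ler_nat.
pose dt (t : R) := t / n.+1%:R.
have dtT t : `|t| < T -> `|dt t| < T1.
  move=> tT; rewrite /dt normrM normfV (ger0_norm (ler0n _ _)) (le_lt_trans _ nT)//.
  by rewrite ler_wpM2r// ltW.
have step k t q : (k <= n.+1)%N -> Dr r q -> `|t| < T ->
   [/\ iter k (F1 0) q = q, X (iter k (F1 (dt t)) q) = X q + (k%:R * dt t) *: a &
   {for (t, q), continuous (fun tq : R * M => iter k (F1 (dt tq.1)) tq.2)}].
  move=> + Dq tT; elim: k => [|k IH] kn.
    split=> //; first by rewrite mul0r scale0r addr0.
    exact: (@cvg_snd _ _ (nbhs t) (nbhs q) _).
  have [I0 IX Ic] := IH (ltnW kn).
  have Dk : Dr (r + T * `|a|) (iter k (F1 (dt t)) q).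
    rewrite /Dr /= IX (le_lt_trans (ler_normD _ _))// normrZ ltr_leD//.
    rewrite ler_wpM2r// normrM (ger0_norm (ler0n _ _)) /dt normrM normfV.
    rewrite (ger0_norm (ler0n _ _)) mulrCA -[leRHS]mulr1 ler_pM//.
    - exact: ltW.
    - by rewrite ler_pdivrMr// mul1r ler_nat ltnW.
  have Dq' : Dr (r + T * `|a|) q.
    by rewrite /Dr /= (lt_le_trans Dq)// lerDl mulr_ge0// ltW.
  have [F0 FX Fc] := L _ _ Dk (dtT t tT).
  have [F0q _ _] := L _ _ Dq' (dtT t tT).
  split.
  - by rewrite iterS I0 F0q.
  - rewrite iterS FX IX -addrA -scalerDl; congr (_ + _ *: _).
    by rewrite -[in RHS]natr1 mulrDl mul1r.
  - have dc : {for (t, q), continuous (fun tq : R * M => dt tq.1)}.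
      apply: (@continuous_comp _ _ _ (fun tq : R * M => tq.1) dt).
        exact: (@cvg_fst _ _ (nbhs t) (nbhs q) _).
      by apply: cvgM; [exact: cvg_id|exact: cvg_cst].
    have pc : {for (t, q), continuous (fun tq : R * M =>
        (dt tq.1, iter k (F1 (dt tq.1)) tq.2))}.
      exact: continuous_pair dc Ic.
    exact: (continuous_comp pc Fc).
exists (fun t q => iter n.+1 (F1 (dt t)) q) => q t Dq tT.
have [I0 IX Ic] := step n.+1 t q (leqnn _) Dq tT.
have dt0 : dt 0 = 0 by rewrite /dt mul0r.
have dtn : n.+1%:R * dt t = t by rewrite /dt mulrC divfK.
by split=> //; [rewrite dt0|rewrite IX dtn].
Qed.

Theorem translation_lift : exists F : R -> M -> M,
  [/\ continuous (fun tq : R * M => F tq.1 tq.2), forall q, F 0 q = q,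
      forall t q, X (F t q) = X q + t *: a &
      forall s t q, F s (F t q) = F (s + t) q].
Proof.
have HT T : 0 < T -> exists F, is_lift T setT F.
  move=> T0; apply: lift_patch; first exact: openT.
  move=> p _; have [F L] := long_lift (`|X p| + 1) T0.
  exists (Dr (`|X p| + 1)), F; split=> //.
  by rewrite /Dr /= ltrDl.
have H' (T : R) : exists F, 0 < T -> is_lift T setT F.
  have [T0|nT0] := pselect (0 < T); last by exists (fun _ q => q).
  by have [F L] := HT T T0; exists F.
have [FT FTP] := choice H'.
(* The duration |t| + 1 makes [t] an interior time, so that near it the lifts of varying durations
   agree with a single continuous one. *)
pose F t q := FT (`|t| + 1) t q.
have n0 (t : R) : 0 < `|t| + 1 by rewrite ltr_wpDl.
have n1 (t : R) : `|t| < `|t| + 1 by rewrite ltrDl.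
have FE T t q : `|t| < T -> FT T t q = F t q.
  move=> tT; have T0 : 0 < T by exact: le_lt_trans tT.
  by apply: (lift_unique (FTP T T0) (FTP _ (n0 t)) (D1 := setT) (D2 := setT)).
have Fc : continuous (fun tq : R * M => F tq.1 tq.2).
  move=> [t q]; have [_ _ c] := FTP _ (n0 t) q t Logic.I (n1 t).
  apply: near_eq_continuous _ c.
  have qT : nbhs q [set: M] by exact: filterT.
  by apply: filterS (nbhs_pair (open_time_ball (n1 t)) qT) => -[s q'] /= [sT _]; exact: FE.
have F0 q : F 0 q = q by have [] := FTP _ (n0 0) q 0 Logic.I (n1 0).
have FX t q : X (F t q) = X q + t *: a by have [_ ? _] := FTP _ (n0 t) q t Logic.I (n1 t).
exists F; split=> // s t q.
have Fq q' : continuous (fun s => F s q').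
  move=> z; have pc : {for z, continuous (fun s : R => (s, q'))}.
    exact: (@continuous_pair _ _ _ id (fun=> q') z (@cvg_id _ _) (@cst_continuous _ _ q' z)).
  exact: (continuous_comp pc (Fc (z, q'))).
apply: (@path_lift_unique (`|s| + 1) (fun s => F s (F t q)) (fun s => F (s + t) q)) => //.
- by move=> z _; exact: Fq.
- move=> z _; apply: (@continuous_comp _ _ _ (fun s : R => s + t) (fun s => F s q)).
    by apply: cvgD; [exact: cvg_id|exact: cvg_cst].
  exact: Fq.
- by move=> z _; rewrite !FX -addrA -scalerDl (addrC t).
- by rewrite F0 add0r.
Qed.

End lifted_translations.

Lemma constant_along (R : realType) m (f : 'rV[R]_m -> R) (y0 y y' : 'rV[R]_m) (r : R) :
  Ck_on 1 (ball y0 r) f -> ball y0 r y -> ball y0 r y' ->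
  (forall z, ball y0 r z -> 'D_(y' - y) f z = 0) -> f y' = f y.
Proof.
move=> f1 yB y'B fD; apply/eqP; rewrite -subr_eq0.
have seg s : 0 <= s <= 1 -> ball y0 r (y + s *: (y' - y)) by exact: ball_line.
have [|s /andP[s0 s1]] := @mean_value_line _ _ f y (y' - y) 1 ltr01.
  by move=> s /seg; exact: Ck_on_differentiable f1.
rewrite fD; last by apply: seg; rewrite !ltW.
have -> : y + 1 *: (y' - y) = y' by rewrite scale1r addrC subrK.
by rewrite mulr0 => ->.
Qed.

Section connected_spaces.
Context {M : topologicalType}.
Hypothesis Mc : connected [set: M].

Lemma connected_locally_constant (P : set M) p0 : P p0 ->
  (forall p, P p -> \forall q \near p, P q) -> closed P -> forall p, P p.
Proof.
move=> Pp0 Pn Pc; suff PT : P = [set: M] by move=> p; have : [set: M] p by []; rewrite -PT.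
apply: Mc; [by exists p0| |].
  by exists P; rewrite ?setTI// openE => p /Pn.
by exists P; rewrite ?setTI.
Qed.

End connected_spaces.

(** * Translation flows, and the case of a constant Gauss map *)

Section flat_directions.
Context {R : realType} {m : nat} {M : topologicalType}.
Variables (A : set (chart R m M)) (X gamma : M -> 'rV[R]_m.+1).
Hypotheses (HA : smooth_atlas A) (HS : self_shrinker A X) (Hg : is_gauss_map A X gamma).
Hypothesis Mh : hausdorff_space M.
Hypothesis Xp : proper_map X.

Lemma immersion_locally_injective (p : M) : exists2 U : set M, nbhs p U &
  forall q1 q2, U q1 -> U q2 -> X q1 = X q2 -> q1 = q2.
Proof.
have [Q QQ Qp] := exists_frame HA Hg p.
have [r [f [G [r0 PG Gp]]]] := exists_graph_patch HA HS Hg QQ Qp.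
have Bp : (G @` ball (tcoord Q (X p)) r) p by exists (tcoord Q (X p)) => //; exact: ballxx.
exists (G @` ball (tcoord Q (X p)) r); first exact: open_nbhs_nbhs (conj (patch_open PG) Bp).
move=> _ _ [y1 B1 <-] [y2 B2 <-] E.
by rewrite -(patch_tcoord QQ PG B1) -(patch_tcoord QQ PG B2) E.
Qed.

Lemma tcoord_immersion_continuous Q : continuous (fun q => tcoord Q (X q)).
Proof.
move=> q; apply: (@continuous_comp _ _ _ X (tcoord Q)).
  exact: immersion_continuous HA HS q.
exact: tcoord_continuous.
Qed.

(** In a patch the tangent direction [a] becomes a direction [b] of the plane along which [f] is
    constant, so translating the parameter by t b translates the graph point by t a. *)
Lemma local_translation_lift a : (forall p, dot (gamma p) a = 0) ->
  forall p : M, exists O T F, [/\ open O, O p, 0 < T & is_lift X a T O F].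
Proof.
move=> a0 p; have [Q QQ Qp] := exists_frame HA Hg p.
have [r [f [G [r0 PG Gp]]]] := exists_graph_patch HA HS Hg QQ Qp.
set y0 := tcoord Q (X p) in PG Gp; set B := ball y0 r in PG.
have Bo : open B by exact: ball_open.
have By0 : B y0 by exact: ballxx.
pose b := tcoord Q a.
have aE : frame_point Q 0 b = a.
  have n0 : ncoord Q a = 0 by rewrite /ncoord Qp dotC.
  by rewrite -n0; exact: frame_coordK.
have Db y : B y -> 'D_b f y = 0.
  move=> By; have := patch_normal_component QQ PG 0 b By.
  by rewrite aE a0 mulr0 sub0r => /eqP; rewrite oppr_eq0 => /eqP.
have fb y t : B y -> B (y + t *: b) -> f (y + t *: b) = f y.
  move=> By Bty; apply: (constant_along (patch_smooth PG 1%N) By Bty) => z Bz.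
  rewrite addrAC subrr add0r derive_dirZ ?Db ?mulr0//.
  exact: Ck_on_differentiable (patch_smooth PG 1%N) Bz.
have bo2 : open (ball y0 (r / 2)) by exact: ball_open.
pose W := (G @` B) `&` (fun q => tcoord Q (X q)) @^-1` (ball y0 (r / 2)).
have Wo : open W.
  apply: (@open_preimageI _ _ (fun q => tcoord Q (X q)) (G @` B) _ (patch_open PG) _ bo2).
  by move=> q _; exact: tcoord_immersion_continuous.
have b1 : 0 < `|b| + 1 by rewrite ltr_wpDl.
(* Starting points lie in the ball of half radius, and in time [T] the parameter moves by at most
   the other half. *)
pose T := r / 2 / (`|b| + 1).
have T0 : 0 < T by rewrite !divr_gt0.
exists W, T, (fun t q => G (tcoord Q (X q) + t *: b)); split=> //.
  by split; [exists y0|apply: ballxx; rewrite divr_gt0].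
move=> q t [[y By <-]]; rewrite /= (patch_tcoord QQ PG By) => y2 tT.
have Byt : B (y + t *: b).
  move: y2; rewrite /B -!ball_normE /= => y2.
  rewrite opprD addrA (le_lt_trans (ler_normB _ _))// [ltRHS]splitr ltr_leD//.
  rewrite normrZ; apply: (@le_trans _ _ (T * (`|b| + 1))); last by rewrite /T divfK// gt_eqF.
  by apply: ler_pM => //; [exact: ltW|rewrite lerDl].
split.
- by rewrite scale0r addr0.
- rewrite (patch_X PG Byt) (patch_X PG By) /graph_map fb// -aE.
  by rewrite -frame_point_linear mulr0 addr0.
- apply: (@continuous_comp _ _ _ (fun tq : R * M => tcoord Q (X tq.2) + tq.1 *: b) G).
    have c1 : {for (t, G y), continuous (fun tq : R * M => tcoord Q (X tq.2))}.
      apply: (@continuous_comp _ _ _ (fun tq : R * M => tq.2) (fun q => tcoord Q (X q))).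
        exact: (@cvg_snd _ _ (nbhs t) (nbhs (G y)) _).
      exact: tcoord_immersion_continuous.
    have c2 : {for (t, G y), continuous (fun tq : R * M => tq.1 *: b)}.
      apply: (@continuousZr_tmp _ _ _ (fun tq : R * M => tq.1)).
      exact: (@cvg_fst _ _ (nbhs t) (nbhs (G y)) _).
    exact: (@cvgD _ _ _ (nbhs (t, G y)) _ _ _ _ _ c1 c2).
  by apply: (patch_continuous PG); rewrite /= (patch_tcoord QQ PG By).
Qed.

Lemma translation_flow a : (forall p, dot (gamma p) a = 0) ->
  exists F : R -> M -> M,
  [/\ continuous (fun tq : R * M => F tq.1 tq.2), forall q, F 0 q = q,
      forall t q, X (F t q) = X q + t *: a &
      forall s t q, F s (F t q) = F (s + t) q].
Proof.
move=> a0; apply: translation_lift => //; first exact: immersion_locally_injective.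
exact: local_translation_lift.
Qed.

Section constant_gauss_map.
Hypothesis Mc : connected [set: M].
Variables (p0 : M) (e : 'rV[R]_m.+1).
Hypothesis ge : forall p, gamma p = e.

(** In a patch a constant Gauss map forces the gradient of [f] to vanish, so the height is locally
    constant; M is connected. *)
Lemma flat_height_constant p : dot (X p) e = dot (X p0) e.
Proof.
have Xec : continuous (fun p => dot (X p) e).
  move=> q; have Xq := immersion_continuous HA HS (x := q).
  exact: (continuous_dot Xq (@cst_continuous _ _ e q)).
apply: (connected_locally_constant Mc (P := [set p | dot (X p) e = dot (X p0) e]) (p0 := p0)) => //.
  move=> q /= Eq; have [Q QQ Qq] := exists_frame HA Hg q.
  have [r [f [G [r0 PG Gq]]]] := exists_graph_patch HA HS Hg QQ Qq.
  set y0 := tcoord Q (X q) in PG Gq; set B := ball y0 r in PG.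
  have By0 : B y0 by exact: ballxx.
  have fc y : B y -> f y = f y0.
    move=> By; apply: (constant_along (patch_smooth PG 1%N) By0 By) => z Bz.
    rewrite derive_grad; last exact: Ck_on_differentiable (patch_smooth PG 1%N) Bz.
    by rewrite (patch_grad0 QQ PG Bz) ?dot0r// Qq !ge.
  have Xe y : B y -> dot (X (G y)) e = f y.
    by move=> By; rewrite (patch_X PG By) -(ge q) -Qq; exact: ncoord_frame_point.
  have Bq : (G @` B) q by exists y0.
  apply: filterS (open_nbhs_nbhs (conj (patch_open PG) Bq)) => _ [y By <-] /=.
  by rewrite Xe// fc// -(Xe y0)// Gq.
exact: (@closed_comp _ _ (fun p => dot (X p) e) [set t | t = dot (X p0) e]
  (fun p _ => Xec p) (@closed_eq _ _)).
Qed.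

(* Composing the flows in the coordinate directions retracts [M] continuously
   onto a fibre of [X]; fibres are discrete and [M] is connected. *)
Lemma flat_retraction Q (s : seq 'I_m) : orthomx Q -> row 0 Q = e ->
  exists sg : M -> M, [/\ continuous sg,
    forall p q, X p = X q -> X (sg p) = X (sg q),
    forall p q, X p = X q -> sg p = sg q -> p = q &
    forall q j, j \in s -> tcoord Q (X (sg q)) 0 j = 0].
Proof.
move=> QQ Qe; elim: s => [|i s [sg [sgc sgX sgi sg0]]].
  by exists id; split=> // p; exact: cvg_id.
pose v := frame_point Q 0 (delta_mx 0 i).
have v0 p : dot (gamma p) v = 0.
  by rewrite ge -Qe row0_frame_point dot_frame_point// mulr0 dot0l addr0.
have [F [Fc F0 FX FF]] := translation_flow v0.
pose tau q := - tcoord Q (X q) 0 i.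
have tauc : continuous tau.
  move=> q; apply: (@continuousN _ _ _ (fun q => tcoord Q (X q) 0 i)).
  apply: (@continuous_comp _ _ _ (fun q => tcoord Q (X q)) (fun y : 'rV[R]_m => y 0 i)).
    exact: tcoord_immersion_continuous.
  exact: coord_continuous.
exists (fun q => F (tau (sg q)) (sg q)); split.
- move=> q; apply: (@continuous_comp _ _ _ (fun q => (tau (sg q), sg q)) (fun tq : R * M => F tq.1 tq.2)).
    apply: continuous_pair; last exact: sgc.
    by apply: (@continuous_comp _ _ _ sg tau); [exact: sgc|exact: tauc].
  exact: Fc.
- by move=> p q /sgX E; rewrite !FX /tau E.
- move=> p q Epq; have E := sgX p q Epq.
  have tE : tau (sg p) = tau (sg q) by rewrite /tau E.
  rewrite tE => /(congr1 (F (- tau (sg q)))); rewrite !FF addNr !F0.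
  exact: sgi.
- move=> q j; rewrite inE FX tcoordD tcoordZ tcoord_frame_point// mxE [X in _ + X]mxE [X in _ * X]mxE eqxx /=.
  have [->|ji] := eqVneq j i; first by rewrite mulr1 /tau subrr.
  by move=> /= js; rewrite sg0// add0r mulr0.
Qed.

Lemma flat_is_hyperplane : is_hyperplane X.
Proof.
have e1 : dot e e = 1 by rewrite -(ge p0); exact: gauss_unit HA Hg p0.
exists e, (dot (X p0) e); split.
- by rewrite -dot_gt0 e1 ltr01.
- have [Q QQ Qp0] := exists_frame HA Hg p0; rewrite ge in Qp0.
  have [sg [sgc sgX sgi sg0]] := flat_retraction (enum 'I_m) QQ Qp0.
  have Xsg q : X (sg q) = X (sg p0).
    rewrite -(frame_coordK (X (sg q)) QQ) -(frame_coordK (X (sg p0)) QQ).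
    congr frame_point; last by apply/rowP => j; rewrite !sg0// mem_enum.
    by rewrite /ncoord Qp0 !flat_height_constant.
  have sgE q : sg q = sg p0.
    apply: (connected_locally_constant Mc (P := [set q | sg q = sg p0]) (p0 := p0)) => //.
      move=> z /= Ez; have [U Uz Uinj] := immersion_locally_injective (sg z).
      have nU : \forall q \near z, U (sg q) by exact: (sgc z).
      apply: filterS nU => z' Uz' /=; rewrite -Ez; apply: Uinj => //.
        exact: nbhs_singleton Uz.
      by rewrite Xsg Ez.
    apply: (@closed_comp _ _ sg [set z | z = sg p0] (fun p _ => sgc p)).
    exact: (accessible_closed_set1 (hausdorff_accessible Mh)).
  by move=> p q E; apply: sgi => //; rewrite !sgE.
- apply/seteqP; split=> [_ [q _ <-]|x xe]; first exact: flat_height_constant.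
  (* Every displacement within the plane is tangent to M, so its flow carries [p0] to a point above
     [x]. *)
  have v0 p : dot (gamma p) (x - X p0) = 0.
    by rewrite ge dotC dotBl xe subrr.
  have [F [Fc F0 FX FF]] := translation_flow v0.
  by exists (F 1 p0) => //; rewrite FX scale1r addrC subrK.
Qed.

End constant_gauss_map.

End flat_directions.

(** * The cross section of a cylinder *)

Section cylinder_frames.
Context {R : realType}.

Lemma orthomx_of_isometry N (Q : 'M[R]_N) :
  (forall u v, dot (u *m Q) (v *m Q) = dot u v) -> orthomx Q.
Proof.
move=> iso; apply/matrixP => i j.
have := iso (delta_mx 0 i) (delta_mx 0 j); rewrite -!rowE dot_delta.
rewrite /dot [RHS]mxE eqxx /= => E; rewrite mxE [RHS]mxE eq_sym -E.
by apply: eq_bigr => k _; rewrite !mxE.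
Qed.

Lemma orthomxM N (P Q : 'M[R]_N) : orthomx P -> orthomx Q -> orthomx (P *m Q).
Proof.
by move=> PP QQ; rewrite /orthomx trmx_mul mulmxA -(mulmxA P) QQ mulmx1.
Qed.

(** If the Householder frame has determinant -1, the sign of its last row is changed; in dimension
    at least 2 that is not the row equal to [a]. *)
Lemma exists_rotation n (a : 'rV[R]_n.+2) : dot a a = 1 ->
  exists Q, rotation Q /\ row 0 Q = a.
Proof.
move=> a1; have [Q [QQ Qa]] := Householder a1.
have : \det Q * \det Q = 1 by rewrite -[X in _ * X]det_tr -det_mulmx QQ det1.
move=> /eqP; rewrite -expr2 sqrf_eq1 => /orP[/eqP d1|/eqP d1]; first by exists Q.
pose d : 'rV[R]_n.+2 := \row_i (if i == ord_max then -1 else 1).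
have dd : diag_mx d *m (diag_mx d)^T = 1%:M.
  rewrite tr_diag_mx mulmx_diag; apply/matrixP => i j; rewrite !mxE.
  by case: (i == ord_max); rewrite ?mulrNN mulr1.
exists (diag_mx d *m Q); split; first split.
- exact: orthomxM.
- rewrite det_mulmx d1 det_diag (bigD1 ord_max)//= mxE eqxx big1.
    by rewrite mulr1 mulrNN mulr1.
  by move=> i /negbTE im; rewrite mxE im.
- rewrite row_mul -[RHS]Qa; apply/rowP => j; rewrite !mxE (bigD1 0)//= big1.
    by rewrite addr0 !mxE !eqxx mulr1n mul1r.
  by move=> k /negbTE k0; rewrite !mxE [0 == k]eq_sym k0 mulr0n mul0r.
Qed.

Section frame.
Context {n : nat}.
Variables (Q0 : 'M[R]_n.+2) (Q' : 'M[R]_n.+1).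
Hypotheses (QQ0 : orthomx Q0) (QQ' : orthomx Q').

(** The rows are, in order, the first row of [Q'] placed in the complement of the axis, the axis
    itself, and the remaining rows of [Q']. The axis thus becomes the first coordinate of the plane
    over which M is a graph. *)
Definition cylinder_frame : 'M[R]_n.+2 :=
  let T0 : 'M[R]_(n.+1, n.+2) := dsubmx (Q0 : 'M[R]_(1 + n.+1, n.+2)) in
  col_mx (usubmx (Q' : 'M[R]_(1 + n, n.+1)) *m T0)
    (col_mx (usubmx (Q0 : 'M[R]_(1 + n.+1, n.+2)))
            (dsubmx (Q' : 'M[R]_(1 + n, n.+1)) *m T0)) : 'M[R]_(1 + (1 + n), n.+2).

Lemma cylinder_frame_point (s t : R) (z : 'rV[R]_n) :
  frame_point cylinder_frame s (row_mx t%:M z : 'rV[R]_(1 + n)) =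
  frame_point Q0 t (frame_point Q' s z).
Proof.
rewrite /frame_point /cylinder_frame.
have -> : Q0 = col_mx (usubmx (Q0 : 'M[R]_(1 + n.+1, n.+2)))
    (dsubmx (Q0 : 'M[R]_(1 + n.+1, n.+2))) by rewrite vsubmxK.
have E : (row_mx s%:M z : 'rV[R]_(1 + n)) *m Q' =
    s%:M *m usubmx (Q' : 'M[R]_(1 + n, n.+1)) + z *m dsubmx (Q' : 'M[R]_(1 + n, n.+1)).
  by rewrite -mul_row_col vsubmxK.
rewrite E !mul_row_col col_mxKu col_mxKd mulmxDl !mulmxA.
by rewrite (mul_row_col t%:M z) mulmxA addrCA.
Qed.

Lemma orthomx_cylinder_frame : orthomx cylinder_frame.
Proof.
apply: orthomx_of_isometry => u v.
have dec (x : 'rV[R]_n.+2) : exists s t z,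
    x = (row_mx s%:M (row_mx t%:M z : 'rV[R]_(1 + n)) : 'rV[R]_(1 + n.+1)).
  exists (lsubmx (x : 'rV[R]_(1 + n.+1)) 0 0),
    (lsubmx (rsubmx (x : 'rV[R]_(1 + n.+1)) : 'rV[R]_(1 + n)) 0 0),
    (rsubmx (rsubmx (x : 'rV[R]_(1 + n.+1)) : 'rV[R]_(1 + n))).
  by rewrite -!mx11_scalar !hsubmxK.
have [s [t [z ->]]] := dec u; have [s' [t' [z' ->]]] := dec v.
rewrite -![_ *m cylinder_frame]/(frame_point cylinder_frame _ _).
rewrite !cylinder_frame_point !dot_frame_point// (dot_row_mx s s') (dot_row_mx t t').
by rewrite addrCA.
Qed.

End frame.

End cylinder_frames.

Section slices.
Context {R : realType} {n : nat}.
Implicit Types (z : 'rV[R]_n).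
Local Notation e i := (delta_mx 0 i).

Definition slice_point z : 'rV[R]_n.+1 := (row_mx 0 z : 'rV[R]_(1 + n)).

Lemma slice_pointE : slice_point = (fun z => z *m (row_mx 0 1%:M : 'M[R]_(n, 1 + n))).
Proof. by apply/funext => z; rewrite mul_mx_row mulmx0 mulmx1. Qed.

Lemma Ck_on_slice_point k U : Ck_on k U slice_point.
Proof. by rewrite slice_pointE; exact: Ck_on_mulmx. Qed.

Lemma derive_slice_point z v : 'D_v slice_point z = slice_point v.
Proof.
rewrite slice_pointE; have di : differentiable (id : 'rV[R]_n -> 'rV[R]_n) z by exact: ex_diff.
by have [_ ->] := derive_mulmx (row_mx 0 1%:M : 'M[R]_(n, 1 + n)) v di; rewrite derive_id.
Qed.

Lemma slice_point_delta i : slice_point (e i) = e (rshift 1 i : 'I_(1 + n)).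
Proof.
rewrite /slice_point; apply/rowP => j; rewrite mxE; case: (@splitP 1 n j) => k jk; rewrite !mxE.
  rewrite eqxx /=; case: eqP => // ji; have := ltn_ord k.
  by rewrite -jk ji.
rewrite !eqxx /=; congr (nat_of_bool _)%:R; apply/eqP/eqP => [ki|ji].
  by apply/val_inj; rewrite /= jk ki.
by apply/val_inj; move: jk; rewrite ji /= /bump /= !add1n => -[].
Qed.

Lemma ball_slice_point z0 (r : R) z : 0 < r -> ball z0 r z ->
  ball (slice_point z0) r (slice_point z).
Proof.
move=> r0; rewrite -!ball_normE /= => zr.
have -> : slice_point z0 - slice_point z = slice_point (z0 - z).
  by rewrite !slice_pointE mulmxBl.
apply: rV_norm_lt => // i; rewrite mxE; case: (@splitP 1 n i) => k _.
  by rewrite mxE normr0.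
exact: le_lt_trans (ler_norm_coord _ _) zr.
Qed.

Lemma sum_split1 (F : 'I_n.+1 -> R) :
  \sum_i F i = F 0 + \sum_(i < n) F (rshift 1 i : 'I_(1 + n)).
Proof.
rewrite big_ord_recl; congr (_ + _); apply: eq_bigr => i _.
by congr F; exact: val_inj.
Qed.

Variables (f : 'rV[R]_n.+1 -> R) (z0 : 'rV[R]_n) (r : R).
Let B := ball (slice_point z0) r.
Let B' := ball z0 r.
Hypotheses (r0 : 0 < r) (fs : smooth_on B f) (fpde : shrinker_graph B f).
Hypothesis f0 : forall y, B y -> 'D_(e 0) f y = 0.

Let Bo : open B. Proof. exact: ball_open. Qed.
Let B'o : open B'. Proof. exact: ball_open. Qed.
Let B'B z : B' z -> B (slice_point z). Proof. exact: ball_slice_point. Qed.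

Lemma smooth_slice : smooth_on B' (f \o slice_point).
Proof. by move=> k; apply: (Ck_on_comp B'o B'B (Ck_on_slice_point k _) (fs k)). Qed.

Lemma derive_slice (g : 'rV[R]_n.+1 -> R) z v : Ck_on 1 B g -> B' z ->
  'D_v (g \o slice_point) z = 'D_(slice_point v) g (slice_point z).
Proof.
move=> g1 Bz.
have ds : differentiable slice_point z.
  by apply: (Ck_on_differentiable (Ck_on_slice_point 1 B')).
apply: etrans (derive_comp v ds (Ck_on_differentiable g1 (B'B Bz))) _.
by rewrite derive_slice_point.
Qed.

Lemma derive2_slice z v w : B' z -> 'D_v ('D_w (f \o slice_point)) z =
  'D_(slice_point v) ('D_(slice_point w) f) (slice_point z).
Proof.
move=> Bz; have E : \forall y \near z, 'D_w (f \o slice_point) y =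
    ('D_(slice_point w) f \o slice_point) y.
  by apply: filterS (open_nbhs_nbhs (conj B'o Bz)) => y By; exact: (derive_slice w (fs 1%N)).
apply: etrans (near_eq_derive v E) _.
exact: (derive_slice v (Ck_on_derive _ (fs 2%N))).
Qed.

Lemma grad_slice z : B' z ->
  grad f (slice_point z) = slice_point (grad (f \o slice_point) z).
Proof.
move=> Bz; apply/rowP => i; rewrite mxE [RHS]mxE; case: (@splitP 1 n i) => k ik.
  rewrite mxE; have -> : i = 0 by apply/val_inj; rewrite /= ik ord1.
  by rewrite f0//; exact: B'B.
rewrite mxE (derive_slice _ (fs 1%N))// slice_point_delta.
by congr ('D_(e _) f _); exact: val_inj.
Qed.

(** Every term of the equation that involves the coordinate 0 contains a derivative of [f] in that
    direction, which vanishes; what remains is the same equation in one dimension less. *)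
Lemma slice_shrinker : shrinker_graph B' (f \o slice_point).
Proof.
move=> z Bz; have Bsz := B'B Bz; rewrite -[RHS](fpde Bsz) /shrinker_graph_expr grad_slice//.
have D0 v : 'D_v ('D_(e 0) f) (slice_point z) = 0.
  have E : \forall y \near slice_point z, 'D_(e 0) f y = cst 0 y.
    by apply: filterS (open_nbhs_nbhs (conj Bo Bsz)) => y; exact: f0.
  by apply: etrans (near_eq_derive v E) _; exact: derive_cst.
have dotE : dot (slice_point (grad (f \o slice_point) z))
    (slice_point (grad (f \o slice_point) z)) =
    dot (grad (f \o slice_point) z) (grad (f \o slice_point) z).
  rewrite /slice_point -(raddf0 (@scalar_mx R 1)).
  by rewrite (dot_row_mx 0 0) mulr0 add0r.
have lapE : laplacian f (slice_point z) = laplacian (f \o slice_point) z.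
  apply: etrans (sum_split1 _) _.
  apply: etrans (congr1 (fun t => t + _) (D0 (e 0))) _; rewrite add0r; apply: eq_bigr => i _.
  by apply: etrans _ (esym (derive2_slice (e i) (e i) Bz)); rewrite (slice_point_delta i).
rewrite dotE lapE (derive_slice z (fs 1%N) Bz); congr (_ - _).
have s0 : slice_point (grad (f \o slice_point) z) 0 0 = 0.
  by rewrite mxE; case: splitP => // k _; rewrite mxE.
have sr j : slice_point (grad (f \o slice_point) z) 0 (rshift 1 j : 'I_(1 + n)) =
    grad (f \o slice_point) z 0 j.
  by rewrite /slice_point (row_mxEr (0 : 'rV[R]_1)).
move: s0 sr; set g := slice_point _; set g' := grad _ z => s0 sr.
apply: esym; apply: etrans (sum_split1 _) _.
have mul3 (x1 x2 x3 y1 y2 y3 : R) :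
    x1 = y1 -> x2 = y2 -> x3 = y3 -> x1 * x2 * x3 = y1 * y2 * y3 by move=> -> -> ->.
have H0 : \sum_j g 0 0 * g 0 j * 'D_(e 0) ('D_(e j) f) (slice_point z) = 0.
  by apply: big1 => j _; rewrite s0 !mul0r.
apply: etrans (congr1 (fun t => t + _) H0) _; rewrite add0r; apply: eq_bigr => i _.
apply: etrans (sum_split1 _) _; rewrite s0 mulr0 mul0r add0r.
apply: eq_bigr => j _; apply: mul3 (sr i) (sr j) _.
apply: etrans _ (esym (derive2_slice (e i) (e j) Bz)).
by rewrite (slice_point_delta i) (slice_point_delta j).
Qed.

End slices.

Section subtypes.
Context {M : topologicalType} (S : set M).

Lemma continuous_to_subtype (T : topologicalType) (g : T -> set_type S) x :
  {for x, continuous (fun y => set_val (g y))} -> {for x, continuous g}.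
Proof.
move=> gx W [_ /= [] [W0 oW0 <-] /= Wgx WW].
have nW : nbhs (set_val (g x)) W0 by exact: open_nbhs_nbhs.
have H : \forall y \near x, W0 (set_val (g y)) := gx _ nW.
by apply: filterS H => y Wy; exact: WW.
Qed.

Lemma continuous_set_val : continuous (set_val : set_type S -> M).
Proof. exact: initial_continuous. Qed.

Lemma set_type_inj (x y : set_type S) : set_val x = set_val y -> x = y.
Proof. exact: val_inj. Qed.

Lemma hausdorff_subtype : hausdorff_space M -> hausdorff_space (set_type S).
Proof.
rewrite !open_hausdorff => Mh x y xy.
have vxy : set_val x != set_val y by apply: contra xy => /eqP/set_type_inj ->.
have [[U1 U2] /= [/set_mem U1x /set_mem U2y] [U1o U2o /eqP U12]] := Mh _ _ vxy.
exists (set_val @^-1` U1, set_val @^-1` U2) => /=; first by split; apply/mem_set.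
split.
- by apply: open_comp => // z _; exact: continuous_set_val.
- by apply: open_comp => // z _; exact: continuous_set_val.
- by apply/eqP; rewrite -preimage_setI U12 preimage_set0.
Qed.

Lemma second_countable_subtype : @second_countable M -> @second_countable (set_type S).
Proof.
move=> [B Bc [Bo Bb]].
exists ((fun U => (set_val : set_type S -> M) @^-1` U) @` B); first exact: (sub_countable (card_image_le _ _) Bc).
split=> [_ [U BU <-]|x W [_ /= [] [W0 oW0 <-] /= Wx WW]].
  by apply: open_comp; [move=> z _; exact: continuous_set_val|exact: Bo].
have nW : nbhs (set_val x) W0 by exact: open_nbhs_nbhs.
have [U [BU Ux] UW] := Bb _ _ nW.
exists (set_val @^-1` U) => /=; first by split=> //; exists U.
by move=> y Uy; apply/WW/UW.
Qed.

End subtypes.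

Section smooth_maps_into.
Context {R : realType} {m : nat} {M : topologicalType}.
Variables (A : set (chart R m M)) (X gamma : M -> 'rV[R]_m.+1).
Hypotheses (HA : smooth_atlas A) (HS : self_shrinker A X) (Hg : is_gauss_map A X gamma).

(* Near each point the charts factor through [X], so that smoothness of a
   continuous map into [M] can be tested after composing with [X]. *)
Lemma smooth_into (V : normedModType R) (U : set V) (g : V -> M) k : open U ->
  (forall x, U x -> {for x, continuous g}) -> Ck_on k U (X \o g) ->
  forall phi, A phi -> Ck_on k (U `&` g @^-1` crange phi) (cinv phi \o g).
Proof.
move=> Uo gc Xg phi Aphi; have [ch _ _] := HA; have [_ Ro _ _ _] := ch phi Aphi.
apply: Ck_on_local => x [Ux gx].
have [Q QQ Qp] := exists_frame HA Hg (g x).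
have [r [f [G [r0 PG Gp]]]] := exists_graph_patch HA HS Hg QQ Qp.
set y0 := tcoord Q (X (g x)) in PG Gp; set B := ball y0 r in PG.
have Bo : open B by exact: ball_open.
have By0 : B y0 by exact: ballxx.
pose D := U `&` g @^-1` (G @` B `&` crange phi).
have Do : open D.
  apply: (@open_preimageI _ _ g U (G @` B `&` crange phi) Uo gc).
  by apply: openI => //; exact: patch_open PG.
have Dx : D x by split=> //; split=> //; exists y0.
have DG z : D z -> B (tcoord Q (X (g z))) /\ G (tcoord Q (X (g z))) = g z.
  by move=> [_ [[y By Gy] _]]; rewrite -Gy (patch_tcoord QQ PG By).
exists D; first exact: open_nbhs_nbhs.
have BGo : open (B `&` G @^-1` crange phi).
  by apply: (@open_preimageI _ _ G B (crange phi) Bo (patch_continuous PG) Ro).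
have tD : Ck_on k D (fun z => tcoord Q (X (g z))).
  by apply: (Ck_on_tcoord Q Do); apply: Ck_on_sub Xg => z [].
have := @Ck_on_comp_rV _ _ _ _ k D (B `&` G @^-1` crange phi)
  (fun z => tcoord Q (X (g z))) (cinv phi \o G) Do BGo.
have DB z : D z -> (B `&` G @^-1` crange phi) (tcoord Q (X (g z))).
  by move=> Dz; have [Bz Gz] := DG z Dz; split=> //; rewrite /= Gz; have [_ []] := Dz.
move=> /(_ DB tD (patch_chart PG Aphi k)); apply: Ck_on_ext => // z /set_mem Dz /=.
by have [_ ->] := DG z Dz.
Qed.

End smooth_maps_into.

(** * The cross section as a self-shrinker, and the product structure of M *)

Section cylinder.
Context {R : realType} {n : nat} {M : topologicalType}.
Variables (A : set (chart R n.+1 M)) (X gamma : M -> 'rV[R]_n.+2).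
Hypotheses (HM : smooth_manifold A) (HS : self_shrinker A X) (Hg : is_gauss_map A X gamma).
Variables (Q0 : 'M[R]_n.+2) (F : R -> M -> M).
Hypotheses (QQ0 : orthomx Q0) (ga : forall p, dot (gamma p) (row 0 Q0) = 0).
Hypotheses (Fc : continuous (fun tq : R * M => F tq.1 tq.2)) (F0 : forall q, F 0 q = q)
  (FX : forall t q, X (F t q) = X q + t *: row 0 Q0)
  (FF : forall s t q, F s (F t q) = F (s + t) q).

Let HA : smooth_atlas A. Proof. by case: HM. Qed.

Let height p := ncoord Q0 (X p).

Lemma height_flow t q : height (F t q) = height q + t.
Proof.
by rewrite /height FX /ncoord dotDl dotZl row0_frame_point dot_frame_point// dot0l addr0 !mulr1.
Qed.

Definition cross_section : set M := [set p | ncoord Q0 (X p) = 0].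
Local Notation M' := (set_type cross_section).

Lemma section_projP p : F (- height p) p \in cross_section.
Proof. by apply/mem_set; rewrite /cross_section /= -/(height _) height_flow subrr. Qed.

Definition section_proj p : M' := exist (fun x => x \in cross_section) _ (section_projP p).

Lemma set_val_section_proj p : set_val (section_proj p) = F (- height p) p.
Proof. by rewrite set_valE. Qed.

Definition section_map (q : M') : 'rV[R]_n.+1 := tcoord Q0 (X (set_val q)).

Lemma height_section (q : M') : height (set_val q) = 0.
Proof. exact: (set_mem (valP q)). Qed.

Lemma section_projK p : height p = 0 -> set_val (section_proj p) = p.
Proof. by move=> hp; rewrite set_val_section_proj hp oppr0 F0. Qed.

Lemma X_section (q : M') : X (set_val q) = frame_point Q0 0 (section_map q).
Proof. by rewrite -(height_section q) frame_coordK. Qed.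

Lemma section_map_proj p : section_map (section_proj p) = tcoord Q0 (X p).
Proof.
rewrite /section_map set_val_section_proj FX tcoordD tcoordZ.
by rewrite row0_frame_point tcoord_frame_point// scaler0 addr0.
Qed.

Let Xc : continuous X. Proof. exact: immersion_continuous HA HS. Qed.

Lemma height_continuous : continuous height.
Proof.
move=> p; have Xpc := @Xc p.
exact: (continuous_dot Xpc (@cst_continuous _ _ (row 0 Q0) p)).
Qed.

Lemma section_proj_continuous : continuous section_proj.
Proof.
move=> p; apply: continuous_to_subtype.
have -> : (fun y => set_val (section_proj y)) = (fun y => F (- height y) y).
  by apply/funext => y; exact: set_val_section_proj.
have c1 : {for p, continuous (fun p => - height p)}.
  by apply: (@continuousN _ _ _ height); exact: height_continuous.
have pc := continuous_pair c1 (@cvg_id _ (nbhs p)).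
apply: (@continuous_comp _ _ _ (fun p => (- height p, p)) (fun tq => F tq.1 tq.2) p pc).
exact: Fc.
Qed.

Lemma section_map_continuous : continuous section_map.
Proof.
move=> q; apply: (@continuous_comp _ _ _ set_val (fun p => tcoord Q0 (X p))).
  exact: continuous_set_val.
exact: (tcoord_immersion_continuous HA HS).
Qed.

(** The inverse of such a chart is a linear projection of [section_map] on the whole cross section,
    so that smoothness in these charts is smoothness after composing with [section_map]. *)
Record slice_chart (phi : chart R n M') (Q' : 'M[R]_n.+1) (f : 'rV[R]_n -> R) : Prop :=
  SliceChart {
    slice_orthomx : orthomx Q' ;
    slice_open : open (cdom phi) ;
    slice_range_open : open (crange phi) ;
    slice_smooth : smooth_on (cdom phi) f ;
    slice_pde : shrinker_graph (cdom phi) f ;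
    slice_continuous : forall z, cdom phi z -> {for z, continuous (cmap phi)} ;
    slice_cinv : forall q, cinv phi q = tcoord Q' (section_map q) ;
    slice_cmap : forall z, cdom phi z -> section_map (cmap phi z) = graph_map Q' f z }.

Definition slice_atlas : set (chart R n M') :=
  [set phi | exists Q' f, slice_chart phi Q' f].

(** The normal of M is orthogonal to the axis, so it is also the normal of the cross section. A
    patch of M in the frame adapted to both is restricted to the slice where the axial coordinate is
    0. *)
Lemma exists_slice_chart (q : M') : exists2 phi, slice_atlas phi & crange phi q.
Proof.
pose p := set_val q; have g1 := gauss_unit HA Hg p.
pose nu' := tcoord Q0 (gamma p).
have gE : frame_point Q0 0 nu' = gamma p.
  have <- : ncoord Q0 (gamma p) = 0 by rewrite /ncoord ga.
  exact: frame_coordK.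
have nu1 : dot nu' nu' = 1.
  by have := dot_frame_point 0 0 nu' nu' QQ0; rewrite gE g1 mulr0 add0r.
have [Q' [QQ' Qnu]] := Householder nu1.
pose Q := cylinder_frame Q0 Q'.
have QQ : orthomx Q by exact: orthomx_cylinder_frame.
have sliceE s z : frame_point Q s (slice_point z) = frame_point Q0 0 (frame_point Q' s z).
  by rewrite -cylinder_frame_point /slice_point raddf0.
have sl0 : slice_point (0 : 'rV[R]_n) = 0 by rewrite slice_pointE mul0mx.
have Qp : row 0 Q = gamma p.
  by rewrite row0_frame_point -sl0 sliceE -row0_frame_point Qnu gE.
have [r [f [G [r0 PG Gp]]]] := exists_graph_patch HA HS Hg QQ Qp.
pose z0 := tcoord Q' (section_map q).
have y0E : tcoord Q (X p) = slice_point z0.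
  rewrite /p X_section -{1}(frame_coordK (section_map q) QQ') -sliceE.
  exact: tcoord_frame_point.
rewrite y0E in PG Gp; set B := ball (slice_point z0) r in PG.
(* The first coordinate of the plane is the axis, which is tangent to M everywhere. *)
have f0 y : B y -> 'D_(delta_mx 0 0) f y = 0.
  move=> By; have := patch_normal_component QQ PG 0 (delta_mx 0 0) By.
  have -> : frame_point Q 0 (delta_mx 0 0) = row 0 Q0.
    have -> : (delta_mx 0 0 : 'rV[R]_n.+1) = (row_mx 1%:M 0 : 'rV[R]_(1 + n)).
      apply/rowP => j; rewrite !mxE; case: splitP => k jk; rewrite !mxE.
        by rewrite !ord1 !eqxx /=; have -> : j == 0 by apply/eqP/val_inj; rewrite /= jk ord1.
      by have -> : j == 0 = false by apply/negbTE/eqP => j0; move: jk; rewrite j0.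
    rewrite cylinder_frame_point row0_frame_point; congr frame_point.
    by rewrite /frame_point raddf0 row_mx0 mul0mx.
  by rewrite ga mulr0 sub0r => /eqP; rewrite oppr_eq0 => /eqP.
pose f' := f \o @slice_point R n.
pose phi := Chart (ball z0 r) (fun z => section_proj (G (slice_point z)))
  (fun q => tcoord Q' (section_map q)).
have BB z : ball z0 r z -> B (slice_point z) by exact: ball_slice_point.
have XG z : ball z0 r z -> X (G (slice_point z)) = frame_point Q0 0 (graph_map Q' f' z).
  by move=> /BB Bz; rewrite (patch_X PG Bz) /graph_map sliceE.
have hG z : ball z0 r z -> height (G (slice_point z)) = 0.
  by move=> Bz; rewrite /height XG// ncoord_frame_point.
have vphi z : ball z0 r z -> set_val (cmap phi z) = G (slice_point z).
  by move=> Bz; rewrite section_projK//; exact: hG.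
have bo : open (ball z0 r) by exact: ball_open.
have Gs z : ball z0 r z -> {for z, continuous (fun z => G (slice_point z))}.
  move=> Bz; apply: (@continuous_comp _ _ _ (@slice_point R n) G).
    exact: (Ck_on_continuous (Ck_on_slice_point 0 (ball z0 r)) Bz).
  by apply: (patch_continuous PG); exact: BB.
exists phi; last first.
  exists z0; first exact: ballxx.
  by apply: set_type_inj; rewrite vphi ?Gp//; exact: ballxx.
exists Q', f'; split=> //.
- pose D := (set_val : M' -> M) @^-1` (G @` B).
  have Do : open D.
    by apply: open_comp; [move=> x _; exact: continuous_set_val|exact: patch_open PG].
  have -> : crange phi = D `&` (fun q => tcoord Q' (section_map q)) @^-1` (ball z0 r).
    apply/seteqP; split=> [_ [z Bz <-]|q' [[y By Gy] Bq']].
      split; first by exists (slice_point z); [exact: BB|rewrite vphi].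
      rewrite /= /section_map vphi// XG// tcoord_frame_point//.
      by rewrite tcoord_frame_point.
    exists (tcoord Q' (section_map q')) => //; apply: set_type_inj; rewrite vphi//.
    rewrite -Gy; congr G; rewrite -(patch_tcoord QQ PG By) Gy X_section.
    rewrite -{2}(frame_coordK (section_map q') QQ') -sliceE.
    by rewrite tcoord_frame_point.
  apply: (@open_preimageI _ _ (fun q => tcoord Q' (section_map q)) D (ball z0 r) Do _ bo).
  move=> q' _; apply: (@continuous_comp _ _ _ section_map (tcoord Q')).
    exact: section_map_continuous.
  exact: tcoord_continuous.
- by move=> k; exact: (smooth_slice r0 (patch_smooth PG)).
- exact: (slice_shrinker r0 (patch_smooth PG) (patch_shrinker PG) f0).
- move=> z Bz; apply: continuous_to_subtype.
  apply: (near_eq_continuous (f := fun z => G (slice_point z))); last exact: Gs.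
  by apply: filterS (open_nbhs_nbhs (conj bo Bz)) => z' /vphi ->.
- by move=> z Bz; rewrite /section_map vphi// XG// tcoord_frame_point.
Qed.

Lemma slice_is_chart phi Q' f : slice_chart phi Q' f -> is_chart phi.
Proof.
move=> S; split.
- exact: slice_open S.
- exact: slice_range_open S.
- by apply: continuous_in_subspaceT => z /set_mem Dz; exact: (slice_continuous S Dz).
- apply: continuous_subspaceT => q.
  have -> : cinv phi = (fun q => tcoord Q' (section_map q)).
    by apply/funext => q'; exact: slice_cinv S q'.
  apply: (@continuous_comp _ _ _ section_map (tcoord Q')).
    exact: section_map_continuous.
  exact: tcoord_continuous.
- move=> z Dz; rewrite (slice_cinv S) (slice_cmap S Dz) tcoord_frame_point//.
  exact: slice_orthomx S.
Qed.

Lemma slice_section_smooth phi Q' f : slice_chart phi Q' f ->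
  smooth_on (cdom phi) (section_map \o cmap phi).
Proof.
move=> S k; have Do := slice_open S.
have := Ck_on_frame_point Q' Do (slice_smooth S k) (Ck_on_id k _).
by apply: Ck_on_ext => // z /set_mem Dz; rewrite /= (slice_cmap S Dz).
Qed.

Lemma smooth_into_section (V : normedModType R) (U : set V) (g : V -> M') k : open U ->
  Ck_on k U (section_map \o g) ->
  forall phi, slice_atlas phi -> Ck_on k U (cinv phi \o g).
Proof.
move=> Uo gU phi [Q' [f S]]; have := Ck_on_tcoord Q' Uo gU.
by apply: Ck_on_ext => // x _; rewrite /= (slice_cinv S).
Qed.

Lemma slice_manifold : smooth_manifold slice_atlas.
Proof.
have [Mh Msc _] := HM; split.
- exact: hausdorff_subtype.
- exact: second_countable_subtype.
- split.
  + by move=> phi [Q' [f S]]; exact: slice_is_chart S.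
  + exact: exists_slice_chart.
  + move=> phi psi [Q' [f S]] Apsi k.
    have Do := slice_open S.
    apply: (Ck_on_sub (O := cdom phi)); first by move=> z [].
    exact: (smooth_into_section Do (slice_section_smooth S k)).
Qed.

Lemma slice_self_shrinker : self_shrinker slice_atlas section_map.
Proof.
have id_unit (z : 'rV[R]_n) : jacobian id z \in unitmx.
  suff -> : jacobian id z = 1%:M by exact: unitmx1.
  have di : differentiable (id : 'rV[R]_n -> 'rV[R]_n) z by exact: ex_diff.
  by apply/row_matrixP => i; rewrite jacobianE// derive_id row1.
split=> [phi [Q' [f S]]|phi [Q' [f S]] z Dz].
  split; first exact: slice_section_smooth S.
  move=> z Dz; exact: (row_free_graph_param (slice_open S) Dz (fun _ => id)
    (slice_smooth S 2%N) (Ck_on_id 2 _) (slice_orthomx S) (slice_cmap S) (id_unit z)).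
apply/(graph_param_shrinker (slice_open S) Dz (fun _ => id)
    (slice_smooth S 2%N) (Ck_on_id 2 _) (slice_orthomx S) (slice_cmap S) (id_unit z)).
exact: slice_pde S z Dz.
Qed.

Definition cylinder_map (tq : R * M') : M := F tq.1 (set_val tq.2).
Definition cylinder_inv (p : M) : R * M' := (height p, section_proj p).

Lemma X_cylinder_map t q : X (cylinder_map (t, q)) = frame_point Q0 t (section_map q).
Proof.
rewrite /cylinder_map FX X_section row0_frame_point -frame_point_linear.
by rewrite add0r mulr1 scaler0 addr0.
Qed.

Lemma cylinder_map_continuous : continuous cylinder_map.
Proof.
move=> [t q].
have c1 : {for (t, q), continuous (fun tq : R * M' => tq.1)}.
  exact: (@cvg_fst _ _ (nbhs t) (nbhs q) _).
have c2 : {for (t, q), continuous (fun tq : R * M' => set_val tq.2)}.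
  apply: (@continuous_comp _ _ _ (fun tq : R * M' => tq.2) set_val).
    exact: (@cvg_snd _ _ (nbhs t) (nbhs q) _).
  exact: continuous_set_val.
apply: (@continuous_comp _ _ _ (fun tq : R * M' => (tq.1, set_val tq.2))
  (fun tq => F tq.1 tq.2) (t, q) (continuous_pair c1 c2)); exact: Fc.
Qed.

Lemma cylinder_inv_continuous : continuous cylinder_inv.
Proof.
by move=> p; apply: continuous_pair; [exact: height_continuous|exact: section_proj_continuous].
Qed.

Lemma cylinder_mapK : cancel cylinder_map cylinder_inv.
Proof.
move=> [t q]; rewrite /cylinder_inv /cylinder_map /=.
rewrite height_flow height_section add0r; congr (_, _); apply: set_type_inj.
by rewrite set_val_section_proj height_flow height_section add0r FF addNr F0.
Qed.

Lemma cylinder_invK : cancel cylinder_inv cylinder_map.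
Proof.
move=> p; rewrite /cylinder_map /cylinder_inv /= set_val_section_proj.
by rewrite FF subrr F0.
Qed.

(** Neither direction differentiates the flow. The map is tested after composing with X, where it is
    explicit, and the coordinates of the inverse are linear functions of X. *)
Lemma cylinder_diffeomorphism : diffeomorphism (line_atlas slice_atlas) A cylinder_map.
Proof.
have rT k : Ck_on k setT (fun y : 'rV[R]_n.+1 => rsubmx (y : 'rV[R]_(1 + n))).
  apply/(Ck_on_rV k _ openT) => i.
  have := Ck_on_coord k [set: 'rV[R]_n.+1] (rshift 1 i : 'I_(1 + n)).
  by apply: Ck_on_ext; [exact: openT|move=> y _; rewrite mxE].
exists cylinder_inv; split; [exact: cylinder_mapK|exact: cylinder_invK| |].
- split; first exact: cylinder_map_continuous.
  move=> _ psi [phi [Q' [f S]] <-] Apsi k.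
  pose U := [set y : 'rV[R]_n.+1 | cdom phi (rsubmx (y : 'rV[R]_(1 + n)))].
  have Uo : open U.
    by apply: open_comp; [move=> z _; exact: (Ck_on_continuous (rT 0%N) I)|exact: slice_open S].
  pose g (y : 'rV[R]_n.+1) := cylinder_map (lsubmx (y : 'rV[R]_(1 + n)) 0 0,
     cmap phi (rsubmx (y : 'rV[R]_(1 + n)))).
  have rU : Ck_on k U (fun y : 'rV[R]_n.+1 => rsubmx (y : 'rV[R]_(1 + n))).
    exact: (Ck_on_sub _ (rT k)).
  have lU : Ck_on k U (fun y : 'rV[R]_n.+1 => lsubmx (y : 'rV[R]_(1 + n)) 0 0).
    have := Ck_on_coord k U (lshift n (0 : 'I_1) : 'I_(1 + n)).
    by apply: Ck_on_ext => // y _; rewrite mxE.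
  have gc y : U y -> {for y, continuous g}.
    move=> Uy; have c1 := Ck_on_continuous lU Uy.
    have c2 := continuous_comp (Ck_on_continuous rU Uy) (slice_continuous S Uy).
    exact: (continuous_comp (continuous_pair c1 c2) (@cylinder_map_continuous _)).
  have Xg : Ck_on k U (X \o g).
    have sU : Ck_on k U (fun y => section_map (cmap phi (rsubmx (y : 'rV[R]_(1 + n))))).
      exact: (Ck_on_comp_rV Uo (slice_open S) (fun _ => id) rU (slice_section_smooth S k)).
    have := Ck_on_frame_point Q0 Uo lU sU; apply: Ck_on_ext => // y _.
    by rewrite /= X_cylinder_map.
  exact: (smooth_into HA HS Hg Uo gc Xg Apsi).
- split; first exact: cylinder_inv_continuous.
  move=> psi _ Apsi [phi [Q' [f S]] <-] k.
  have [ch _ _] := HA; have [Do _ _ _ _] := ch psi Apsi.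
  have [HX _] := HS; have [Xs _] := HX psi Apsi.
  have hs := Ck_on_ncoord Q0 Do (Xs k).
  have ts := Ck_on_tcoord Q' Do (Ck_on_tcoord Q0 Do (Xs k)).
  apply: (Ck_on_sub (O := cdom psi)); first by move=> z [].
  apply/(Ck_on_rV k _ Do) => i.
  rewrite /=; case: (@splitP 1 n i) => j ij.
    apply: Ck_on_ext hs => // x _ /=.
    have -> : i = lshift n j by exact: val_inj.
    by rewrite (@row_mxEl R 1 1 n) ord1 mxE eqxx mulr1n.
  apply: Ck_on_ext ((Ck_on_rV k _ Do).1 ts j) => // x _ /=.
  have -> : i = rshift 1 j by exact: val_inj.
  by rewrite (@row_mxEr R 1 1 n) (slice_cinv S) section_map_proj.
Qed.

End cylinder.

(** * Completeness of the cross section *)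

Lemma within_continuous_comp (S T W : topologicalType) (D : set S) (f : S -> T) (g : T -> W) :
  {within D, continuous f} -> continuous g -> {within D, continuous (g \o f)}.
Proof. by move=> fc gc x; exact: (continuous_comp (fc x) (gc _)). Qed.

Section curve_lengths.
Context {R : realType}.
Implicit Types (s : seq R).

Definition interior_times s : set R := `]0, 1[%classic `\` [set` s].

Lemma measurable_finite_set (D : set R) : finite_set D -> measurable D.
Proof. by move=> /finite_set_countable Dc; apply: countable_measurable Dc => t. Qed.

Lemma interior_times_open s : open (interior_times s).
Proof.
rewrite /interior_times setDE; apply: openI; first exact: interval_open.
rewrite openC; have /accessible_finite_set_closed := @hausdorff_accessible R (@Rhausdorff R).
by apply; exact: finite_seq.
Qed.

Definition speed N (x : R -> 'rV[R]_N) (t : R) : R := Num.sqrt (dot (derive1 x t) (derive1 x t)).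

(** The speed is continuous on the open set of regular times, and on the finite remainder any
    function is measurable. *)
Lemma speed_measurable N (x : R -> 'rV[R]_N) s :
  Ck_on 1 (interior_times s) x -> measurable_fun (`[0, 1]%classic : set R) (speed x).
Proof.
move=> xs; pose E := `[0, 1]%classic `\` interior_times s.
have Do := @interior_times_open s.
have sub : interior_times s `<=` `[0, 1]%classic.
  by move=> t [+ _]; exact: subset_itv_oo_cc.
have Ef : finite_set E.
  apply: (@sub_finite_set _ _ [set` 0 :: 1 :: s]); last exact: finite_seq.
  move=> t [/=]; rewrite !in_itv /= !inE => /andP[t0 t1] nt.
  case: (eqVneq t 0) => //= tn0; case: (eqVneq t 1) => //= tn1.
  apply: contrapT => ns; apply: nt; split => //=.
  by rewrite in_itv /= !lt_neqAle t0 t1 eq_sym tn0 tn1.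
have Em (D : set R) : D `<=` E -> measurable D.
  by move=> DE; apply: measurable_finite_set; exact: sub_finite_set Ef.
have x'c : Ck_on 0 (interior_times s) (derive1 x : R -> 'rV[R]_N).
  by apply: (Ck_on_ext Do _ (Ck_on_derive (1 : R) xs)) => u _; rewrite derive1E.
rewrite -(setDUK sub); apply/measurable_funU; first exact: measurable_realfun.open_measurable.
  exact: Em.
split; last by move=> _ Y _; apply: Em => t [].
apply: measurable_realfun.open_continuous_measurable_fun => // t /set_mem Dt.
have xc := Ck_on_continuous x'c Dt.
exact: (continuous_comp (continuous_dot xc xc) (@sqrt_continuous _ _)).
Qed.

(* At the finitely many excluded times the derivatives are junk values. *)
Lemma speed_integral_le N N' (x : R -> 'rV[R]_N) (y : R -> 'rV[R]_N') s :
  Ck_on 1 (interior_times s) x -> Ck_on 1 (interior_times s) y ->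
  (forall t, interior_times s t -> speed x t <= speed y t) ->
  (\int[lebesgue_measure]_(t in `[0%R, 1%R]%classic) (speed x t)%:E <=
   \int[lebesgue_measure]_(t in `[0%R, 1%R]%classic) (speed y t)%:E)%E.
Proof.
move=> xs ys xy; set I := `[0, 1]%classic.
pose N0 := [set` 0 :: 1 :: s].
have N0f : finite_set N0 by exact: finite_seq.
have N0m := measurable_finite_set N0f.
have N00 := countable_lebesgue_measure0 (finite_set_countable N0f).
have Im : measurable I by exact: measurable_itv.
have sub t : (I `\` N0) t -> interior_times s t.
  rewrite /I /N0 => -[] /=; rewrite in_itv /= !inE => /andP[t0 t1] /negP.
  rewrite !negb_or => /and3P[tn0 tn1 /negP ts]; split=> //=.
  by rewrite in_itv /= !lt_neqAle t0 t1 eq_sym tn0 tn1.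
have xm := (measurable_realfun.measurable_EFinP _ _).2 (speed_measurable xs).
have ym := (measurable_realfun.measurable_EFinP _ _).2 (speed_measurable ys).
rewrite (@ge0_negligible_integral _ _ _ lebesgue_measure I N0)//; last first.
  by move=> t _; rewrite lee_fin sqrtr_ge0.
rewrite [leRHS](@ge0_negligible_integral _ _ _ lebesgue_measure I N0)//; last first.
  by move=> t _; rewrite lee_fin sqrtr_ge0.
apply: ge0_le_integral.
- exact: measurableD.
- by move=> t _; rewrite lee_fin sqrtr_ge0.
- by apply: measurable_funS xm => // t [].
- by apply: measurable_funS ym => // t [].
- by move=> t /sub Dt; rewrite lee_fin; exact: xy.
Qed.

End curve_lengths.

Lemma riemannian_dist_le {R : realType} {n N n' N' : nat} {M M' : topologicalType}
  (A : set (chart R n M)) (X : M -> 'rV[R]_N) (A' : set (chart R n' M')) (Y : M' -> 'rV[R]_N')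
  (g : M -> M') p q :
  (forall c, piecewise_C1 A c ->
     piecewise_C1 A' (g \o c) /\ (curve_length Y (g \o c) <= curve_length X c)%E) ->
  (riemannian_dist A' Y (g p) (g q) <= riemannian_dist A X p q)%E.
Proof.
move=> gc; apply: le_ereal_inf_tmp => _ [c [/gc[gcs gl] c0 c1] <-].
apply: le_trans gl; apply: ereal_inf_lbound; exists (g \o c) => //.
by split=> //=; [rewrite c0|rewrite c1].
Qed.

Section piecewise_smooth_curves.
Context {R : realType} {n N : nat} {M : topologicalType}.
Variables (A : set (chart R n M)) (X : M -> 'rV[R]_N).
Hypotheses (HA : smooth_atlas A) (HX : immersion A X).

Lemma interior_continuous (c : R -> M) s t : {within `[0, 1]%classic, continuous c} ->
  interior_times s t -> {for t, continuous c}.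
Proof.
have io : open (`]0, 1[%classic : set R) by exact: interval_open.
move=> cc [It _]; apply: within_continuous_at io _ It.
by apply: continuous_subspaceW cc; exact: subset_itv_oo_cc.
Qed.

(** Regularity of [c] is stated chart by chart; continuity of [c] makes the preimages of chart
    ranges open at regular times, where the chain rule then applies. *)
Lemma piecewise_C1_immersion (c : R -> M) : piecewise_C1 A c ->
  exists s, Ck_on 1 (interior_times s) (X \o c).
Proof.
move=> [cc [s cs]]; exists s; apply: Ck_on_local => t It.
have [ch cov _] := HA; have [phi Aphi pt] := cov (c t).
have [Do Ro _ _ _] := ch phi Aphi; have [Xs _] := HX Aphi.
pose D := interior_times s `&` c @^-1` crange phi.
have Dopen : open D.
  apply: open_preimageI => //; first exact: interior_times_open.
  by move=> u; exact: interior_continuous.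
exists D; first by apply: open_nbhs_nbhs.
have H := Ck_on_comp_rV Dopen Do _ (cs phi Aphi) (Xs 1%N).
have DK u : D u -> cdom phi (cinv phi (c u)) /\ cmap phi (cinv phi (c u)) = c u.
  by move=> [_ Du]; exact: chart_invK (ch phi Aphi) Du.
apply: (Ck_on_ext Dopen _ (H _)); last by move=> u /DK[].
by move=> u /set_mem/DK[_ /= ->].
Qed.

End piecewise_smooth_curves.

Section cylinder_completeness.
Context {R : realType} {n : nat} {M : topologicalType}.
Variables (A : set (chart R n.+1 M)) (X gamma : M -> 'rV[R]_n.+2).
Hypotheses (HM : smooth_manifold A) (HS : self_shrinker A X) (Hg : is_gauss_map A X gamma).
Variables (Q0 : 'M[R]_n.+2) (F : R -> M -> M).
Hypotheses (QQ0 : orthomx Q0) (ga : forall p, dot (gamma p) (row 0 Q0) = 0).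
Hypotheses (Fc : continuous (fun tq : R * M => F tq.1 tq.2)) (F0 : forall q, F 0 q = q)
  (FX : forall t q, X (F t q) = X q + t *: row 0 Q0).

Local Notation A' := (@slice_atlas R n M X Q0).
Local Notation Y := (@section_map R n M X Q0).
Local Notation proj := (@section_proj R n M X Q0 F QQ0 FX).
Let HA : smooth_atlas A. Proof. by case: HM. Qed.
Let HA' : smooth_atlas A'.
Proof. by have [_ _] := slice_manifold HM HS Hg QQ0 ga F0 FX. Qed.

(** Pythagoras for the velocity, split into its axial and transverse parts. For a curve in the cross
    section the axial part is zero; projecting a curve of M discards it. *)
Lemma speed_tcoord (x : R -> 'rV[R]_n.+2) t : differentiable x t ->
  dot (derive1 x t) (derive1 x t) =
  (ncoord Q0 (derive1 x t)) ^+ 2 +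
  dot (derive1 (fun t => tcoord Q0 (x t)) t) (derive1 (fun t => tcoord Q0 (x t)) t).
Proof.
move=> xd.
have -> : derive1 (fun t => tcoord Q0 (x t)) t = tcoord Q0 (derive1 x t).
  by rewrite !derive1E; exact: derive_tcoord.
by rewrite -{1 2}(frame_coordK (derive1 x t) QQ0) dot_frame_point// expr2.
Qed.

Lemma inclusion_curve c : piecewise_C1 A' c ->
  piecewise_C1 A (set_val \o c) /\ (curve_length X (set_val \o c) <= curve_length Y c)%E.
Proof.
move=> cs; have [cc _] := cs.
have [s Ys] := piecewise_C1_immersion HA' (slice_self_shrinker X Q0).1 cs.
have Do := @interior_times_open R s.
have XE : X \o (set_val \o c) = fun t => frame_point Q0 0 (Y (c t)).
  by apply/funext => t /=; rewrite (X_section QQ0).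
have Xs : Ck_on 1 (interior_times s) (X \o (set_val \o c)).
  by rewrite XE; exact: (Ck_on_frame_point Q0 Do (Ck_on_cst _ _ _) Ys).
have vc : {within `[0, 1]%classic, continuous (set_val \o c)}.
  exact: within_continuous_comp cc (@continuous_set_val _ _).
split.
  split=> //; exists s => phi Aphi.
  apply: (smooth_into HA HS Hg Do _ Xs Aphi) => t; exact: interior_continuous.
apply: (speed_integral_le Xs Ys) => t It; apply: ler_wsqrtr.
have xd := Ck_on_differentiable Xs It.
rewrite (speed_tcoord xd).
have -> : (fun t => tcoord Q0 ((X \o (set_val \o c)) t)) = Y \o c.
  by apply/funext => u /=; rewrite (X_section QQ0) tcoord_frame_point.
suff -> : ncoord Q0 (derive1 (X \o (set_val \o c)) t) = 0 by rewrite expr0n add0r.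
have := @derive_dot R _ _ (X \o (set_val \o c)) (fun=> row 0 Q0) t 1 xd (differentiable_cst _ _).
rewrite derive_cst dot0r addr0 => E; rewrite derive1E; apply: etrans (esym E) _.
have -> : (fun y => dot ((X \o (set_val \o c)) y) (row 0 Q0)) = fun=> 0.
  by apply/funext => u; exact: height_section.
exact: derive_cst.
Qed.

Lemma projection_curve c : piecewise_C1 A c ->
  piecewise_C1 A' (proj \o c) /\ (curve_length Y (proj \o c) <= curve_length X c)%E.
Proof.
move=> cs; have [cc _] := cs; have [HX _] := HS.
have [s Xs] := piecewise_C1_immersion HA HX cs.
have Do := @interior_times_open R s.
have YE : Y \o (proj \o c) = fun t => tcoord Q0 ((X \o c) t).
  by apply/funext => t /=; rewrite section_map_proj.
have Ys : Ck_on 1 (interior_times s) (Y \o (proj \o c)).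
  by rewrite YE; exact: Ck_on_tcoord.
split.
  split.
    have pc : continuous proj by move=> p; exact: (section_proj_continuous HM HS Fc).
    exact: within_continuous_comp cc pc.
  exists s => phi Aphi.
  apply: (Ck_on_sub (O := interior_times s)); first by move=> t [].
  exact: (smooth_into_section Do Ys Aphi).
apply: (speed_integral_le Ys Xs) => t It; apply: ler_wsqrtr.
by rewrite (speed_tcoord (Ck_on_differentiable Xs It)) YE lerDr sqr_ge0.
Qed.

(** A Cauchy sequence of the cross section is Cauchy in M through the inclusion. The limit in M is
    projected back, and the projection fixes the terms of the sequence. *)
Lemma slice_complete : complete_immersion A X -> complete_immersion A' Y.
Proof.
move=> Ac u uC.
have [e e0|p up] := Ac (set_val \o u).
  have [K uK] := uC e e0; exists K => i j Ki Kj; apply: le_lt_trans (uK i j Ki Kj).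
  exact: (riemannian_dist_le (g := set_val) _ _ inclusion_curve).
exists (proj p) => e /up[K uK]; exists K => i Ki; apply: le_lt_trans (uK i Ki).
have <- : proj (set_val (u i)) = u i.
  apply: set_type_inj; rewrite section_projK//; exact: height_section.
exact: (riemannian_dist_le (g := proj) _ _ projection_curve).
Qed.

End cylinder_completeness.

Theorem theorem3p1 (R : realType) (n : nat) (M : topologicalType)
    (A : set (chart R n.+1 M)) (X gamma : M -> 'rV[R]_n.+2) :
  smooth_manifold A -> oriented_atlas A ->
  [set: M] !=set0 -> connected [set: M] ->
  self_shrinker A X -> complete_immersion A X -> proper_map X ->
  is_gauss_map A X gamma ->
  ((exists2 a : 'rV[R]_n.+2,
      unit_sphere a & range gamma `<=` open_hemisphere a) ->
   is_hyperplane X) /\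
  ((exists2 a : 'rV[R]_n.+2,
      unit_sphere a & range gamma `<=` closed_hemisphere a) ->
   is_hyperplane X \/ is_cylinder A X).
Proof.
move=> HM _ [p0 _] Mc HS Acomplete Xp Hg; have [Mh _ HA] := HM.
split=> [[a _ ga]|[a a1 ga]].
  have ga_gt0 p : 0 < dot (gamma p) a by have [] : open_hemisphere a (gamma p) by apply: ga; exists p.
  have [[e ge]|ga0] := gauss_map_dichotomy HA HS Hg Mc p0 Xp (fun p => ltW (ga_gt0 p)).
    exact: (flat_is_hyperplane HA HS Hg Mh Xp Mc p0 ge).
  (* In an open hemisphere the component along the pole is positive, which excludes the tangent
     alternative. *)
  by have := ga_gt0 p0; rewrite ga0 ltxx.
have ga_ge0 p : 0 <= dot (gamma p) a by have [] : closed_hemisphere a (gamma p) by apply: ga; exists p.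
have [[e ge]|] := gauss_map_dichotomy HA HS Hg Mc p0 Xp ga_ge0.
  by left; exact: (flat_is_hyperplane HA HS Hg Mh Xp Mc p0 ge).
have [Q0 [Qrot <-]] := exists_rotation a1; have [QQ0 _] := Qrot => ga0.
have [F [Fc F0 FX FF]] := translation_flow HA HS Hg Mh Xp ga0.
right; exists (set_type (cross_section X Q0)), (@slice_atlas _ _ _ X Q0), (@section_map _ _ _ X Q0).
exists Q0, (@cylinder_map _ _ _ X Q0 F); split=> //.
- exact: (slice_manifold HM HS Hg QQ0 ga0 F0 FX).
- split; first exact: slice_self_shrinker.
  exact: (slice_complete HM HS Hg QQ0 ga0 Fc F0 FX Acomplete).
- exact: (cylinder_diffeomorphism HM HS Hg QQ0 Fc F0 FX FF).
- exact: (X_cylinder_map QQ0 FX).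
Qed.
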